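(* Let $c>0$ and $d>1$. There exist an integer $D_0=D_0(c,d)$ and, for every $D\in\mathbb{N}$, a constant $\kappa_0=\kappa_0(c,d,D)$ such that for every $D\in\mathbb{N}$, every $\rho\in\mathbb{R}^D$ satisfying the Diophantine condition $\mathrm{dist}(n\rho\bmod 1,0)\geq c\,n^{-d}$ for all $n\in\mathbb{N}$, and every $\kappa\geq\kappa_0$, the map $$F_\kappa:\mathbb{T}^D\times[0,1]\to\mathbb{T}^D\times[0,1],\qquad F_\kappa(\theta,x)=\Big(\theta+\rho\bmod 1,\ \tanh(\kappa x)\cdot\frac1D\sum_{i=1}^D\sin(\pi\theta_i)\Big),$$ with upper bounding graph $\varphi^+$, point set $\Phi^+$ and associated measure $\mu_{\varphi^+}$, has the following properties: 1. $\Phi^+$ has Hausdorff dimension $D$; 2. the $D$-dimensional Hausdorff measure of $\Phi^+$ is infinite if $D=1$, and finite if $D\geq D_0$; 3. $\mu_{\varphi^+}$ is exact dimensional with pointwise dimension $D$; 4. the information dimension of $\mu_{\varphi^+}$ is $D$; 5. $\mu_{\varphi^+}$ is $D$-rectifiable.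
   Context: $\mathbb{N}=\{1,2,\dots\}$; $\mathbb{T}^D=\mathbb{R}^D/\mathbb{Z}^D$ with the metric $\mathrm{dist}$ induced by the Euclidean metric; coordinates $\theta=(\theta_1,\dots,\theta_D)$ are represented in $[0,1)$; $\mathbb{T}^D\times[0,1]$ carries the usual product metric. Upper bounding graph: $\varphi^+(\theta)=\sup\{x\in[0,1]\mid(\theta,x)\in\mathcal{A}\}$ with $\mathcal{A}=\bigcap_{n\in\mathbb{N}}F_\kappa^n(\mathbb{T}^D\times[0,1])$; $\Phi^+=\{(\theta,\varphi^+(\theta))\mid\theta\in\mathbb{T}^D\}$. The associated measure is $\mu_{\varphi^+}(A)=\mathrm{Leb}_{\mathbb{T}^D}(\pi_1(A\cap\Phi^+))$ for Borel $A\subseteq\mathbb{T}^D\times[0,1]$, with $\pi_1$ the projection to $\mathbb{T}^D$. Hausdorff measure and dimension: $\mathcal{H}^s(A)=\lim_{\varepsilon\to0}\inf\{\sum_i(\mathrm{diam}A_i)^s\}$, the infimum over finite or countable covers of $A$ by sets of diameter $\leq\varepsilon$; $D_H(A)=\sup\{s\geq0\mid\mathcal{H}^s(A)=\infty\}$. Rectifiability: in a separable metric space $X$, a Borel set $A$ is countably $D$-rectifiable if there are Lipschitz maps $g_i:A_i\subseteq\mathbb{R}^D\to X$, $i\in\mathbb{N}$, with $\mathcal{H}^D(A\setminus\bigcup_i g_i(A_i))=0$. A finite Borel measure $\mu$ is $D$-rectifiable if $\mu=\Theta\,\mathcal{H}^D|_A$ for some countably $D$-rectifiable $A$ and some Borel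 measurable $\Theta:A\to[0,\infty)$. Dimensions of $\mu$: the pointwise dimension at $x$ is $\lim_{\varepsilon\to0}\log\mu(B_\varepsilon(x))/\log\varepsilon$ if it exists ($B_\varepsilon(x)$ the open ball); $\mu$ is exact dimensional if this exists and is constant $\mu$-a.e. The information dimension is $D_1(\mu)=\lim_{\varepsilon\to0}\int\log\mu(B_\varepsilon(x))\,d\mu(x)/\log\varepsilon$ if it exists. *)

(* Defs.v *)
From HB Require Import structures.
From mathcomp Require Import all_boot all_order all_algebra.
From mathcomp Require Import all_classical all_reals all_analysis.
From mathcomp Require Import ring lra.

Set Implicit Arguments.
Unset Strict Implicit.
Unset Printing Implicit Defensive.
Import Order.TTheory GRing.Theory Num.Theory.
Import numFieldNormedType.Exports.

Local Open Scope classical_set_scope.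
Local Open Scope ring_scope.

#[short(type="pmetricType")]
HB.structure Definition PointedMetric (R : numDomainType) :=
  { M of Metric R M & isPointed M }.

(* The library puts the sup norm on 'rV[R]_n, hence this separate norm. *)
Section euclidean_norm.
Context {R : realType} {n : nat}.
Implicit Types u v : 'rV[R]_n.

Definition euclid_norm u : R := Num.sqrt (\sum_i u 0 i ^+ 2).

Lemma euclid_norm_ge0 u : 0 <= euclid_norm u.
Proof. exact: sqrtr_ge0. Qed.

Lemma euclid_norm0 : euclid_norm 0 = 0.
Proof.
by rewrite /euclid_norm big1 ?sqrtr0// => i _; rewrite mxE expr0n.
Qed.

Lemma euclid_normN u : euclid_norm (- u) = euclid_norm u.
Proof.
by rewrite /euclid_norm; congr Num.sqrt; apply: eq_bigr => i _; rewrite mxE sqrrN.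
Qed.

Lemma coord_le_euclid_norm u i : `|u 0 i| <= euclid_norm u.
Proof.
rewrite -sqrtr_sqr ler_wsqrtr// (bigD1 i)//= lerDl.
by apply: sumr_ge0 => j _; exact: sqr_ge0.
Qed.

Lemma cauchy_schwarz u v :
  (\sum_i u 0 i * v 0 i) ^+ 2 <= (\sum_i u 0 i ^+ 2) * (\sum_i v 0 i ^+ 2).
Proof.
set a := \sum_i u 0 i ^+ 2; set b := \sum_i v 0 i ^+ 2.
set c := \sum_i u 0 i * v 0 i.
have a0 : 0 <= a by apply: sumr_ge0 => i _; exact: sqr_ge0.
have b0 : 0 <= b by apply: sumr_ge0 => i _; exact: sqr_ge0.
have [b00|bN0] := eqVneq b 0.
  have v0 i : v 0 i = 0.
    apply/eqP; rewrite -(sqrf_eq0 (v 0 i)).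
    move/eqP: b00; rewrite psumr_eq0; last by move=> j _; exact: sqr_ge0.
    by move/allP => /(_ i (mem_index_enum _)).
  by rewrite /c big1 ?expr0n ?mulr_ge0// => i _; rewrite v0 mulr0.
have bp : 0 < b by rewrite lt_neqAle eq_sym bN0.
have : 0 <= \sum_i (b * u 0 i - c * v 0 i) ^+ 2.
  by apply: sumr_ge0 => i _; exact: sqr_ge0.
suff -> : \sum_i (b * u 0 i - c * v 0 i) ^+ 2 = b * (a * b - c ^+ 2).
  by rewrite pmulr_rge0// subr_ge0.
have sumE (r s : R) : \sum_i (r * u 0 i - s * v 0 i) ^+ 2 =
    r ^+ 2 * a - (r * s *+ 2) * c + s ^+ 2 * b.
  rewrite !mulr_sumr -sumrB -big_split/=.
  by apply: eq_bigr => i _; ring.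
by rewrite sumE; ring.
Qed.

Lemma euclid_normD u v : euclid_norm (u + v) <= euclid_norm u + euclid_norm v.
Proof.
have uv0 : 0 <= euclid_norm u + euclid_norm v.
  by rewrite addr_ge0// euclid_norm_ge0.
rewrite -[leRHS]ger0_norm// -sqrtr_sqr ler_wsqrtr//.
rewrite sqrrD !sqr_sqrtr; try by apply: sumr_ge0 => i _; exact: sqr_ge0.
have -> : \sum_i (u + v) 0 i ^+ 2 = \sum_i u 0 i ^+ 2 +
    (\sum_i u 0 i * v 0 i) *+ 2 + \sum_i v 0 i ^+ 2.
  rewrite -mulr_natr mulr_suml -!big_split/=.
  by apply: eq_bigr => i _; rewrite mxE; ring.
rewrite lerD2r lerD2l lerMn2r/=.
rewrite (le_trans (ler_norm _))// -sqrtr_sqr -sqrtrM.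
  by rewrite ler_wsqrtr// cauchy_schwarz.
by apply: sumr_ge0 => i _; exact: sqr_ge0.
Qed.

End euclidean_norm.

(* The torus R^D / Z^D; a point is its representative in [0, 1)^D. *)
Record torus (R : realType) (D : nat) := Torus {
  torus_rep : 'rV[R]_D ;
  torus_repP : [forall i, 0 <= torus_rep 0 i < 1] }.

HB.instance Definition _ (R : realType) (D : nat) :=
  [isSub for @torus_rep R D].
HB.instance Definition _ (R : realType) (D : nat) :=
  [Choice of torus R D by <:].

Section torus.
Context {R : realType} {D : nat}.
Implicit Types (u : 'rV[R]_D) (x y z : torus R D).

Lemma torus_of_subproof u :
  [forall i, 0 <= (\row_j (u 0 j - (Num.floor (u 0 j))%:~R)) 0 i < 1].
Proof.
apply/forallP => i; rewrite mxE subr_ge0 floor_le_tmp/=.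
by rewrite ltrBlDl -intrD1 floorD1_gt.
Qed.

Definition torus_of u : torus R D := Torus (torus_of_subproof u).

HB.instance Definition _ := isPointed.Build (torus R D) (torus_of 0).

Definition torus_dist x y : R :=
  inf [set euclid_norm (torus_rep x - torus_rep y + \row_i (k i)%:~R)
      | k in [set: 'I_D -> int]].

Lemma torus_dist_nonempty x y :
  [set euclid_norm (torus_rep x - torus_rep y + \row_i (k i)%:~R)
    | k in [set: 'I_D -> int]] !=set0.
Proof. by eexists; exists (fun=> 0). Qed.

Lemma torus_dist_lbound x y :
  lbound [set euclid_norm (torus_rep x - torus_rep y + \row_i (k i)%:~R)
    | k in [set: 'I_D -> int]] 0.
Proof. by move=> _ [k _ <-]; exact: euclid_norm_ge0. Qed.

Lemma torus_dist_le x y (k : 'I_D -> int) :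
  torus_dist x y <= euclid_norm (torus_rep x - torus_rep y + \row_i (k i)%:~R).
Proof.
apply: ge_inf; last by exists k.
by exists 0; exact: torus_dist_lbound.
Qed.

Lemma torus_dist_ge0 x y : 0 <= torus_dist x y.
Proof. by apply: lb_le_inf (@torus_dist_nonempty x y) (@torus_dist_lbound x y). Qed.

Lemma torus_dist_approx x y (e : R) : 0 < e -> exists k : 'I_D -> int,
  euclid_norm (torus_rep x - torus_rep y + \row_i (k i)%:~R) < torus_dist x y + e.
Proof.
move=> e0; have hi : has_inf [set euclid_norm
    (torus_rep x - torus_rep y + \row_i (k i)%:~R) | k in [set: 'I_D -> int]].
  split; first exact: torus_dist_nonempty.
  by exists 0; exact: torus_dist_lbound.
by have [_ [k _ <-] ?] := inf_adherent e0 hi; exists k.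
Qed.

Lemma torus_distxx x : torus_dist x x = 0.
Proof.
apply/eqP; rewrite eq_le torus_dist_ge0 andbT.
rewrite (le_trans (torus_dist_le x x (fun=> 0)))// subrr add0r.
rewrite (_ : \row_i _ = 0) ?euclid_norm0//.
by apply/rowP => i; rewrite !mxE.
Qed.

Lemma torus_dist_sym x y : torus_dist x y = torus_dist y x.
Proof.
suff h a b : torus_dist a b <= torus_dist b a by apply/eqP; rewrite eq_le !h.
apply: lb_le_inf; first exact: torus_dist_nonempty.
move=> _ [k _ <-]; apply: (le_trans (torus_dist_le a b (fun i => - k i))).
rewrite -euclid_normN (_ : - _ = torus_rep b - torus_rep a + \row_i (k i)%:~R)//.
by apply/rowP => i; rewrite !mxE mulrNz; ring.
Qed.

Lemma torus_dist_triangle y x z :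
  torus_dist x z <= torus_dist x y + torus_dist y z.
Proof.
apply/ler_addgt0Pl => e e0.
have e20 : 0 < e / 2 by rewrite divr_gt0.
have [k kP] := torus_dist_approx x y e20.
have [l lP] := torus_dist_approx y z e20.
apply: (le_trans (torus_dist_le x z (fun i => k i + l i))).
rewrite (_ : _ + _ = (torus_rep x - torus_rep y + \row_i (k i)%:~R) +
  (torus_rep y - torus_rep z + \row_i (l i)%:~R)).
  apply: (le_trans (euclid_normD _ _)).
  by move: (ltW (ltrD kP lP)) => /le_trans; apply; lra.
by apply/rowP => i; rewrite !mxE intrD; ring.
Qed.

Lemma torus_dist_positivity x y : torus_dist x y = 0 -> x = y.
Proof.
move=> xy0; apply: val_inj => /=; apply/rowP => i; apply/eqP/negPn/negP => nxy.
pose t := torus_rep x 0 i - torus_rep y 0 i.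
have t0 : 0 < `|t| by rewrite normr_gt0 subr_eq0.
have t1 : `|t| < 1.
  have /forallP/(_ i)/andP[? ?] := torus_repP x.
  have /forallP/(_ i)/andP[? ?] := torus_repP y.
  by rewrite ltr_norml /t; apply/andP; split; lra.
pose e := Num.min `|t| (1 - `|t|).
have e0 : 0 < e by rewrite lt_min t0 subr_gt0.
have [k] := torus_dist_approx x y e0.
apply/negP; rewrite -leNgt xy0 add0r.
apply: le_trans (coord_le_euclid_norm _ i); rewrite !mxE -/t.
have [->|k0] := eqVneq (k i) 0; first by rewrite addr0 ge_min lexx.
rewrite ge_min; apply/orP; right.
have : 1 <= `|(k i)%:~R : R|.
  by rewrite -intr_norm ler1z -gtz0_ge1 normr_gt0.
have := ler_normB (t + (k i)%:~R) t; rewrite addrAC subrr add0r => ? ?; lra.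
Qed.

HB.instance Definition _ := @isMetric.Build R (torus R D) torus_dist
  torus_distxx torus_dist_positivity torus_dist_sym torus_dist_triangle.

End torus.

Definition unit_interval (R : realType) : Type := {i01 R}.

Section unit_interval.
Context {R : realType}.
Implicit Types x y z : unit_interval R.

HB.instance Definition _ := Choice.copy (unit_interval R) {i01 R}.
HB.instance Definition _ := isPointed.Build (unit_interval R) (0%:i01 : {i01 R}).

Definition unit_dist x y : R := `|x%:num - y%:num|.

Lemma unit_distxx x : unit_dist x x = 0.
Proof. by rewrite /unit_dist subrr normr0. Qed.

Lemma unit_dist_positivity x y : unit_dist x y = 0 -> x = y.
Proof. by move/eqP; rewrite normr_eq0 subr_eq0 => /eqP/val_inj. Qed.

Lemma unit_dist_sym x y : unit_dist x y = unit_dist y x.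
Proof. exact: distrC. Qed.

Lemma unit_dist_triangle y x z : unit_dist x z <= unit_dist x y + unit_dist y z.
Proof. exact: ler_distD. Qed.

HB.instance Definition _ := @isMetric.Build R (unit_interval R) unit_dist
  unit_distxx unit_dist_positivity unit_dist_sym unit_dist_triangle.

End unit_interval.

(* The maximum metric, the one behind the library's product topology. *)
Section product_metric.
Context {R : realType} (X Y : metricType R).
Implicit Types p q : X * Y.

Definition prod_dist p q : R := Num.max (mdist p.1 q.1) (mdist p.2 q.2).

Lemma prod_dist_ge0 p q : 0 <= prod_dist p q.
Proof. by rewrite le_max mdist_ge0. Qed.

Lemma prod_dist_positivity p q : prod_dist p q = 0 -> p = q.
Proof.
move=> pq0; have : prod_dist p q <= 0 by rewrite pq0.
rewrite ge_max => /andP[h1 h2].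
have e1 : mdist p.1 q.1 = 0 by apply/eqP; rewrite eq_le h1 mdist_ge0.
have e2 : mdist p.2 q.2 = 0 by apply/eqP; rewrite eq_le h2 mdist_ge0.
by case: p q {pq0 h1 h2} e1 e2 => [a b] [c d] /= /mdist_positivity -> /mdist_positivity ->.
Qed.

Lemma prod_ballE p (e : R) : ball p e = [set q | prod_dist p q < e].
Proof.
apply/seteqP; split=> q /=; rewrite /prod_dist gt_max.
  by case; rewrite !ballEmdist/= => -> ->.
by move=> /andP[h1 h2]; split; rewrite ballEmdist.
Qed.

HB.instance Definition _ := @PseudoMetric_isMetric.Build R (X * Y)%type prod_dist
  prod_dist_ge0 prod_dist_positivity prod_ballE.

End product_metric.

HB.instance Definition _ (R : realType) (X Y : pmetricType R) :=
  Metric.on (X * Y)%type.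

Definition borel {R : realType} (X : pmetricType R) :=
  g_sigma_algebraType [set U : set X | open U].

Section hausdorff.
Context {R : realType} {X : metricType R}.
Local Open Scope ereal_scope.

(* [maxe 0] gives the empty set diameter 0. *)
Definition diam (A : set X) : \bar R :=
  maxe 0 (ereal_sup [set (mdist x y)%:E | x in A & y in A]).

(* The index set [J] makes finite covers available; this matters when [s = 0],
   as [0 `^ 0 = 1]. *)
Definition hausdorff_premeasure (s eps : R) (A : set X) : \bar R :=
  ereal_inf [set t | exists (J : set nat) (U : nat -> set X),
    [/\ A `<=` \bigcup_(i in J) U i,
        forall i, J i -> diam (U i) <= eps%:E &
        t = \esum_(i in J) (diam (U i) `^ s)]].

Definition hausdorff_measure (s : R) (A : set X) : \bar R :=
  lim (hausdorff_premeasure s eps A @[eps --> 0%R^'+]).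

(* [maxe 0]: the supremum is taken in [0, +oo], so that of the empty set is 0. *)
Definition hausdorff_dim (A : set X) : \bar R :=
  maxe 0 (ereal_sup [set s%:E | s in
    [set s : R | (0 <= s)%R /\ hausdorff_measure s A = +oo]]).

End hausdorff.

Section rectifiability.
Context {R : realType} {X : pmetricType R}.

Definition lipschitz_map n (A : set 'rV[R]_n) (g : 'rV[R]_n -> X) : Prop :=
  exists L : R, forall u v, A u -> A v ->
    mdist (g u) (g v) <= L * euclid_norm (u - v).

Definition countably_rectifiable (n : nat) (A : set (borel X)) : Prop :=
  measurable A /\
  exists (E : nat -> set 'rV[R]_n) (g : nat -> 'rV[R]_n -> X),
    (forall i, lipschitz_map (E i) (g i)) /\
    hausdorff_measure n%:R ((A : set X) `\` \bigcup_i (g i @` E i)) = 0%E.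

(* The library's integral takes a bare set function and evaluates it only on
   measurable sets, so this is the integral against the restriction of the
   Hausdorff measure to the Borel sets. *)
Definition rectifiable_measure (n : nat) (mu : set (borel X) -> \bar R) : Prop :=
  (mu setT < +oo)%E /\
  exists (A : set (borel X)) (Theta : borel X -> R),
    [/\ countably_rectifiable n A,
        measurable_fun A Theta,
        forall x, A x -> 0 <= Theta x &
        forall B : set (borel X), measurable B ->
          mu B = (\int[@hausdorff_measure R X n%:R : set (borel X) -> \bar R]_(x in B `&` A)
                    (Theta x)%:E)%E].

End rectifiability.

Section dimensions_of_measures.
Context {R : realType} {X : pmetricType R}.
Implicit Types mu : set (borel X) -> \bar R.
Local Open Scope ereal_scope.

(* [lne 0 = -oo], so balls of measure 0 give the quotient +oo. *)
Definition has_pointwise_dim mu (x : X) (a : R) : Prop :=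
  lne (mu (ball x eps)) / (ln eps)%:E @[eps --> 0%R^'+] --> a%:E.

Definition exact_dimensional mu (a : R) : Prop :=
  {ae mu, forall x, has_pointwise_dim mu x a}.

Definition has_information_dim mu (a : R) : Prop :=
  (\int[mu]_x lne (mu (ball (x : X) eps))) / (ln eps)%:E
    @[eps --> 0%R^'+] --> a%:E.

End dimensions_of_measures.

Section lebesgue_torus.
Context {R : realType}.

Definition cons_tuple n (p : measurableTypeR R * n.-tuple R) : n.+1.-tuple R :=
  [tuple of p.1 :: p.2].

Lemma measurable_cons_tuple n : measurable_fun setT (@cons_tuple n).
Proof. exact: measurable_cons. Qed.

HB.instance Definition _ n :=
  isMeasurableFun.Build _ _ _ _ (@cons_tuple n) (@measurable_cons_tuple n).

(* Lebesgue measure on the cube [0, 1]^n, as an n-fold product; its image under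
   reduction mod 1 is Lebesgue measure on the torus. *)
Fixpoint lebesgue_cube n : probability (n.-tuple R) R :=
  if n isn't m.+1 then dirac [tuple]
  else distribution (uniform_prob (@ltr01 R) \x lebesgue_cube m)%E
         (@cons_tuple m).

Definition lebesgue_torus D (E : set (torus R D)) : \bar R :=
  lebesgue_cube D [set t | E (torus_of (\row_i tnth t i))].

End lebesgue_torus.

Section skew_product.
Context {R : realType} {D : nat}.

Definition tanh (x : R) : R := (expR x - expR (- x)) / (expR x + expR (- x)).

Definition forcing (theta : torus R D) : R :=
  D%:R^-1 * \sum_i sin (pi * torus_rep theta 0 i).

Lemma tanh_ge0 x : 0 <= x -> 0 <= tanh x.
Proof.
move=> x0; apply: divr_ge0; last by rewrite addr_ge0 ?expR_ge0.
by rewrite subr_ge0 ler_expR; lra.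
Qed.

Lemma tanh_le1 x : tanh x <= 1.
Proof.
have := expR_gt0 x; have := expR_gt0 (- x) => ? ?.
by rewrite ler_pdivrMr ?addr_gt0//; lra.
Qed.

Lemma forcing_ge0 theta : 0 <= forcing theta.
Proof.
rewrite mulr_ge0 ?invr_ge0//; apply: sumr_ge0 => i _.
have /forallP/(_ i)/andP[h0 h1] := torus_repP theta.
apply: sin_ge0_pi; rewrite mulr_ge0 ?pi_ge0//=.
by rewrite ler_piMr ?pi_ge0// ltW.
Qed.

Lemma forcing_le1 theta : forcing theta <= 1.
Proof.
have [D0|D0] := eqVneq D 0%N; first by rewrite /forcing [in _^-1]D0 invr0 mul0r.
rewrite /forcing mulrC ler_pdivrMr ?ltr0n ?lt0n// mul1r.
apply: (@le_trans _ _ (\sum_(i < D) (1 : R))).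
  by apply: ler_sum => i _; exact: sin_le1.
by rewrite sumr_const card_ord.
Qed.

Lemma fibre_ge0 (kappa : {nonneg R}) theta (x : unit_interval R) :
  0 <= tanh (kappa%:num * x%:num) * forcing theta.
Proof. by rewrite mulr_ge0 ?forcing_ge0 ?tanh_ge0 ?mulr_ge0. Qed.

Lemma fibre_le1 (kappa : {nonneg R}) theta (x : unit_interval R) :
  tanh (kappa%:num * x%:num) * forcing theta <= 1.
Proof.
rewrite (le_trans (ler_wpM2r (forcing_ge0 _) (tanh_le1 _)))//.
by rewrite mul1r forcing_le1.
Qed.

Notation phase := (torus R D * unit_interval R)%type.

(* [kappa] is nonnegative so that [0, 1] is mapped into itself. *)
Definition skew_map (kappa : {nonneg R}) (rho : 'rV[R]_D) (p : phase) : phase :=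
  (torus_of (torus_rep p.1 + rho),
   Itv01 (fibre_ge0 kappa p.1 p.2) (fibre_le1 kappa p.1 p.2)).

Definition attractor kappa rho : set phase :=
  \bigcap_(n in [set n | (0 < n)%N]) (iter n (skew_map kappa rho) @` setT).

Definition upper_graph kappa rho (theta : torus R D) : R :=
  sup [set x%:num | x in [set x : unit_interval R | attractor kappa rho (theta, x)]].

Definition upper_graph_set kappa rho : set phase :=
  [set p | p.2%:num = upper_graph kappa rho p.1].

Definition upper_graph_measure kappa rho (A : set (borel phase)) : \bar R :=
  lebesgue_torus (fst @` ((A : set phase) `&` upper_graph_set kappa rho)).

Definition diophantine (c d : R) (rho : 'rV[R]_D) : Prop :=
  forall n : nat, (0 < n)%N ->
    c * n%:R `^ (- d) <= mdist (torus_of (rho *+ n)) (torus_of 0).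

End skew_product.

(* Main.v *)
Require Import Defs.
From HB Require Import structures.
From mathcomp Require Import all_boot all_order all_algebra.
From mathcomp Require Import all_classical all_reals all_analysis.
From mathcomp Require Import measurable_realfun ring lra.
From mathcomp Require Import zify.

(* The upper graph [phi] vanishes on the forward orbit [j rho] of 0, the zero of the
   forcing, and is Lipschitz away from it.  Put [kappa = p ^ (- 64)] with [p] small and
   [delta = p ^ 32].  If [theta] keeps distance [2 D p ^ (2 j)] from [j rho] for [j > m],
   then along the backward orbit of [theta] the small values of the forcing cost finitely
   many factors [delta], each of which is regained in one step because the fibre maps
   expand by about [kappa delta].  The Diophantine condition makes the losses sparse, so
   [phi >= delta] most of the time, and there the fibre maps contract strongly, as [tanh]
   saturates; differences of [phi] at two such points are thus controlled by a constant of
   order [kappa ^ (3 m)].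

   Hence the graph is a countable union of Lipschitz graphs plus a part over the limsup
   of exponentially small balls, which has measure zero for every Hausdorff measure of
   exponent above 1.  This gives the dimension and rectifiability, and finiteness when the
   radii ([p ^ (2 j)] to the power [D]) beat the Lipschitz constants.  With the larger
   radii [2 D p ^ j] most of a small ball around a point stays in one Lipschitz piece,
   which gives the local dimension with a constant exponential in [m], integrable since
   the set of points with index above [m] has measure at most [2 ^ (- m)].

   On the circle, for infinitely many [m] the graph climbs from 0 at [m rho] to [delta]
   within distance [p ^ (2 m)]; the pieces near different [m rho] are disjoint and each
   has length at least [delta / 4]. *)

Set Implicit Arguments.
Unset Strict Implicit.
Unset Printing Implicit Defensive.
Import Order.TTheory GRing.Theory Num.Theory.
Import numFieldNormedType.Exports.

Local Open Scope classical_set_scope.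
Local Open Scope ring_scope.

(** * Distances on the torus *)

(** The exponents come from one account. Since [kappa * delta ^ 2 = 1], one step of a fibre map
    lifts a height [delta ^ (z + 1)] by two powers of [delta], and an ordinary value of the forcing
    takes one of them back; so one factor is regained per step, and the losses behave like work in a
    queue served at unit rate. As [delta = p ^ 32], a distance of order [p ^ (2 j)] to the pinching
    point costs at most [j / 16] factors. Losses of at least [i >= 1] factors recur only after more
    than [32 ^ i >= 16 * 2 ^ i] steps, so over [l] steps they add up to at most [l / 16] plus the
    size of the largest one, again [l / 16]. The queue is thus busy for about one eighth of the time
    for one orbit, and one quarter for a pair. With expansion by at most [B = 4 kappa] while busy
    and contraction by [B ^ (- 2)] otherwise, a quarter of bad steps still leaves a product below
    [B ^ (3 m + 1 - k)] after [k] steps. The exponent [3 m] in all later constants is the price of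
    the first [m] steps, about which nothing is assumed. *)

Section nearest_integer.
Context {R : realType}.
Implicit Types s t : R.

Definition int_dist t : R := `|t - (Num.floor (t + 2^-1))%:~R|.

Lemma int_dist_le_half t : int_dist t <= 2^-1.
Proof.
rewrite /int_dist; have := floor_le_tmp (t + 2^-1).
have := floorD1_gt (t + 2^-1); rewrite intrD1 => h1 h2.
by rewrite ler_norml; apply/andP; split; lra.
Qed.

Lemma int_dist_ge0 t : 0 <= int_dist t. Proof. exact: normr_ge0. Qed.

Lemma int_dist_le t (k : int) : int_dist t <= `|t - k%:~R|.
Proof.
have [kE|kN] := eqVneq k (Num.floor (t + 2^-1)); first by rewrite kE lexx.
have := int_dist_le_half t; rewrite {1}/int_dist; set f := Num.floor _ => hf.
have h : 1 <= `|f%:~R - k%:~R : R|.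
  by rewrite -intrB -intr_norm ler1z -gtz0_ge1 normr_gt0 subr_eq0 eq_sym.
have := ler_distD t (f%:~R) (k%:~R : R); rewrite (distrC f%:~R t) => h2.
by apply: (le_trans (int_dist_le_half t)); lra.
Qed.

Lemma int_dist_ex t : exists k : int, int_dist t = `|t - k%:~R|.
Proof. by eexists. Qed.

Lemma int_distN t : int_dist (- t) = int_dist t.
Proof.
suff h s : int_dist (- s) <= int_dist s.
  by apply/eqP; rewrite eq_le h/= -{1}(opprK t) h.
have [k ->] := int_dist_ex s.
by rewrite (le_trans (int_dist_le _ (- k)))// mulrNz -opprD normrN.
Qed.

Lemma int_distD s t : int_dist (s + t) <= int_dist s + int_dist t.
Proof.
have [k ->] := int_dist_ex s; have [l ->] := int_dist_ex t.
rewrite (le_trans (int_dist_le _ (k + l)))// intrD.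
by rewrite (_ : _ - _ = (s - k%:~R) + (t - l%:~R)) ?ler_normD//; ring.
Qed.

Lemma int_dist_int t (k : int) : int_dist (t + k%:~R) = int_dist t.
Proof.
apply/eqP; rewrite eq_le; apply/andP; split.
  have [l ->] := int_dist_ex t.
  rewrite (le_trans (int_dist_le _ (k + l)))// intrD.
  by rewrite (_ : _ - _ = t - l%:~R)//; ring.
have [l ->] := int_dist_ex (t + k%:~R).
rewrite (le_trans (int_dist_le _ (l - k)))// intrB.
by rewrite (_ : _ - _ = t + k%:~R - l%:~R)//; ring.
Qed.

Lemma int_dist_norm t : int_dist t <= `|t|.
Proof. by have := int_dist_le t 0; rewrite subr0. Qed.

Lemma int_dist_small t : `|t| <= 2^-1 -> int_dist t = `|t|.
Proof.
move=> th; apply/eqP; rewrite eq_le int_dist_norm/=.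
have [k ->] := int_dist_ex t.
have [->|kN] := eqVneq k 0; first by rewrite subr0.
have h : 1 <= `|k%:~R : R| by rewrite -intr_norm ler1z -gtz0_ge1 normr_gt0.
have := ler_distD t 0 (k%:~R : R); rewrite !sub0r !normrN => h2; lra.
Qed.

End nearest_integer.

Section torus_norm.
Context {R : realType} {D : nat}.
Implicit Types (u v w : 'rV[R]_D) (x y z : torus R D).

Lemma le_euclid_norm u v : (forall i, `|u 0 i| <= `|v 0 i|) ->
  euclid_norm u <= euclid_norm v.
Proof.
move=> uv; rewrite ler_wsqrtr//; apply: ler_sum => i _.
by rewrite -[leLHS]real_normK ?num_real// -[leRHS]real_normK ?num_real// lerXn2r ?nnegrE.
Qed.

Lemma euclid_norm_le_sum u : euclid_norm u <= \sum_i `|u 0 i|.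
Proof.
have s0 : 0 <= \sum_i `|u 0 i| by apply: sumr_ge0.
rewrite -[leRHS]ger0_norm// -sqrtr_sqr ler_wsqrtr//.
rewrite [leRHS]expr2 mulr_suml; apply: ler_sum => i _.
rewrite -[leLHS]real_normK ?num_real// expr2 ler_wpM2l//.
by rewrite (bigD1 i)//= lerDl sumr_ge0.
Qed.

(** Working on lifts in [R^D] turns the rotation into addition of [rho]. A nearest lattice point can
    be found coordinate by coordinate, so this closed form replaces the infimum in [torus_dist]. *)
Definition torus_norm w : R := euclid_norm (\row_i int_dist (w 0 i)).

Lemma torus_norm_ge0 w : 0 <= torus_norm w.
Proof. exact: euclid_norm_ge0. Qed.

Lemma torus_norm_le_euclid w : torus_norm w <= euclid_norm w.
Proof.
apply: le_euclid_norm => i; rewrite mxE ger0_norm ?int_dist_ge0//.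
exact: int_dist_norm.
Qed.

Lemma torus_normN w : torus_norm (- w) = torus_norm w.
Proof. by congr euclid_norm; apply/rowP => i; rewrite !mxE int_distN. Qed.

Lemma torus_normD u v : torus_norm (u + v) <= torus_norm u + torus_norm v.
Proof.
apply: le_trans (euclid_normD _ _); apply: le_euclid_norm => i.
by rewrite !mxE !ger0_norm ?addr_ge0 ?int_dist_ge0// int_distD.
Qed.

Lemma torus_norm_int w (k : 'I_D -> int) :
  torus_norm (w + \row_i (k i)%:~R) = torus_norm w.
Proof. by congr euclid_norm; apply/rowP => i; rewrite !mxE int_dist_int. Qed.

Lemma int_dist_le_torus_norm w i : int_dist (w 0 i) <= torus_norm w.
Proof.
apply: le_trans (coord_le_euclid_norm _ i).
by rewrite mxE ger0_norm// int_dist_ge0.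
Qed.

Lemma torus_norm_le_sum w : torus_norm w <= \sum_i int_dist (w 0 i).
Proof.
rewrite (le_trans (euclid_norm_le_sum _))//; apply: ler_sum => i _.
by rewrite mxE ger0_norm// int_dist_ge0.
Qed.

Lemma torus_distE u v :
  torus_dist (torus_of u) (torus_of v) = torus_norm (u - v).
Proof.
have e (k : 'I_D -> int) : torus_rep (torus_of u) - torus_rep (torus_of v) +
    \row_i (k i)%:~R = (u - v) +
    \row_i (k i - Num.floor (u 0 i) + Num.floor (v 0 i))%:~R.
  by apply/rowP => i; rewrite !mxE intrD intrB; ring.
apply/eqP; rewrite eq_le; apply/andP; split; last first.
  apply: lb_le_inf; first exact: torus_dist_nonempty.
  move=> _ [k _ <-]; rewrite e -(torus_norm_int _ (fun i =>
    k i - Num.floor (u 0 i) + Num.floor (v 0 i))).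
  exact: torus_norm_le_euclid.
have [k kP] := boolp.choice (fun i => int_dist_ex ((u - v) 0 i)).
apply: (le_trans (torus_dist_le _ _
  (fun i => - k i + Num.floor (u 0 i) - Num.floor (v 0 i)))).
rewrite e; apply: le_euclid_norm => i.
rewrite [in leRHS]mxE kP normr_id le_eqVlt; apply/orP; left; apply/eqP.
apply: f_equal; rewrite !mxE !(intrD, intrB, mulrNz); ring.
Qed.

Lemma torus_of_rep x : torus_of (torus_rep x) = x.
Proof.
apply: val_inj; apply/rowP => i /=; rewrite mxE.
have /forallP/(_ i) h := torus_repP x.
rewrite (_ : Num.floor _ = 0) ?subr0//; apply/eqP.
by rewrite floor_eq add0r.
Qed.

Lemma torus_of_rep_int u : exists k : 'I_D -> int,
  torus_rep (torus_of u) = u + \row_i (k i)%:~R.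
Proof.
exists (fun i => - Num.floor (u 0 i)); apply/rowP => i.
by rewrite !mxE mulrNz.
Qed.

Lemma torus_of_int u (k : 'I_D -> int) :
  torus_of (u + \row_i (k i)%:~R) = torus_of u.
Proof.
apply: torus_dist_positivity; rewrite torus_distE addrAC subrr torus_norm_int.
apply/eqP; rewrite eq_le torus_norm_ge0 andbT (le_trans (torus_norm_le_euclid _))//.
by rewrite euclid_norm0.
Qed.

Lemma torus_of_repD u v :
  torus_of (torus_rep (torus_of u) + v) = torus_of (u + v).
Proof.
have [k ->] := torus_of_rep_int u.
by rewrite addrAC torus_of_int.
Qed.

End torus_norm.

(** * The fibre maps and the forcing *)

Section tanh_estimates.
Context {R : realType}.
Implicit Types x y z : R.

Lemma tanhE x : tanh x = 1 - 2 / (expR (2 * x) + 1).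
Proof.
rewrite /tanh expRN (expRM_natl 2).
have := expR_gt0 x; set e := expR x => e0.
by field; rewrite !gt_eqF// ?addr_gt0// ?exprn_gt0.
Qed.

Lemma tanh0 : tanh 0 = 0 :> R.
Proof. by rewrite /tanh oppr0 subrr mul0r. Qed.

Lemma ler_tanh x y : x <= y -> tanh x <= tanh y.
Proof.
move=> xy; rewrite !tanhE lerD2l lerN2 ler_pM2l// lef_pV2 ?posrE ?ltr_wpDl ?expR_ge0//.
by rewrite lerD2r ler_expR ler_pM2l.
Qed.

Lemma continuous_tanh : continuous (@tanh R).
Proof.
move=> x; have -> : @tanh R = fun x => (expR x - expR (- x)) / (expR x + expR (- x)) by [].
apply: cvgM.
  apply: cvgB; first exact: continuous_expR.
  apply: continuous_comp; [exact: opp_continuous|exact: continuous_expR].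
apply: cvgV; first by rewrite gt_eqF// addr_gt0 ?expR_gt0.
apply: cvgD; first exact: continuous_expR.
apply: continuous_comp; [exact: opp_continuous|exact: continuous_expR].
Qed.

(** Replacing [expR (2 * x)] by [1 + 2 * x] in [tanhE] gives [x / (1 + x)]. Below 1 the bound
    records the expansion, above 1 the saturation. *)
Lemma tanh_ge_min x : 0 <= x -> Num.min x 1 / 2 <= tanh x.
Proof.
move=> x0; have e := expR_ge1Dx (2 * x); rewrite tanhE.
apply: (@le_trans _ _ (x / (1 + x))).
  rewrite ler_pdivlMr ?ltr_wpDr// mulrAC ler_pdivrMr//.
  have [x1|x1] := leP x 1; nra.
rewrite (_ : x / (1 + x) = 1 - 2 / ((1 + 2 * x) + 1)).
  by rewrite lerD2l lerN2 ler_pM2l// lef_pV2 ?posrE ?ltr_wpDl ?expR_ge0// ?lerD2r//; lra.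
by field; apply/andP; split; rewrite gt_eqF//; lra.
Qed.

(** The factor bounds the derivative [1 / cosh ^ 2] on [[z, +oo)], here by algebra from [tanhE]. At
    [z = 0] this is a Lipschitz bound, at large [z] a strong contraction. *)
Lemma tanh_diff z x y : z <= x -> z <= y ->
  `|tanh x - tanh y| <= 4 * expR (- (2 * z)) * `|x - y|.
Proof.
wlog xy : x y / y <= x => [h|] zx zy.
  have [yx|/ltW xy] := leP y x; first exact: h.
  by rewrite distrC (distrC x) h.
rewrite ger0_norm ?subr_ge0 ?ler_tanh// ger0_norm ?subr_ge0// !tanhE.
set a := expR (2 * x); set b := expR (2 * y).
have a0 : 0 < a := expR_gt0 _; have b0 : 0 < b := expR_gt0 _.
have ba : a - b <= a * (2 * (x - y)).
  have -> : b = a * expR (2 * (y - x)).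
    by rewrite -expRD; congr expR; ring.
  rewrite -{1}(mulr1 a) -mulrBr ler_wpM2l ?(ltW a0)//.
  by have := expR_ge1Dx (2 * (y - x)); lra.
have -> : 1 - 2 / (a + 1) - (1 - 2 / (b + 1)) = 2 * (a - b) / ((a + 1) * (b + 1)).
  by field; rewrite !gt_eqF// ltr_wpDl// ltW.
have zb : b^-1 <= expR (- (2 * z)).
  by rewrite -expRN ler_expR lerN2 ler_pM2l.
have xy0 : 0 <= x - y by rewrite subr_ge0.
have a1 : 0 < a + 1 by rewrite addr_gt0.
have b1 : 0 < b + 1 by rewrite addr_gt0.
rewrite ler_pdivrMr ?mulr_gt0//.
apply: (@le_trans _ _ (4 * b^-1 * (x - y) * (a * b))).
  rewrite (_ : 4 * _ * _ * _ = 4 * (a * (x - y))); first by lra.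
  by field; rewrite gt_eqF.
apply: ler_pM; first by rewrite !mulr_ge0// invr_ge0 ltW.
- by rewrite mulr_ge0// ltW.
- by rewrite ler_wpM2r// ler_wpM2l.
- by apply: ler_pM; rewrite ?ltW// ?ltrDl.
Qed.

Lemma tanh_lipschitz x y : 0 <= x -> 0 <= y ->
  `|tanh x - tanh y| <= 4 * `|x - y|.
Proof.
by move=> x0 y0; have := tanh_diff x0 y0; rewrite mulr0 oppr0 expR0 mulr1.
Qed.

Lemma tanh_ivt (k a x : R) : 0 <= k -> 0 <= a -> 0 <= x <= tanh (k * a) ->
  exists2 y, 0 <= y <= a & tanh (k * y) = x.
Proof.
move=> k0 a0 xa.
have := @IVT R (fun y => tanh (k * y)) 0 a x a0; rewrite mulr0 tanh0.
have h0 : 0 <= tanh (k * a) by rewrite tanh_ge0 ?mulr_ge0.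
rewrite min_l// max_r//.
move=> /(_ _ xa) []; last by move=> y; rewrite in_itv/= => *; exists y.
apply: continuous_subspaceT => y.
apply: (@continuous_comp _ _ _ (fun y => k * y)); last exact: continuous_tanh.
exact: mulrl_continuous.
Qed.

End tanh_estimates.

Section sine_estimates.
Context {R : realType}.
Implicit Types x y z : R.

Lemma sin_lipschitz x y : `|sin x - sin y| <= `|x - y|.
Proof.
wlog xy : x y / y <= x => [h|].
  have [yx|/ltW xy] := leP y x; first exact: h.
  by rewrite distrC (distrC x) h.
have [] := @MVT_segment R sin cos y x xy.
  by apply: continuous_subspaceT => z; exact: continuous_sin.
by move=> z _ ->; rewrite normrM ler_piMl// cos_max.
Qed.

Lemma pi_lt4 : pi < 4 :> R.
Proof. by have := @pihalf_lt2 R; rewrite ltr_pdivrMr//; lra. Qed.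

Lemma cos_pi4_sqr : cos (pi / 4) ^+ 2 = 2^-1 :> R.
Proof.
have := cos_mulr2n (pi / 4 : R).
rewrite (_ : (pi / 4) *+ 2 = pi / 2); last by rewrite -mulr_natr; lra.
by rewrite cos_pihalf -mulr_natr; lra.
Qed.

Lemma cos_pi4_ge : 2^-1 <= cos (pi / 4) :> R.
Proof.
have pi0 := @pi_gt0 R.
have h : 0 <= cos (pi / 4 : R) by apply: cos_ge0_pihalf; lra.
by have := cos_pi4_sqr; nra.
Qed.

Lemma sin_pi4_ge : 2^-1 <= sin (pi / 4) :> R.
Proof.
have pi0 := @pi_gt0 R.
have h : 0 <= sin (pi / 4 : R) by apply: sin_ge0_pi; lra.
by have := sin2cos2 (pi / 4 : R); rewrite cos_pi4_sqr; nra.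
Qed.

(** Up to [pi / 4] the cosine is at least 1/2 and [pi >= 2], so the slope in [x] is at least 1;
    beyond it the sine is already at least 1/2. *)
Lemma sin_pi_ge x : 0 <= x <= 2^-1 -> x <= sin (pi * x).
Proof.
move=> /andP[x0 xh]; have pi2 := @pi_ge2 R.
have px0 : 0 <= pi * x by nra.
have pxh : pi * x <= pi / 2 by nra.
have [x4|x4] := leP (pi * x) (pi / 4); last first.
  apply: (@le_trans _ _ (sin (pi / 4))); first by rewrite (le_trans xh)// sin_pi4_ge.
  by rewrite ltW// ltr_sin// in_itv/=; lra.
have [] := @MVT_segment R sin cos 0 (pi * x) px0.
  by apply: continuous_subspaceT => z; exact: continuous_sin.
move=> z; rewrite in_itv/= sin0 !subr0 => /andP[z0 zx] ->.
have : 2^-1 <= cos z.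
  apply: (le_trans cos_pi4_ge).
  have [->//|zN] := eqVneq z (pi / 4).
  rewrite ltW// ltr_cos ?in_itv/=; [|lra|lra].
  by rewrite lt_neqAle zN/=; lra.
nra.
Qed.

Lemma norm_sin_piD_int x (k : int) : `|sin (pi * (x + k%:~R))| = `|sin (pi * x)|.
Proof.
have h n y : `|sin (pi * (y + n%:R))| = `|sin (pi * y)|.
  elim: n y => [|n IH] y; first by rewrite addr0.
  rewrite -addn1 natrD addrA mulrDr mulr1.
  by have := sinDpi (pi * (y + n%:R)) => ->; rewrite normrN IH.
case: k => n; first exact: h.
by rewrite NegzE mulrNz -(h n.+1 (x - _)) subrK.
Qed.

Lemma norm_sin_pi_lipschitz x y :
  `| `|sin (pi * x)| - `|sin (pi * y)| | <= 4 * int_dist (x - y).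
Proof.
have [k ->] := int_dist_ex (x - y).
rewrite -(norm_sin_piD_int y k) (le_trans (ler_dist_dist _ _))//.
rewrite (le_trans (sin_lipschitz _ _))// -mulrBr normrM.
rewrite (ger0_norm (@pi_ge0 R)) opprD addrA ler_wpM2r//.
exact/ltW/pi_lt4.
Qed.

Lemma norm_sin_pi_ge x : int_dist x <= `|sin (pi * x)|.
Proof.
have [k kE] := int_dist_ex x; rewrite kE -[X in sin (pi * X)](subrK (k%:~R) x).
rewrite norm_sin_piD_int.
have : `|x - k%:~R| <= 2^-1 by rewrite -kE int_dist_le_half.
set y := x - _ => yh; have : `|y| <= sin (pi * `|y|) by rewrite sin_pi_ge ?normr_ge0.
have [y0|y0] := leP 0 y; first by move=> /le_trans; apply; rewrite (ger0_norm y0) ler_norm.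
by move=> /le_trans; apply; rewrite (ltr0_norm y0) mulrN sinN -normrN ler_norm.
Qed.

End sine_estimates.

Section forcing_estimates.
Context {R : realType} {D : nat}.
Implicit Types (u v : 'rV[R]_D).

(** The absolute values make the formula periodic, so that it can be evaluated at any lift; on
    representatives in [[0, 1)] the sines are nonnegative anyway. *)
Definition lift_forcing u : R := D%:R^-1 * \sum_i `|sin (pi * u 0 i)|.

Lemma forcing_lift u : forcing (torus_of u) = lift_forcing u.
Proof.
rewrite /forcing /lift_forcing; congr (_ * _); apply: eq_bigr => i _.
have /forallP/(_ i)/andP[h0 h1] := torus_repP (torus_of u).
have [k kE] := torus_of_rep_int u.
have : 0 <= sin (pi * torus_rep (torus_of u) 0 i).
  apply: sin_ge0_pi; rewrite mulr_ge0 ?pi_ge0//=.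
  by rewrite ler_piMr ?pi_ge0// ltW.
by move=> /ger0_norm <-; rewrite kE !mxE norm_sin_piD_int.
Qed.

Lemma lift_forcing_ge0 u : 0 <= lift_forcing u.
Proof. by rewrite -forcing_lift forcing_ge0. Qed.

Lemma lift_forcing_le1 u : lift_forcing u <= 1.
Proof. by rewrite -forcing_lift forcing_le1. Qed.

Lemma lift_forcing0 : lift_forcing 0 = 0.
Proof.
by rewrite /lift_forcing big1 ?mulr0// => i _; rewrite mxE mulr0 sin0 normr0.
Qed.

Lemma lift_forcing_lipschitz u v :
  `|lift_forcing u - lift_forcing v| <= 4 * torus_norm (u - v).
Proof.
have [D0|D0] := posnP D.
  rewrite /lift_forcing !big1; try by move=> [i ?]; exfalso; lia.
  by rewrite subrr normr0 mulr_ge0// torus_norm_ge0.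
rewrite /lift_forcing -mulrBr -sumrB normrM ger0_norm ?invr_ge0// mulrC.
rewrite ler_pdivrMr ?ltr0n// (le_trans (ler_norm_sum _ _ _))//.
apply: (@le_trans _ _ (\sum_(i < D) 4 * torus_norm (u - v))).
  apply: ler_sum => i _; rewrite (le_trans (norm_sin_pi_lipschitz _ _))//.
  rewrite ler_pM2l//; apply: le_trans (int_dist_le_torus_norm _ i).
  by rewrite !mxE.
by rewrite sumr_const card_ord mulr_natr.
Qed.

Lemma lift_forcing_ge u : torus_norm u / D%:R <= lift_forcing u.
Proof.
rewrite /lift_forcing mulrC ler_wpM2l ?invr_ge0//.
rewrite (le_trans (torus_norm_le_sum _))//; apply: ler_sum => i _.
exact: norm_sin_pi_ge.
Qed.

End forcing_estimates.

(** * The upper bounding graph as a limit *)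

Lemma unit_interval_le1 {R : realType} (x : unit_interval R) : x%:num <= 1.
Proof. by rewrite /unit_interval in x *. Qed.

Lemma unit_interval_ge0 {R : realType} (x : unit_interval R) : 0 <= x%:num.
Proof. by rewrite /unit_interval in x *. Qed.

Section boundary_iterates.
Context {R : realType} {D : nat}.
Variables (kappa : {nonneg R}) (rho : 'rV[R]_D).
Implicit Types (u v : 'rV[R]_D) (n : nat).

Local Notation k := (kappa%:num).

Fixpoint boundary_iter n u : R :=
  if n is m.+1 then tanh (k * boundary_iter m (u - rho)) * lift_forcing (u - rho)
  else 1.

Local Notation P := boundary_iter.

Lemma boundary_iter_ge0 n u : 0 <= P n u.
Proof.
by elim: n u => //= n IH u; rewrite mulr_ge0 ?lift_forcing_ge0 ?tanh_ge0 ?mulr_ge0.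
Qed.

Lemma boundary_iter_le1 n u : P n u <= 1.
Proof.
case: n => [|n] //=; rewrite -[leRHS]mulr1 ler_pM ?lift_forcing_ge0 ?tanh_le1//.
- by rewrite tanh_ge0 ?mulr_ge0// boundary_iter_ge0.
- exact: lift_forcing_le1.
Qed.

Lemma boundary_iterS n u : P n.+1 u <= P n u.
Proof.
elim: n u => [|n IH] u; first exact: boundary_iter_le1.
rewrite [leLHS]/= [leRHS]/= ler_wpM2r ?lift_forcing_ge0// ler_tanh//.
by rewrite ler_wpM2l//; exact: IH.
Qed.

Lemma le_boundary_iter m n u : (m <= n)%N -> P n u <= P m u.
Proof.
elim: n => [|n IH]; first by rewrite leqn0 => /eqP ->.
rewrite leq_eqVlt => /predU1P[->//|]; rewrite ltnS => /IH.
exact/le_trans/boundary_iterS.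
Qed.

Lemma boundary_iter_pinch j n : (0 < j <= n)%N -> P n (rho *+ j) = 0.
Proof.
elim: n j => [|n IH] j; first by case: j.
case: j => // j /= jn; rewrite mulrS addrAC subrr add0r.
case: j jn => [|j] jn; first by rewrite mulr0n lift_forcing0 mulr0.
by rewrite IH ?mulr0 ?tanh0 ?mul0r.
Qed.

(** Each fibre map is nondecreasing, continuous and fixes 0, so it maps [[0, a]] onto an interval
    starting at 0. Hence the images of the whole space are the regions below the images of the
    section [x = 1]. *)
Lemma iter_skew_mapP n u (x : unit_interval R) :
  (iter n (skew_map kappa rho) @` setT) (torus_of u, x) <-> x%:num <= P n u.
Proof.
elim: n u x => [|n IH] u x.
  split=> [_|_]; first exact: unit_interval_le1.
  by exists (torus_of u, x).
split.
  move=> [p _]; rewrite iterS; set q := iter n _ p => qE.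
  have q1 : torus_of (torus_rep q.1 + rho) = torus_of u := f_equal fst qE.
  have := f_equal snd qE => /= <- /=.
  have q1E : q.1 = torus_of (u - rho).
    by rewrite -(torus_of_repD u) -q1 torus_of_repD addrK torus_of_rep.
  rewrite q1E forcing_lift ler_wpM2r ?lift_forcing_ge0// ler_tanh// ler_wpM2l//.
  by apply/IH; exists p => //; rewrite -q1E -surjective_pairing.
move=> xP.
have [y /andP[y0 yP] xE] : exists2 y, 0 <= y <= P n (u - rho) &
    x%:num = tanh (k * y) * lift_forcing (u - rho).
  (* Where the forcing vanishes the whole fibre collapses to 0, and any preimage height will do. *)
  have [g0|gN0] := eqVneq (lift_forcing (u - rho)) 0.
    exists 0; first by rewrite lexx boundary_iter_ge0.
    by apply/eqP; rewrite g0 mulr0 eq_le ge0 andbT; move: xP => /=; rewrite g0 mulr0.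
  have g0 : 0 < lift_forcing (u - rho) by rewrite lt_neqAle eq_sym gN0 lift_forcing_ge0.
  have [|||y yP yE] := @tanh_ivt R k (P n (u - rho)) (x%:num / lift_forcing (u - rho)).
  - by [].
  - exact: boundary_iter_ge0.
  - by rewrite divr_ge0 ?lift_forcing_ge0//= ler_pdivrMr.
  by exists y => //; rewrite yE divfK.
have y1 : y <= 1 by rewrite (le_trans yP)// boundary_iter_le1.
have /IH[p _ pE] : (Itv01 y0 y1)%:num <= P n (u - rho) by [].
exists p => //; rewrite iterS pE; congr pair.
  by rewrite torus_of_repD subrK.
by apply: val_inj => /=; rewrite forcing_lift.
Qed.

Definition upper_lift u : R := upper_graph kappa rho (torus_of u).

Local Notation phi := upper_lift.

Lemma upper_lift_ge (a : R) u : 0 <= a -> (forall n, a <= P n u) -> a <= phi u.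
Proof.
move=> a0 aP; have a1 : a <= 1 by rewrite (le_trans (aP 0%N))// boundary_iter_le1.
apply: ub_le_sup.
  by exists 1 => _ [x _ <-]; exact: unit_interval_le1.
exists (Itv01 a0 a1) => // n /= n0.
exact/iter_skew_mapP/aP.
Qed.

Lemma upper_lift_le n u : phi u <= P n u.
Proof.
apply: ge_sup.
  exists 0, (0%:i01) => // m _; apply/iter_skew_mapP => /=.
  exact: boundary_iter_ge0.
move=> _ [x xA <-].
case: n => [|n]; first exact: unit_interval_le1.
by apply/iter_skew_mapP; apply: xA.
Qed.

Lemma upper_lift_ge0 u : 0 <= phi u.
Proof. by apply: upper_lift_ge => // n; exact: boundary_iter_ge0. Qed.

Lemma upper_lift_le1 u : phi u <= 1.
Proof. exact: upper_lift_le 0%N u. Qed.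

(** Together with [upper_lift_le] this makes [phi] the infimum of the boundary iterates; estimates
    uniform in [n] then pass to [phi] without any convergence argument. *)
Lemma upper_lift_lt (a : R) u : phi u < a -> exists n, P n u < a.
Proof.
move=> ua; apply: contrapT => /forallNP h.
have a0 : 0 <= a by rewrite (le_trans _ (ltW ua))// upper_lift_ge0.
suff : a <= phi u by rewrite leNgt ua.
by apply: upper_lift_ge => // n; rewrite leNgt; apply/negP; exact: h.
Qed.

Lemma upper_lift_pinch j : (0 < j)%N -> phi (rho *+ j) = 0.
Proof.
move=> j0; apply/eqP; rewrite eq_le upper_lift_ge0 andbT.
by rewrite (le_trans (upper_lift_le j _))// boundary_iter_pinch// j0/=.
Qed.

Lemma upper_lift_dist (a : R) u v : (forall n, `|P n u - P n v| <= a) ->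
  `|phi u - phi v| <= a.
Proof.
suff h x y : (forall n, `|P n x - P n y| <= a) -> phi x - phi y <= a.
  move=> uv; rewrite ler_norml lerNl opprB !h// => n.
  by rewrite distrC.
move=> xy; rewrite lerBlDl; apply/ler_addgt0Pl => e e0.
have /upper_lift_lt[n nP] : phi y < phi y + e by rewrite ltrDl.
have := xy n; rewrite ler_norml => /andP[_ h].
by have := upper_lift_le n x; lra.
Qed.

End boundary_iterates.

(** * Backlogs *)

Section backlog.
Implicit Types (Om Z : nat -> nat) (m k l n : nat).
Local Open Scope nat_scope.

(** A queue with time running down from [n]: on passing from [j + 1] to [j] one unit of the old
    backlog is served and [Om j.+1] arrives. The equation is conservation of work between [l] and
    [m]. *)
Lemma backlog_balance Om Z n m l :
  (forall j, j < n -> Z j = Om j.+1 + (Z j.+1).-1) -> m <= l <= n ->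
  Z m + \sum_(m <= j < l) (0 < Z j.+1) = \sum_(m <= j < l) Om j.+1 + Z l.
Proof.
move=> ZE /andP[]; elim: l => [|l IH].
  by rewrite leqn0 => /eqP -> _; rewrite !big_geq// addn0 add0n.
rewrite leq_eqVlt => /predU1P[-> _|]; first by rewrite !big_geq// addn0 add0n.
rewrite ltnS => ml ln; rewrite !big_nat_recr//= addnA IH// ?(ltnW ln)//.
rewrite -!addnA; congr addn; rewrite ZE//.
by case: (Z l.+1) => [|z]; rewrite /= ?addn0// addn1 addnS.
Qed.

(* While the backlog is positive every unit of time uses up one unit of work, so
   up to the first idle time [l >= k] all the busy time is accounted for by work
   that has arrived. *)
Lemma busy_time_le Om Z n m k :
  (forall j, j < n -> Z j = Om j.+1 + (Z j.+1).-1) -> Z n = 0 -> m <= k <= n ->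
  (forall l, k <= l <= n -> 8 * \sum_(m <= j < l) Om j.+1 <= l) ->
  8 * \sum_(m <= j < k) (0 < Z j.+1) <= k.+1.
Proof.
move=> ZE Zn /andP[mk kn] OmB.
have exl : exists l, (k <= l) && (Z l == 0) by exists n; rewrite kn Zn.
case: (ex_minnP exl) => l /andP[kl /eqP Zl] lmin.
have ln : l <= n by apply: lmin; rewrite kn Zn.
have := @backlog_balance Om Z n m l ZE; rewrite (leq_trans mk kl) ln => /(_ isT).
have := OmB l; rewrite kl ln => /(_ isT); set S := \sum_(m <= j < l) Om j.+1.
rewrite Zl (@big_cat_nat _ _ _ k)//=; set b := \sum_(m <= j < k) _.
(* No time from [k] up to [l - 1] is idle, by minimality of [l]; the predecessor discounts the idle
   time [l] itself. *)
have : l.-1 - k <= \sum_(k <= j < l) (0 < Z j.+1).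
  case: l kl Zl lmin ln @S => [|l] kl Zl lmin ln S //.
  have [->|lk] := eqVneq k l.+1; first by rewrite [X in X <= _](_ : _ = 0)//; lia.
  rewrite big_nat_recr /=; last by lia.
  apply: leq_trans (leq_addr _ _).
  rewrite -[leqLHS]mul1n -[leqLHS]mulnC -[leqLHS]sum_nat_const_nat.
  rewrite big_nat [leqRHS]big_nat; apply: leq_sum => j /andP[kj jl].
  have [Z0|_ //] := posnP (Z j.+1).
  by have := lmin j.+1; rewrite Z0 eqxx (leq_trans kj)// => /(_ isT); rewrite ltnNge jl.
lia.
Qed.

(** The last visit, at [l], excludes all others above [l - T], and the induction resumes there. *)
Lemma sparse_count (Q : pred nat) T m l :
  (forall j j', m <= j -> j < j' -> j' < l -> Q j -> Q j' -> T <= j' - j) ->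
  T * \sum_(m <= j < l) Q j <= (l - m) + T.
Proof.
elim/ltn_ind: l => l IH sep.
have [lm|ml] := leqP l m; first by rewrite big_geq// muln0.
case: l ml IH sep => // l ml IH sep.
rewrite big_nat_recr//=.
have IHl k : k <= l -> T * \sum_(m <= j < k) Q j <= k - m + T.
  move=> kl; apply: IH => // j j' mj jj' j'k.
  by apply: sep => //; rewrite ltnS (leq_trans (ltnW j'k)).
case Ql : (Q l); last by rewrite addn0 (leq_trans (IHl _ (leqnn _)))// leq_add2r; lia.
have [->|T0] := posnP T; first by rewrite mul0n.
have noQ j : m <= j -> l < T + j -> j < l -> (Q j : nat) = 0.
  by move=> mj jT jl; case Qj : (Q j) => //; have := sep j l mj jl (leqnn _) Qj Ql; lia.
have [lT|lT] := ltnP l (T + m).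
  rewrite big1_seq ?muln1 ?add0n; first by rewrite leq_addl.
  move=> j; rewrite mem_index_iota => /andP[_ /andP[mj jl]].
  by apply: noQ => //; lia.
have lTl : (l - T).+1 <= l by lia.
rewrite (@big_cat_nat _ _ _ (l - T).+1)/=; [|lia|lia].
rewrite [X in _ + X + _]big1_seq; last first.
  move=> j; rewrite mem_index_iota => /andP[_ /andP[mj jl]].
  by apply: noQ; lia.
by have := IHl _ lTl; lia.
Qed.

Lemma sum_divn_exp2 l V : \sum_(1 <= i < V.+1) l %/ 2 ^ i + l %/ 2 ^ V <= l.
Proof.
elim: V => [|V IH]; first by rewrite big_geq// expn0 divn1.
rewrite big_nat_recr//=; apply: leq_trans IH.
rewrite -addnA leq_add2l addnn -muln2 expnSr divnMA.
exact: leq_trunc_div.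
Qed.

(** Summation by levels: the sum of [Om] counts, for each [i] up to [V], the times with [Om j >= i].
    These are [16 * 2 ^ i] apart, so level [i] contributes at most [l / (16 * 2 ^ i) + 1]. *)
Lemma sparse_sum Om V m l :
  (forall j, m <= j < l -> Om j <= V) ->
  (forall i j j', 0 < i -> m <= j -> j < j' -> j' < l -> i <= Om j -> i <= Om j' ->
     16 * 2 ^ i <= j' - j) ->
  16 * \sum_(m <= j < l) Om j <= l + 16 * V.
Proof.
move=> OmV sep.
have -> : \sum_(m <= j < l) Om j =
    \sum_(1 <= i < V.+1) \sum_(m <= j < l) (i <= Om j).
  rewrite exchange_big/= big_nat [RHS]big_nat; apply: eq_bigr => j /OmV.
  move: (Om j) => a aV; rewrite (@big_cat_nat _ _ _ a.+1)//=.
  rewrite [X in _ = _ + X]big1_seq ?addn0; last first.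
    by move=> i; rewrite mem_index_iota => /andP[_ /andP[ai _]]; rewrite leqNgt ai.
  rewrite (@eq_big_nat _ _ _ _ _ _ (fun=> 1)); last first.
    by move=> i /andP[_]; rewrite ltnS => ->.
  by rewrite sum_nat_const_nat; lia.
rewrite big_distrr/=.
apply: (@leq_trans (\sum_(1 <= i < V.+1) (l %/ 2 ^ i + 16))).
  rewrite big_nat [leqRHS]big_nat; apply: leq_sum => i /andP[i0 _].
  have /(@sparse_count (fun j => i <= Om j)) : forall j j', m <= j -> j < j' ->
      j' < l -> i <= Om j -> i <= Om j' -> 16 * 2 ^ i <= j' - j.
    by move=> j j' mj jj' j'l; exact: sep.
  set N := \sum_(_ <= j < _) _ => h.
  have p0 : 0 < 2 ^ i by rewrite expn_gt0.
  rewrite -(@leq_pmul2r (2 ^ i))//.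
  have : 2 ^ i * (16 * N) <= l + 2 ^ i * 16.
    by move: h; rewrite [16 * 2 ^ i]mulnC -!mulnA; lia.
  move=> h2; have := leq_div2r (2 ^ i) h2.
  rewrite mulKn// divnDr ?dvdn_mulr// mulKn// => h3.
  by rewrite leq_pmul2r.
rewrite big_split/= sum_nat_const_nat leq_add//; last by lia.
exact: leq_trans (leq_addr _ _) (sum_divn_exp2 l V).
Qed.

End backlog.

(** * Accumulation of errors along a backward orbit *)

Section error_propagation.
Context {R : realType}.
Implicit Types (q delta : nat -> R).

(** Unrolling the recursion, the error [e] made after [k] steps reaches step 0 multiplied by the
    first [k] factors [q]. *)
Lemma error_propagation q delta (e S : R) n :
  0 <= e -> (forall j, 0 <= q j) ->
  (forall j, (j < n)%N -> delta j <= q j.+1 * delta j.+1 + e) -> delta n = 0 ->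
  \sum_(0 <= k < n) \prod_(0 <= j < k) q j.+1 <= S ->
  delta 0%N <= e * S.
Proof.
move=> e0 q0 dq dn hS.
suff h l : (l <= n)%N -> delta 0%N <=
    e * (\sum_(0 <= k < l) \prod_(0 <= j < k) q j.+1) +
    (\prod_(0 <= j < l) q j.+1) * delta l.
  by rewrite (le_trans (h n (leqnn _)))// dn mulr0 addr0 ler_wpM2l.
elim: l => [_|l IH ln]; first by rewrite !big_geq// mulr0 mul1r add0r.
rewrite (le_trans (IH (ltnW ln)))// !big_nat_recr//= mulrDr -addrA lerD2l.
set p := \prod_(0 <= _ < l) _.
have p0 : 0 <= p by apply: prodr_ge0.
by have := ler_wpM2l p0 (dq l ln); rewrite mulrDr mulrA; lra.
Qed.

(** With [b] bad factors among [k] the product is at most [B ^ (3 b - 2 k)], and the bound on [b]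
    makes this at most [B ^ (3 m + 1 - k)]. As [B >= 2], a geometric series of sum 2 dominates. *)
Lemma sum_prod_le (B : R) (bad : pred nat) q m n : 2 <= B ->
  (forall j, 0 <= q j) ->
  (forall j, q j <= if bad j then B else B ^- 2) ->
  (forall k, (k < n)%N -> 4 * \sum_(0 <= j < k) bad j.+1 <= 4 * m + k.+1)%N ->
  \sum_(0 <= k < n) \prod_(0 <= j < k) q j.+1 <= 2 * B ^+ (3 * m + 1).
Proof.
move=> B2 q0 qB badn.
have B0 : 0 < B by rewrite (lt_le_trans _ B2).
have bk k : (\sum_(0 <= j < k) bad j.+1 <= k)%N.
  rewrite (@leq_trans (\sum_(0 <= j < k) 1)%N)//.
    by apply: leq_sum => j _; case: (bad _).
  by rewrite sum_nat_const_nat subn0 muln1.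
have prodB k : \prod_(0 <= j < k) q j.+1 <=
    B ^+ (\sum_(0 <= j < k) bad j.+1) / B ^+ (2 * (k - \sum_(0 <= j < k) bad j.+1)).
  elim: k => [|k IH]; first by rewrite !big_geq// muln0 !expr0 divr1.
  rewrite !big_nat_recr//=; have := bk k; set b := (\sum_(0 <= j < k) _)%N in IH * => {}bk.
  apply: (le_trans (ler_pM _ _ IH (qB k.+1))) => //; first exact: prodr_ge0.
  case: (bad k.+1).
    by rewrite addn1 subSS exprSr mulrAC.
  by rewrite [(b + _)%N]addn0 subSn// mulnSr -mulrA -invfM -exprD.
apply: (@le_trans _ _ (\sum_(0 <= k < n) B ^+ (3 * m + 1) / 2 ^+ k)).
  rewrite big_nat [leRHS]big_nat; apply: ler_sum => k kn.
  rewrite (le_trans (prodB k))//.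
  apply: (@le_trans _ _ (B ^+ (3 * m + 1) / B ^+ k)); last first.
    rewrite ler_pM2l ?exprn_gt0// lef_pV2 ?posrE ?exprn_gt0//.
    by rewrite lerXn2r ?nnegrE// (le_trans _ B2).
  have := badn k kn; have := bk k; set b := (\sum_(_ <= j < _) _)%N => {}bk h.
  rewrite ler_pdivrMr ?exprn_gt0// mulrAC ler_pdivlMr ?exprn_gt0// -!exprD.
  have B1 : 1 < B by lra.
  by rewrite ler_eXn2l//; lia.
rewrite -mulr_sumr mulrC ler_pM2r ?exprn_gt0//.
have : \sum_(0 <= k < n) (2 ^+ k)^-1 + (2 ^+ n)^-1 * 2 = 2 :> R.
  elim: n {badn} => [|n IH]; first by rewrite big_geq// expr0 invr1 add0r mul1r.
  rewrite big_nat_recr//= -addrA -[RHS]IH; congr (_ + _).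
  by rewrite exprS invfM; field; rewrite expf_neq0.
have : 0 <= (2 ^+ n)^-1 * 2 :> R by rewrite mulr_ge0// invr_ge0 exprn_ge0.
lra.
Qed.

End error_propagation.

(** * Lipschitz pieces of the graph *)

(* [p] is the small parameter of all estimates, [kappa] being [p ^ (- 64)]; the last field
   is the only consequence of the Diophantine condition in use. *)
Record regime (R : realType) (D : nat) (kappa : {nonneg R}) (rho : 'rV[R]_D) (p : R)
    : Prop := Regime {
  regime_dim : (0 < D)%N ;
  regime_gt0 : 0 < p ;
  regime_small : p * (96 * D%:R) <= 4^-1 ;
  regime_kappa : kappa%:num * p ^+ 64 = 1 ;
  regime_recurrence : forall i n, (0 < i)%N -> (0 < n <= 32 ^ i)%N ->
    4 * D%:R * p ^+ i <= torus_norm (rho *+ n) }.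

Section lipschitz_pieces.
Context {R : realType} {D : nat} {kappa : {nonneg R}} {rho : 'rV[R]_D} {p : R}.
Hypothesis H : regime kappa rho p.
Implicit Types (u v : 'rV[R]_D) (i j k l m n o z : nat).

Local Notation kap := (kappa%:num).
Local Notation P := (boundary_iter kappa rho).
Local Notation G := lift_forcing.
Local Notation delta := (p ^+ 32).
Local Notation B := (4 * kappa%:num).

Let p0 := regime_gt0 H.

Lemma regime_dimR : 1 <= D%:R :> R.
Proof. by rewrite ler1n (regime_dim H). Qed.

Lemma regime_p_le : p <= 384^-1.
Proof. by have := regime_small H; have := regime_dimR; have := p0; nra. Qed.

Lemma regime_p_le1 : p <= 1.
Proof. by have := regime_p_le; lra. Qed.

Lemma regime_delta_gt0 : 0 < delta. Proof. by rewrite exprn_gt0// p0. Qed.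

Lemma regime_delta_small : delta * 2 ^+ 11 <= 1.
Proof.
have h : delta <= p ^+ 11 by rewrite ler_wiXn2l// ?(ltW p0)// regime_p_le1.
rewrite (le_trans (ler_wpM2r _ h)) ?exprn_ge0// -exprMn exprn_ile1//.
  by rewrite mulr_ge0// ltW// p0.
by have := regime_p_le; lra.
Qed.

Lemma regime_delta_le : delta <= 4^-1.
Proof.
have h : delta <= p by rewrite -[leRHS]expr1 ler_wiXn2l// ?(ltW p0)// regime_p_le1.
by rewrite (le_trans h)//; have := regime_p_le; lra.
Qed.

Lemma regime_delta_le1 : delta <= 1.
Proof. by have := regime_delta_le; lra. Qed.

Lemma regime_kappa_delta : kap * delta ^+ 2 = 1.
Proof. by rewrite -exprM (regime_kappa H). Qed.

Lemma regime_factor_ge2 : 2 <= B.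
Proof.
have := regime_kappa_delta; have := regime_delta_gt0; have := regime_delta_le.
have k0 : 0 <= kap by [].
move: delta => e e1 e0 h; have : kap * e ^+ 2 <= kap.
  by rewrite ler_piMr// exprn_ile1// ?ltW//; lra.
lra.
Qed.

(* [kap * delta = y] with [kap = y ^ 2]: a fixed power against an exponential. *)
Lemma regime_contraction : B * expR (- (2 * (kap * delta))) <= B ^- 2.
Proof.
set y := kap * delta; have kE : kap = y ^+ 2.
  by rewrite /y exprMn expr2 -mulrA (regime_kappa_delta) mulr1.
have yd : y * delta = 1 by rewrite /y -mulrA -expr2 regime_kappa_delta.
have y0 : 0 < y.
  rewrite /y mulr_gt0 ?regime_delta_gt0// lt_neqAle eq_sym ge0 andbT.
  by apply/eqP => k0; move: regime_kappa_delta; rewrite k0 mul0r => /eqP; rewrite eq_sym oner_eq0.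
(* In terms of [z] the claim is [2 ^ 18 * z ^ 6 <= expR z ^ 8], which follows from
   [2 ^ 9 <= z <= expR z]. *)
pose z := y / 4; have z0 : 0 < z by rewrite divr_gt0.
have z1 : 2 ^+ 9 <= z.
  have zd : z * delta = 4^-1 by rewrite /z mulrAC yd mul1r.
  rewrite -(ler_pM2r regime_delta_gt0) zd mulrC.
  have := regime_delta_small; rewrite -[11%N]/(9 + 2)%N exprD mulrA.
  by move: (delta * _) => t; lra.
have yE : y = 4 * z by rewrite /z; field.
clearbody z.
rewrite expRN kE ler_pdivrMr ?expR_gt0// [leRHS]mulrC ler_pdivlMr; last first.
  by rewrite exprn_gt0// mulr_gt0// exprn_gt0.
have -> : 4 * y ^+ 2 * (4 * y ^+ 2) ^+ 2 = (2 ^+ 9) ^+ 2 * z ^+ 6.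
  by rewrite yE -!exprM !exprMn; ring.
apply: (@le_trans _ _ (z ^+ 8)).
  rewrite -[8%N]/(2 + 6)%N exprD ler_wpM2r ?exprn_ge0 ?(ltW z0)//.
  by rewrite lerXn2r ?nnegrE ?exprn_ge0// ltW.
rewrite (_ : 2 * y = 8%:R * z); last by rewrite yE; ring.
rewrite expRM_natl lerXn2r ?nnegrE ?expR_ge0 ?(ltW z0)//.
by have := expR_ge1Dx z; lra.
Qed.

(** By [kap * delta ^ 2 = 1] the hyperbolic tangent is at least [delta ^ z.-1 / 2]: two powers are
    gained, or fewer once it saturates, which is why the predecessor is truncated at [z = 0]. The
    forcing then takes [o + 1] powers, and its factor 2 cancels the 1/2. *)
Lemma ge_boundary_step y (g : R) o z : delta ^+ z.+1 <= y ->
  2 * delta ^+ o.+1 <= g -> delta ^+ (o + z.-1).+1 <= tanh (kap * y) * g.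
Proof.
move=> zy og; have d0 := regime_delta_gt0; have dn n : 0 < delta ^+ n by rewrite exprn_gt0.
have y0 : 0 < y by exact: lt_le_trans (dn _) zy.
have : delta ^+ z.-1 / 2 <= tanh (kap * y).
  apply: le_trans (tanh_ge_min _); last by rewrite mulr_ge0// ltW.
  rewrite ler_pM2r// le_min exprn_ile1 ?(ltW d0)//; last exact: regime_delta_le1.
  rewrite andbT; apply: (@le_trans _ _ (kap * delta ^+ z.+1)); last by rewrite ler_wpM2l.
  have := regime_kappa_delta; case: z {zy} => [|z] kd /=.
    by rewrite expr0 -kd expr2 mulrA ler_piMr ?mulr_ge0 ?regime_delta_le1// ltW.
  by rewrite -[z.+2]/(2 + z)%N exprD mulrA kd mul1r.
move=> th; rewrite -addSn exprD.
rewrite (_ : _ * _ = (delta ^+ z.-1 / 2) * (2 * delta ^+ o.+1)); last by field.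
by apply: ler_pM => //; [rewrite divr_ge0// ltW|rewrite mulr_ge0// ltW].
Qed.

(** The least exponent is taken because its minimality, the last clause, shows in [delay_sum] how
    close the orbit is to the pinching point at each level [i]. *)
Lemma exists_delay (g : R) V : 2 * delta ^+ V.+1 <= g -> exists o,
  [/\ 2 * delta ^+ o.+1 <= g, (o <= V)%N &
      forall i, (0 < i <= o)%N -> g < 2 * delta ^+ i].
Proof.
move=> Vg; have ex : exists o, 2 * delta ^+ o.+1 <= g by exists V.
case: (ex_minnP ex) => o og omin; exists o; split=> //; first exact: omin.
by case=> // i /= io; rewrite ltNge; apply/negP => /omin; rewrite leqNgt io.
Qed.

Lemma exists_delays u (V : nat -> nat) (Q : pred nat) :
  (forall j, Q j -> 2 * delta ^+ (V j).+1 <= G (u - rho *+ j)) ->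
  exists Om : nat -> nat, forall j, Q j ->
  [/\ 2 * delta ^+ (Om j).+1 <= G (u - rho *+ j), (Om j <= V j)%N &
      forall i, (0 < i <= Om j)%N -> G (u - rho *+ j) < 2 * delta ^+ i].
Proof.
move=> QV.
have ex j : exists o, Q j ->
    [/\ 2 * delta ^+ o.+1 <= G (u - rho *+ j), (o <= V j)%N &
        forall i, (0 < i <= o)%N -> G (u - rho *+ j) < 2 * delta ^+ i].
  have [Qj|nQj] := boolP (Q j); last by exists 0%N.
  by have [a aP] := exists_delay (QV j Qj); exists a.
have [Om OmP] := boolp.choice ex.
by exists Om.
Qed.

(* Two visits with delay at least [i] are both [2 D delta^i]-close to the pinching
   point, so the Diophantine condition keeps them apart. *)
Lemma delay_sum u Om V m l :
  (forall j, (m <= j < l)%N -> (Om j.+1 <= V)%N) ->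
  (forall j, (m <= j < l)%N -> forall i, (0 < i <= Om j.+1)%N ->
     G (u - rho *+ j.+1) < 2 * delta ^+ i) ->
  (16 * \sum_(m <= j < l) Om j.+1 <= l + 16 * V)%N.
Proof.
move=> OmV OmG; apply: (@sparse_sum (fun j => Om j.+1)) => //.
move=> i j j' i0 mj jj' j'l ij ij'.
have D1 := regime_dimR; have D0 : 0 < D%:R :> R by rewrite (lt_le_trans _ D1).
have close j0 : (m <= j0 < l)%N -> (i <= Om j0.+1)%N ->
    torus_norm (u - rho *+ j0.+1) < 2 * D%:R * p ^+ i.
  move=> mjl ijo; have /(OmG _ mjl) : (0 < i <= Om j0.+1)%N by rewrite i0.
  have := lift_forcing_ge (u - rho *+ j0.+1); rewrite ler_pdivrMr// => h1 h2.
  rewrite (le_lt_trans h1)// [2 * _ * _]mulrAC ltr_pM2r//.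
  rewrite (lt_le_trans h2)// ler_pM2l// -exprM.
  by rewrite ler_wiXn2l ?(ltW p0) ?regime_p_le1//; lia.
rewrite leqNgt; apply/negP => jj'i.
(* The gap [16 * 2 ^ i] is at most [32 ^ i] because [i] is positive. *)
have /(regime_recurrence H i0) : (0 < j' - j <= 32 ^ i)%N.
  rewrite subn_gt0 jj'/= (leq_trans (ltnW jj'i))// -[32%N]/(16 * 2)%N expnMn.
  by rewrite leq_mul2r -{1}(expn1 16) leq_pexp2l ?orbT.
apply/negP; rewrite -ltNge.
have -> : rho *+ (j' - j) = (u - rho *+ j.+1) + - (u - rho *+ j'.+1).
  by rewrite opprB addrC addrA subrK -mulrnBr ?subSS// ltnS ltnW.
rewrite (le_lt_trans (torus_normD _ _))// torus_normN.
have h1 := close j; rewrite mj (ltn_trans jj' j'l) in h1.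
have h2 := close j'; rewrite j'l (leq_trans mj (ltnW jj')) in h2.
by have := h1 isT ij; have := h2 isT ij'; lra.
Qed.

Lemma shift_orbit u j : u - rho *+ j - rho = u - rho *+ j.+1.
Proof. by rewrite mulrSr opprD addrA. Qed.

(** The recursion is on the number [s = n - j] of steps from the end, as the backlog at [j] is
    determined by the one at [j + 1]. *)
Fixpoint backlog_rec Om n s : nat :=
  if s is s'.+1 then (Om (n - s') + (backlog_rec Om n s').-1)%N else 0%N.

Definition backlog Om n j : nat := backlog_rec Om n (n - j).

Lemma backlogn Om n : backlog Om n n = 0%N.
Proof. by rewrite /backlog subnn. Qed.

Lemma backlogS Om n j : (j < n)%N ->
  backlog Om n j = (Om j.+1 + (backlog Om n j.+1).-1)%N.
Proof.
move=> jn; rewrite /backlog -subnSK//=; congr addn; congr Om; lia.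
Qed.

(* [Om j] is the number of factors [delta] lost at the [j]-th backward step, where the
   forcing is small; each step with expansion regains one. *)
Lemma ge_boundary_backlog u Om m n :
  (forall j, (m <= j < n)%N -> 2 * delta ^+ (Om j.+1).+1 <= G (u - rho *+ j.+1)) ->
  forall j, (m <= j <= n)%N ->
    delta ^+ (backlog Om n j).+1 <= P (n - j) (u - rho *+ j).
Proof.
move=> OmG j /andP[mj jn]; rewrite -(subKn jn).
have : (n - j <= n - m)%N by lia.
elim: (n - j)%N => [|s IH] sn.
  by rewrite subn0 backlogn subnn expr1 regime_delta_le1.
have e : (n - s.+1).+1 = (n - s)%N by lia.
have sn' : (s < n)%N by lia.
rewrite backlogS ?e; last by lia.
rewrite subKn; last by lia.
rewrite /= shift_orbit e.
apply: ge_boundary_step; last by rewrite -e OmG//; lia.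
by have := IH (ltnW sn); rewrite subKn// ltnW.
Qed.

(** The factor [D] cancels the one in [lift_forcing_ge], and the factor 2 makes up for the 1/2 lost
    in [tanh_ge_min]. *)
Definition good_lift m u := forall j, (m < j)%N ->
  2 * D%:R * p ^+ (2 * j) <= torus_norm (u - rho *+ j).

Lemma good_lift_forcing u k V :
  2 * D%:R * p ^+ (2 * k) <= torus_norm u ->
  (k <= 16 * V.+1)%N -> 2 * delta ^+ V.+1 <= G u.
Proof.
move=> h kV; apply: le_trans (lift_forcing_ge _).
rewrite ler_pdivlMr ?ltr0n ?(regime_dim H)// mulrAC (le_trans _ h)// ler_wpM2l//.
by rewrite -exprM ler_wiXn2l ?(ltW p0) ?regime_p_le1//; lia.
Qed.

(** The delay at time [j] is at most [j / 16], because [delta = p ^ 32]. Both terms of [delay_sum]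
    are therefore at most [l], and the arriving work is at most [l / 8], as [busy_time_le]
    requires. *)
Lemma good_lift_busy u m n : good_lift m u -> exists Z : nat -> nat,
  (forall j, (m <= j <= n)%N -> delta ^+ (Z j).+1 <= P (n - j) (u - rho *+ j)) /\
  (forall k, (m <= k <= n)%N -> 8 * \sum_(m <= j < k) (0 < Z j.+1) <= k.+1)%N.
Proof.
move=> um.
have /exists_delays[Om OmP] : forall j, (m < j)%N ->
    2 * delta ^+ (j %/ 16).+1 <= G (u - rho *+ j).
  by move=> j mj; apply: good_lift_forcing (um j mj) _; rewrite mulnC ltnW// ltn_ceil.
exists (backlog Om n); split.
  apply: ge_boundary_backlog => j /andP[mj _].
  by have [] := OmP j.+1 mj.
move=> k mkn; apply: (@busy_time_le Om _ n) => //.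
- exact: backlogS.
- exact: backlogn.
move=> l _; have h : (16 * \sum_(m <= j < l) Om j.+1 <= l + 16 * (l %/ 16))%N.
  apply: (@delay_sum u) => j /andP[mj jl].
    by have [_ h _] := OmP j.+1 mj; rewrite (leq_trans h)// leq_div2r.
  by have [] := OmP j.+1 mj.
by have := leq_trunc_div l 16; lia.
Qed.

Lemma boundary_iter_lipschitz m n u v : good_lift m u -> good_lift m v ->
  `|P n u - P n v| <= 8 * B ^+ (3 * m + 1) * torus_norm (u - v).
Proof.
move=> um vm; have B2 := regime_factor_ge2; have B0 : 0 < B by lra.
have [Zu [Zuy Zub]] := good_lift_busy n um.
have [Zv [Zvy Zvb]] := good_lift_busy n vm.
pose y j := P (n - j) (u - rho *+ j); pose w j := P (n - j) (v - rho *+ j).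
(* The first [m] steps count as bad since [good_lift] says nothing about them. At every other step
   that is not bad both backlogs vanish, so both heights are at least [delta] and the contraction
   applies. *)
pose bad j := [|| (j <= m)%N, (0 < Zu j)%N | (0 < Zv j)%N].
pose q j := if bad j then B else B ^- 2.
have q0 j : 0 <= q j by rewrite /q; case: ifP => _; rewrite ?invr_ge0 ?exprn_ge0// ltW.
have := @error_propagation R q (fun j => `|y j - w j|) (4 * torus_norm (u - v))
  (2 * B ^+ (3 * m + 1)) n.
rewrite /y /w !subn0 !mulr0n !subr0.
rewrite (_ : 4 * _ * _ = 8 * B ^+ (3 * m + 1) * torus_norm (u - v)); last by ring.
apply => //.
- by rewrite mulr_ge0// torus_norm_ge0.
- move=> j jn; rewrite -subnSK//=.
  rewrite !shift_orbit -/(y j.+1) -/(w j.+1).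
  set a := G _; set b := G _.
  have a0 : 0 <= a := lift_forcing_ge0 _; have a1 : a <= 1 := lift_forcing_le1 _.
  have y0 : 0 <= y j.+1 := boundary_iter_ge0 _ _ _ _.
  have w0 : 0 <= w j.+1 := boundary_iter_ge0 _ _ _ _.
  have ab : `|a - b| <= 4 * torus_norm (u - v).
    by rewrite (le_trans (lift_forcing_lipschitz _ _))// opprB addrA subrK.
  set s := tanh (kap * y j.+1); set t := tanh (kap * w j.+1).
  have t0 : 0 <= t by rewrite tanh_ge0// mulr_ge0.
  have t1 : t <= 1 := tanh_le1 _.
  have st : `|s - t| <= q j.+1 * `|y j.+1 - w j.+1|.
    have nk : `|kap * y j.+1 - kap * w j.+1| = kap * `|y j.+1 - w j.+1|.
      by rewrite -mulrBr normrM ger0_norm.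
    rewrite /q; case: ifP => hb.
      by rewrite (le_trans (tanh_lipschitz _ _)) ?mulr_ge0// nk mulrA.
    have dy : delta <= y j.+1 /\ delta <= w j.+1.
      move: hb; rewrite /bad; have [//|mj] := leqP j.+1 m.
      have mjn : (m <= j.+1 <= n)%N by rewrite jn (leq_trans _ mj).
      have := Zuy _ mjn; have := Zvy _ mjn.
      by case: (Zu j.+1) => // ; case: (Zv j.+1) => // h1 h2 _; split.
    apply: (le_trans (@tanh_diff _ (kap * delta) _ _ _ _)).
    + by rewrite ler_wpM2l//; case: dy.
    + by rewrite ler_wpM2l//; case: dy.
    rewrite nk mulrA ler_wpM2r//; apply: le_trans regime_contraction.
    by rewrite mulrAC.
  rewrite (_ : s * a - t * b = (s - t) * a + t * (a - b)); last by ring.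
  rewrite (le_trans (ler_normD _ _))// lerD// normrM.
    by rewrite (ger0_norm a0) (le_trans _ st)// ler_piMr.
  by rewrite (ger0_norm t0) (le_trans _ ab)// ler_piMl.
- by rewrite subnn subrr normr0.
apply: (@sum_prod_le _ _ bad) => //.
move=> k kn.
have bad1 (s : seq nat) (F : pred nat) : (\sum_(j <- s) F j <= size s)%N.
  by rewrite -sum1_size; apply: leq_sum => i _; case: (F i).
have [mk|km] := leqP m k; last first.
  have := bad1 (index_iota 0 k) (bad \o succn); rewrite size_iota subn0 /=; lia.
rewrite (@big_cat_nat _ _ _ m)//=.
have := bad1 (index_iota 0 m) (bad \o succn); rewrite size_iota subn0 /= => h0.
have h1 : (\sum_(m <= j < k) bad j.+1 <=
    \sum_(m <= j < k) (0 < Zu j.+1) + \sum_(m <= j < k) (0 < Zv j.+1))%N.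
  rewrite -big_split/= big_nat [leqRHS]big_nat; apply: leq_sum => j /andP[mj _].
  by rewrite /bad ltnNge mj/=; case: (0 < Zu _)%N; case: (0 < Zv _)%N.
have mkn : (m <= k <= n)%N by rewrite mk ltnW.
have := Zub k mkn; have := Zvb k mkn; lia.
Qed.

Definition lip_const m : R := 8 * B ^+ (3 * m + 1).

Lemma upper_lift_lipschitz m u v : good_lift m u -> good_lift m v ->
  `|upper_lift kappa rho u - upper_lift kappa rho v| <= lip_const m * torus_norm (u - v).
Proof. by move=> um vm; apply: upper_lift_dist => n; exact: boundary_iter_lipschitz. Qed.

End lipschitz_pieces.

(** * Hausdorff measure *)

Section diameter.
Context {R : realType} {X : metricType R}.
Implicit Types (A B : set X) (d : R).
Local Open Scope ereal_scope.

Lemma diam_ge0 A : 0 <= diam A.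
Proof. by rewrite /diam le_max lexx. Qed.

Lemma mdist_le_diam A x y : A x -> A y -> (mdist x y)%:E <= diam A.
Proof.
by move=> Ax Ay; rewrite /diam le_max ereal_sup_ubound ?orbT//; exists x => //; exists y.
Qed.

Lemma diam_le A d : (0 <= d)%R -> (forall x y, A x -> A y -> (mdist x y <= d)%R) ->
  diam A <= d%:E.
Proof.
move=> d0 Ad; rewrite /diam ge_max lee_fin d0/=; apply: ge_ereal_sup.
by move=> _ [x Ax [y Ay <-]]; rewrite lee_fin Ad.
Qed.

Lemma diam0 : diam (set0 : set X) = 0.
Proof. by apply/eqP; rewrite eq_le diam_ge0 andbT; exact: diam_le. Qed.

End diameter.

(** * Measurability of open sets for a metric outer measure *)

Section separated.
Context {R : realType} {X : metricType R}.

Definition separated_by (eta : R) (A B : set X) :=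
  forall x y, A x -> B y -> eta <= mdist x y.

Local Open Scope ereal_scope.

(* Carathéodory's criterion.  For [Y] of finite outer measure the layers
   [R_ k = {a_ k.+1 <= f < a_ k}] are separated from [Y_ k.-1 = {a_ k.-1 <= f}],
   so [mu (R_ k)] is at most [mu (Y_ k.+1) - mu (Y_ k.-1)] and the tails of
   their sum vanish. *)
Lemma open_caratheodory (mu : {outer_measure set X -> \bar R}) :
  (forall eta A B, (0 < eta)%R -> separated_by eta A B -> mu A + mu B <= mu (A `|` B)) ->
  forall U : set X, open U -> mu.-caratheodory U.
Proof.
move=> musep U oU; apply: le_caratheodory_measurable => Y.
(* If [U] is the whole space, the distance [f] to its complement would be an infimum over the empty
   set. *)
have [UT|[z0 Uz0]] : ~` U = set0 \/ ~` U !=set0.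
  by have [->|/set0P] := eqVneq (~` U) set0; [left|right].
  by rewrite UT setI0 outer_measure0 adde0; apply: le_outer_measure => x [].
have [->|Yoo] := eqVneq (mu Y) +oo; first by rewrite leey.
have muY A : A `<=` Y -> mu A \is a fin_num.
  move=> AY; rewrite ge0_fin_numE ?outer_measure_ge0//.
  by rewrite (le_lt_trans (le_outer_measure mu _ _ AY))// ltey.
pose S x := [set mdist x y | y in ~` U].
have Slb x : lbound (S x) 0%R by move=> _ [y _ <-]; exact: mdist_ge0.
have S0 x : S x !=set0 by exists (mdist x z0), z0.
pose f x := inf (S x).
have f0 x : (0 <= f x)%R by apply: lb_le_inf.
have fle x y : ~ U y -> (f x <= mdist x y)%R.
  by move=> Uy; apply: ge_inf; [exists 0%R; exact: Slb|exists y].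
have flip x y : (f x - f y <= mdist x y)%R.
  rewrite lerBlDr -lerBlDl; apply: lb_le_inf => // _ [w Uw <-].
  by rewrite lerBlDl (le_trans (fle x w Uw))// metric_triangle.
have fU x : U x -> (0 < f x)%R.
  move=> Ux; have : nbhs x U by apply: open_nbhs_nbhs.
  move=> /nbhs_ballP[e /= e0 eU]; apply: (lt_le_trans e0).
  apply: lb_le_inf => // _ [w Uw <-]; rewrite leNgt; apply/negP => xw.
  by apply: Uw; apply: eU; rewrite ballEmdist.
have fNU x : ~ U x -> f x = 0%R.
  by move=> Ux; apply/eqP; rewrite eq_le f0 andbT -(mdistxx x) fle.
pose a n : R := (n.+1%:R^-1)%R.
have alt n : (a n.+1 < a n)%R by rewrite /a ltf_pV2 ?posrE// ltr_nat.
have a0 n : (0 < a n)%R by rewrite /a invr_gt0.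
pose Y_ n := Y `&` [set x | (a n <= f x)%R].
pose R_ n := Y `&` [set x | (a n.+1 <= f x < a n)%R].
pose y n := fine (mu (Y_ n)); pose r n := fine (mu (R_ n)).
have YE n : mu (Y_ n) = (y n)%:E by rewrite fineK// muY// => x [].
have RE n : mu (R_ n) = (r n)%:E by rewrite fineK// muY// => x [].
have yN n : (y n)%:E + mu (Y `&` ~` U) <= mu Y.
  rewrite -YE (le_trans (musep (a n) _ _ _ _))//.
    move=> x z [_ /= ax] [_ Uz]; apply: le_trans ax _.
    by have := flip x z; rewrite (fNU z Uz) subr0.
  by apply: le_outer_measure => x [] [].
have rle n : (r n.+1 <= y n.+2 - y n)%R.
  rewrite lerBrDl -lee_fin EFinD -YE -RE -YE.
  rewrite (le_trans (musep (a n - a n.+1)%R _ _ _ _)) ?subr_gt0//.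
    move=> x z [_ /= ax] [_ /= /andP[_ za]]; apply: le_trans (flip x z).
    by apply: lerB => //; exact: ltW.
  apply: le_outer_measure => x [] [Yx] /=; split => //=.
    by apply/ltW/(lt_le_trans (alt _))/ltW/(lt_le_trans (alt _)).
  by case/andP: b.
(* The bounds [rle] telescope with step two, so two consecutive values of [y] survive at each
   end. *)
have sumr n M : (y n + y n.+1 + \sum_(n.+1 <= k < (n + M).+1) r k <=
    y (n + M).+1 + y (n + M)%N)%R.
  elim: M => [|M IH]; first by rewrite addn0 big_geq// addr0 addrC.
  rewrite addnS big_nat_recr/= ?ltnS ?leq_addr//.
  by have := rle (n + M)%N; move: IH; lra.
pose L := sup (range y).
have yub : has_sup (range y).
  split; first by exists (y 0%N), 0%N.
  exists (fine (mu Y)) => _ [n _ <-]; rewrite fine_le ?muY//.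
    by move=> x [].
  by apply: le_outer_measure => x [].
have yL n : (y n <= L)%R by apply: sup_upper_bound => //; exists n.
have YL : mu (Y `&` U) <= L%:E.
  apply/lee_addgt0Pr => e e0.
  have [_ [n _ <-] nL] := sup_adherent e0 yub.
  have sub : Y `&` U `<=` Y_ n.+1 `|` \bigcup_(k in ~` `I_n.+1) R_ k.
    move=> x [Yx Ux]; have [ax|ax] := leP (a n.+1) (f x); first by left.
    right; have ex : exists k, (a k <= f x)%R.
      have [k kP] := ltr_add_invr (fU x Ux).
      by exists k; rewrite add0r in kP; exact: ltW.
    case: (ex_minnP ex) => [] [|k] ak kmin.
      by have := lt_trans ax (lt_le_trans (alt n) _); exfalso;
        move: ax; apply/negP; rewrite -leNgt (le_trans _ ak)//;
        rewrite /a lef_pV2 ?posrE// ler_nat.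
    have fk : (f x < a k)%R by rewrite ltNge; apply/negP => /kmin; rewrite ltnn.
    exists k; last by split => //=; rewrite ak.
    move=> /= kn; move: ax; apply/negP; rewrite -leNgt (le_trans _ ak)//.
    by rewrite /a lef_pV2 ?posrE// ler_nat.
  apply: (le_trans (le_outer_measure mu _ _ sub)).
  apply: (le_trans (outer_measureU2 mu _ _)).
  apply: (@le_trans _ _ ((y n.+1)%:E + (L + L - y n - y n.+1)%:E)); last first.
    by rewrite -!EFinD lee_fin; rewrite -/L in nL; lra.
  rewrite YE leeD2l//.
  apply: (le_trans (outer_measure_sigma_subadditive_tail mu n.+1 R_)).
  apply: lime_le; first by apply: is_cvg_nneseries => k _ _; exact: outer_measure_ge0.
  near=> M; rewrite (eq_bigr (fun k => (r k)%:E))//.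
  rewrite sumEFin lee_fin.
  have nM : (n < M)%N by near: M; exact: nbhs_infty_gt.
  have := sumr n (M - n).-1; rewrite (_ : (n + (M - n).-1).+1 = M); last by lia.
  by have := yL M; have := yL (n + (M - n).-1)%N; lra.
have YUN : mu (Y `&` ~` U) \is a fin_num by apply: muY => x [].
apply: (@le_trans _ _ (L%:E + mu (Y `&` ~` U))); first by rewrite leeD2r.
rewrite -(fineK YUN) -(fineK (muY Y (@subset_refl _ Y))) -EFinD lee_fin -lerBrDr.
apply: ge_sup; first by exists (y 0%N), 0%N.
move=> _ [n _ <-]; rewrite lerBrDr -lee_fin EFinD (fineK YUN) (fineK (muY Y (@subset_refl _ Y))).
exact: yN.
Unshelve. all: by end_near. Qed.

End separated.

Section hausdorff_outer_measure.
Context {R : realType} {X : pmetricType R}.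
Implicit Types (A B : set X) (s e d : R).
Local Open Scope ereal_scope.

Lemma premeasure_ge0 s e A : 0 <= hausdorff_premeasure s e A.
Proof.
apply: le_ereal_inf_tmp => _ [J [U [_ _ ->]]].
by apply: esum_ge0 => i _; exact: poweR_ge0.
Qed.

Lemma le_premeasure s e A B : A `<=` B ->
  hausdorff_premeasure s e A <= hausdorff_premeasure s e B.
Proof.
move=> AB; apply: ereal_inf_le_tmp => _ [J [U [BU Ud ->]]].
by exists J, U; split => //; exact: subset_trans BU.
Qed.

Lemma premeasure_anti s e e' A : (e <= e')%R ->
  hausdorff_premeasure s e' A <= hausdorff_premeasure s e A.
Proof.
move=> ee; apply: ereal_inf_le_tmp => _ [J [U [BU Ud ->]]].
by exists J, U; split => // i Ji; rewrite (le_trans (Ud i Ji))// lee_fin.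
Qed.

Lemma hausdorff_cvg s A :
  hausdorff_premeasure s e A @[e --> 0%R^'+] --> hausdorff_measure s A.
Proof.
apply: nonincreasing_at_right_is_cvge; near=> x => e e' _ _ ee.
exact: premeasure_anti.
Unshelve. all: by end_near. Qed.

Lemma hausdorff_measureE s A : hausdorff_measure s A =
  ereal_sup [set hausdorff_premeasure s e A | e in [set e | (0 < e)%R]].
Proof.
have h : hausdorff_premeasure s e A @[e --> 0%R^'+] -->
    ereal_sup ((fun e => hausdorff_premeasure s e A) @`
      [set` Interval (BRight 0%R) +oo%O]).
  apply: nonincreasing_at_right_cvge => // e e' _ _ ee.
  exact: premeasure_anti.
rewrite /hausdorff_measure (cvg_lim _ h)//; congr ereal_sup.
by apply/seteqP; split => _ [e /= e0 <-]; exists e => //;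
  move: e0; rewrite /= in_itv/= andbT.
Qed.

Lemma premeasure_le_hausdorff s e A : (0 < e)%R ->
  hausdorff_premeasure s e A <= hausdorff_measure s A.
Proof. by move=> e0; rewrite hausdorff_measureE; apply: ereal_sup_ubound; exists e. Qed.

Lemma hausdorff_le s A (b : \bar R) :
  (forall e, (0 < e)%R -> hausdorff_premeasure s e A <= b) -> hausdorff_measure s A <= b.
Proof.
by move=> h; rewrite hausdorff_measureE; apply: ge_ereal_sup => _ [e /= e0 <-]; exact: h.
Qed.

Lemma hausdorff_ge0 s A : 0 <= hausdorff_measure s A.
Proof. exact: le_trans (premeasure_ge0 s 1 A) (premeasure_le_hausdorff _ _ ltr01). Qed.

Lemma le_hausdorff s A B : A `<=` B -> hausdorff_measure s A <= hausdorff_measure s B.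
Proof.
move=> AB; apply: hausdorff_le => e e0.
exact: le_trans (le_premeasure s e AB) (premeasure_le_hausdorff s B e0).
Qed.

Lemma premeasure_finite_cover s e d n (U : 'I_n -> set X) A :
  (0 <= s)%R -> (0 <= d <= e)%R ->
  A `<=` \bigcup_i U i -> (forall i, diam (U i) <= d%:E) ->
  hausdorff_premeasure s e A <= (n%:R * d `^ s)%:E.
Proof.
move=> s0 /andP[d0 de] AU Ud.
pose V k := if insub k is Some i then U i else set0.
have VE (i : 'I_n) : V i = U i by rewrite /V insubT//= => ?; congr U; exact: val_inj.
apply: (@le_trans _ _ (\esum_(i in `I_n) (diam (V i) `^ s))).
  apply: ereal_inf_lbound; exists `I_n, V; split => //.
    by move=> x /AU[i _ Ux]; exists (i : nat) => //=; rewrite VE.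
  by move=> k /= kn; rewrite (VE (Ordinal kn)) (le_trans (Ud _))// lee_fin.
rewrite esum_fset//; last by move=> k _; exact: poweR_ge0.
rewrite -fsbig_ord (@le_trans _ _ (\sum_(i < n) (d `^ s)%:E))//.
  apply: lee_sum => i _; rewrite -poweR_EFin VE; apply: gt0_ler_poweR => //.
  - by rewrite in_itv/= diam_ge0 leey.
  - by rewrite in_itv/= lee_fin d0 leey.
by rewrite sumEFin lee_fin sumr_const card_ord mulr_natl.
Qed.

Section positive_dimension.
Variable s : R.
Hypothesis sN0 : s != 0%R.

Local Notation all_sets := (g_sigma_algebraType [set: set X]).

Let all_measurable (A : set all_sets) : measurable A.
Proof. exact: sub_sigma_algebra. Qed.

Let cost e (A : set all_sets) : \bar R :=
  if diam (A : set X) <= e%:E then diam (A : set X) `^ s else +oo.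

Let cost_ge0 e A : 0 <= cost e A.
Proof. by rewrite /cost; case: ifP => // _; exact: poweR_ge0. Qed.

(** The restriction on diameters becomes an infinite cost. As [s] is nonzero, empty sets cost
    nothing, and a cover indexed by [J] can be padded to one indexed by all of [nat]. *)
Let premeasureE e A : (0 <= e)%R ->
  hausdorff_premeasure s e A = @mu_ext _ all_sets R (cost e) A.
Proof.
move=> e0; apply/eqP; rewrite eq_le; apply/andP; split.
  apply: le_ereal_inf_tmp => _ [U [_ AU] <-].
  have [[i Uoo]|Ufin] := pselect (exists i, cost e (U i) = +oo).
    by rewrite (eseries_pinfty _ _ Uoo) ?leey// => n _; rewrite -ltNye (lt_le_trans _ (cost_ge0 e _)).
  apply: ereal_inf_lbound; exists setT, U; split => //.
    move=> i _; apply: contrapT => ni; apply: Ufin; exists i.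
    by rewrite /cost; case: ifP.
  rewrite nneseries_esumT//; apply: eq_esum => i _; rewrite /cost; case: ifPn => // ni.
  by exfalso; apply: Ufin; exists i; rewrite /cost (negbTE ni).
apply: le_ereal_inf_tmp => _ [J [U [AU Ud ->]]].
apply: ereal_inf_lbound; exists (fun i => if i \in J then U i else set0).
  split => [i|x /AU[i Ji Ux]]; first exact: all_measurable.
  by exists i => //; rewrite mem_set.
rewrite nneseries_esumT// [RHS]esum_mkcond; apply: eq_esum => i _.
case: ifPn => [|_]; first by rewrite inE => /Ud iU; rewrite /cost iU.
by rewrite /cost diam0 lee_fin e0 poweR0r.
Qed.

Lemma premeasure_sigma_subadditive e : (0 <= e)%R ->
  sigma_subadditive (hausdorff_premeasure s e : set X -> \bar R).
Proof.
move=> e0 F; rewrite premeasureE//.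
rewrite (le_trans (@mu_ext_sigma_subadditive _ all_sets R (cost e) (cost_ge0 e) F))//.
apply: lee_nneseries => [i _ _|i _]; last by rewrite premeasureE.
by rewrite -premeasureE//; exact: premeasure_ge0.
Qed.

Lemma hausdorff_sigma_subadditive :
  sigma_subadditive (hausdorff_measure s : set X -> \bar R).
Proof.
move=> F; apply: hausdorff_le => e e0.
rewrite (le_trans (premeasure_sigma_subadditive (ltW e0) F))//.
apply: lee_nneseries => i _ //; first by move=> _; exact: premeasure_ge0.
exact: premeasure_le_hausdorff.
Qed.

Lemma hausdorff0 : hausdorff_measure s (set0 : set X) = 0.
Proof.
apply/eqP; rewrite eq_le hausdorff_ge0 andbT; apply: hausdorff_le => e e0.
apply: ereal_inf_lbound; exists set0, (fun=> set0); split => //.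
by rewrite esum_set0.
Qed.

Definition hausdorff_outer : {outer_measure set X -> \bar R} :=
  HB.pack (hausdorff_measure s : set X -> \bar R)
   (isOuterMeasure.Build R X _ hausdorff0 (hausdorff_ge0 s) (@le_hausdorff s)
     hausdorff_sigma_subadditive).

(** A set of diameter at most [e < eta] cannot meet both [A] and [B], so each cover of the union
    splits into a cover of [A] and one of [B]. *)
Lemma premeasure_separated e eta A B : (e < eta)%R -> separated_by eta A B ->
  hausdorff_premeasure s e A + hausdorff_premeasure s e B <=
  hausdorff_premeasure s e (A `|` B).
Proof.
move=> eeta sep; apply: le_ereal_inf_tmp => _ [J [U [ABU Ud ->]]].
pose JA := [set i | J i /\ exists x, A x /\ U i x].
pose w i := diam (U i) `^ s; have w0 i : 0 <= w i by exact: poweR_ge0.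
rewrite (esumID JA); last by move=> i _; exact: w0.
apply: leeD.
  apply: ereal_inf_lbound; exists (J `&` JA), U; split => //.
    move=> x Ax; have [i Ji Ux] := ABU x (or_introl Ax).
    by exists i => //; split => //; split => //; exists x.
  by move=> i [Ji _]; exact: Ud.
apply: ereal_inf_lbound; exists (J `&` ~` JA), U; split => //.
  move=> y By; have [i Ji Uy] := ABU y (or_intror By).
  exists i => //; split => // -[_ [x [Ax Ux]]].
  have := le_trans (mdist_le_diam Ux Uy) (Ud i Ji); rewrite lee_fin => xy.
  by have := le_lt_trans (le_trans (sep x y Ax By) xy) eeta; rewrite ltxx.
by move=> i [Ji _]; exact: Ud.
Qed.

Lemma hausdorff_separated eta A B : (0 < eta)%R -> separated_by eta A B ->
  hausdorff_measure s A + hausdorff_measure s B <= hausdorff_measure s (A `|` B).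
Proof.
move=> eta0 sep.
have cAB : hausdorff_premeasure s e A + hausdorff_premeasure s e B @[e --> 0%R^'+] -->
    hausdorff_measure s A + hausdorff_measure s B.
  apply: cvgeD; [|exact: hausdorff_cvg|exact: hausdorff_cvg].
  by apply: ge0_adde_def; rewrite inE hausdorff_ge0.
rewrite -(cvg_lim _ cAB)//; apply: lime_le; first by apply/cvg_ex; eexists; exact: cAB.
near=> e; apply: (@le_trans _ _ (hausdorff_premeasure s e (A `|` B))).
  by apply: (@premeasure_separated e eta).
exact: premeasure_le_hausdorff.
Unshelve. all: by end_near. Qed.

Lemma borel_caratheodory (A : set (borel X)) :
  measurable A -> hausdorff_outer.-caratheodory (A : set X).
Proof.
move: A; apply: smallest_sub; first split.
- exact: caratheodory_measurable_set0.
- by move=> A mA; rewrite setTD; exact: caratheodory_measurable_setC.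
- exact: caratheodory_measurable_bigcup.
move=> U oU; apply: open_caratheodory => // eta A B; exact: hausdorff_separated.
Qed.

Lemma hausdorff_sigma_additive :
  semi_sigma_additive (hausdorff_measure s : set (borel X) -> \bar R).
Proof.
move=> F mF tF mUF.
have := @caratheodory_measure_sigma_additive R X hausdorff_outer F.
apply => //; first by move=> i; exact: borel_caratheodory (mF i).
exact: borel_caratheodory mUF.
Qed.

Definition hausdorff_borel : {measure set (borel X) -> \bar R} :=
  HB.pack (hausdorff_measure s : set (borel X) -> \bar R)
   (isMeasure.Build _ _ _ (hausdorff_measure s : set (borel X) -> \bar R)
     hausdorff0 (hausdorff_ge0 s) hausdorff_sigma_additive).

End positive_dimension.
End hausdorff_outer_measure.

(** * Lebesgue measure on the torus *)

Section metric_balls.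
Context {R : realType}.

Lemma open_mball (X : metricType R) (x : X) (e : R) : open (ball x e).
Proof.
rewrite openE => y; rewrite ballEmdist/= => xy; apply/nbhs_ballP; exists (e - mdist x y).
  by rewrite /= subr_gt0.
move=> z; rewrite !ballEmdist/= => yz.
by have := metric_triangle x y z; lra.
Qed.

Lemma measurable_mball (X : pmetricType R) (x : X) (e : R) :
  measurable (ball x e : set (borel X)).
Proof. by apply: sub_sigma_algebra; exact: open_mball. Qed.

Lemma measurable_cball (X : pmetricType R) (x : X) (e : R) :
  measurable ([set y | mdist x y <= e] : set (borel X)).
Proof.
rewrite (_ : [set _ | _] = ~` [set y : X | e < mdist x y]); last first.
  by apply/seteqP; split => y /=; rewrite leNgt => /negP.
apply: measurableC; apply: sub_sigma_algebra => /=.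
rewrite openE => y /= ey; apply/nbhs_ballP; exists (mdist x y - e).
  by rewrite /= subr_gt0.
move=> z; rewrite ballEmdist/= => yz /=.
by have := metric_triangle x z y; rewrite (metric_sym z y); lra.
Qed.

End metric_balls.

(** * Separability and Borel measurability *)

Section separable.
Context {R : realType}.

Definition separable (X : pmetricType R) :=
  exists s : nat -> X, forall x (e : R), 0 < e -> exists n, mdist x (s n) < e.

Lemma separable_countable (X : pmetricType R) (I : countType) (f : I -> X) :
  (forall x (e : R), 0 < e -> exists i, mdist x (f i) < e) -> separable X.
Proof.
move=> fP; exists (fun n => if unpickle n is Some i then f i else point).
by move=> x e /(fP x)[i fi]; exists (pickle i); rewrite pickleK.
Qed.

Lemma separable_prod (X Y : pmetricType R) :
  separable X -> separable Y -> separable (X * Y)%type.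
Proof.
move=> [s sP] [t tP]; apply: (@separable_countable _ (nat * nat)%type
  (fun n => (s n.1, t n.2) : X * Y)) => -[x y] e e0.
have [n xn] := sP x e e0; have [k yk] := tP y e e0.
by exists (n, k); rewrite /mdist/= /prod_dist/= gt_max xn yk.
Qed.

Lemma separable_torus D : separable (torus R D).
Proof.
apply: (@separable_countable _ (D.-tuple rat)
  (fun q => torus_of (\row_i ratr (tnth q i)))) => x e e0.
have d0 : 0 < e / D.+1%:R by rewrite divr_gt0.
have /boolp.choice[q qP] : forall i : 'I_D, exists q : rat,
    `|torus_rep x 0 i - ratr q| < e / D.+1%:R.
  move=> i; have : torus_rep x 0 i < torus_rep x 0 i + e / D.+1%:R by rewrite ltrDl.
  move=> /rat_in_itvoo[q]; rewrite in_itv/= => /andP[q1 q2]; exists q.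
  by rewrite distrC ger0_norm ?subr_ge0 ?(ltW q1)// ltrBlDl.
exists [tuple q i | i < D].
rewrite -{1}(torus_of_rep x) [mdist _ _]torus_distE.
rewrite (le_lt_trans (torus_norm_le_euclid _))//.
rewrite (le_lt_trans (euclid_norm_le_sum _))//.
apply: (@le_lt_trans _ _ (\sum_(i < D) e / D.+1%:R)).
  by apply: ler_sum => i _; rewrite !mxE tnth_mktuple ltW// qP.
rewrite sumr_const card_ord -[_ *+ _]mulr_natr mulrAC ltr_pdivrMr//.
by rewrite ltr_pM2l// ltr_nat.
Qed.

Lemma separable_unit_interval : separable (unit_interval R).
Proof.
have c0 (q : rat) : 0 <= Num.max 0 (Num.min 1 (ratr q)) :> R by rewrite le_max lexx.
have c1 (q : rat) : Num.max 0 (Num.min 1 (ratr q)) <= 1 :> R.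
  by rewrite ge_max ge_min lexx ler01.
apply: (@separable_countable (unit_interval R) rat (fun q => Itv01 (c0 q) (c1 q))).
move=> x e e0; have x0 := unit_interval_ge0 x; have x1 := unit_interval_le1 x.
have : x%:num < x%:num + e by rewrite ltrDl.
move=> /rat_in_itvoo[q]; rewrite in_itv/= => /andP[q1 q2].
exists q; rewrite /mdist/= /unit_dist /=.
rewrite max_r; last by rewrite le_min ler01 (le_trans x0)// ltW.
by rewrite /Num.min; case: ifPn => q3; rewrite ltr_norml; apply/andP; split; lra.
Qed.

(** In a separable space an open set is a countable union of balls with centres in the dense
    sequence, and preimages of balls are sublevel sets of distance functions. *)
Lemma measurable_borel d (T : measurableType d) (X : pmetricType R) (f : T -> X) :
  separable X -> (forall x, measurable_fun setT (fun t => mdist (f t) x)) ->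
  measurable_fun setT (f : T -> borel X).
Proof.
move=> [s sP] mf; apply: measurability; first by [].
move=> _ [U oU <-]; rewrite setTI.
rewrite (_ : f @^-1` U = \bigcup_n \bigcup_k (if `[< ball (s n) k.+1%:R^-1 `<=` U >]
    then [set t | mdist (f t) (s n) < k.+1%:R^-1] else set0)); last first.
  apply/seteqP; split => [t /= Ut|t [n _ [k _]]]; last first.
    case: asboolP => // nU /= tn; apply: nU.
    by rewrite ballEmdist/= metric_sym.
  have : nbhs (f t) U by apply: open_nbhs_nbhs.
  move=> /nbhs_ballP[e /= e0 eU].
  have e20 : 0 < e / 2 by rewrite divr_gt0.
  have [k kP] := ltr_add_invr e20; rewrite add0r in kP.
  have k0 : 0 < k.+1%:R^-1 :> R by [].
  have [n nP] := sP (f t) _ k0.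
  exists n => //; exists k => //; case: asboolP => //= nU; exfalso; apply: nU.
  move=> z; rewrite ballEmdist/= => zn; apply: eU; rewrite ballEmdist/=.
  rewrite (le_lt_trans (metric_triangle _ (s n) _))//.
  by have := ltrD nP zn; move: kP; set a := k.+1%:R^-1; lra.
apply: bigcupT_measurable => n; apply: bigcupT_measurable => k.
case: asboolP => // _.
have := mf (s n) measurableT `]-oo, k.+1%:R^-1[%classic (measurable_itv _).
by rewrite setTI; congr measurable; apply/seteqP; split => t /=; rewrite in_itv.
Qed.

End separable.

Section lebesgue_torus_measure.
Context {R : realType}.

Lemma measurable_int_dist : measurable_fun setT (@int_dist R).
Proof.
apply: continuous_measurable_fun => x; apply/cvgrPdist_le => e e0.
near=> y; apply: (@le_trans _ _ `|x - y|); last first.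
  by near: y; exact: cvgr_dist_le.
have h a b : int_dist a - int_dist b <= `|a - b| :> R.
  rewrite lerBlDr (le_trans _ (lerD (int_dist_norm _) (lexx _)))//.
  by rewrite -{1}(subrK b a) int_distD.
by rewrite ler_norml h andbT lerNl opprB distrC h.
Unshelve. all: by end_near. Qed.

Lemma uniform01E (U : set R) : measurable U ->
  uniform_prob (@ltr01 R) U = lebesgue_measure (U `&` `[0, 1]).
Proof.
move=> mU; have mUI : measurable (U `&` `[0, 1]%classic) by exact: measurableI.
rewrite /uniform_prob integral_uniform_pdf (eq_integral (fun=> 1%E)); last first.
  move=> x; rewrite inE /= => -[_]; rewrite in_itv/= /uniform_pdf => ->.
  by rewrite subr0 invr1.
by rewrite integral_cst// mul1e.
Qed.

Lemma measurable_arc (a h : R) : measurable [set t : R | int_dist (t - a) <= h].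
Proof.
have m : measurable_fun setT (fun t : R => int_dist (t - a)).
  by apply: measurableT_comp; [exact: measurable_int_dist|exact: measurable_funB].
have := m measurableT `]-oo, h]%classic (measurable_itv _).
by rewrite setTI; congr measurable; apply/seteqP; split => t /=; rewrite in_itv.
Qed.

(** Inside [[0, 1]] the arc is covered by three intervals of length [2 * h], around [a - 1], [a] and
    [a + 1]. *)
Lemma arc_le (a h : R) : 0 <= a < 1 -> 0 <= h ->
  (uniform_prob (@ltr01 R) [set t | (int_dist (t - a) <= h)%R] <= (6 * h)%:E)%E.
Proof.
move=> /andP[a0 a1] h0; rewrite uniform01E; last exact: measurable_arc.
pose I (k : R) : set R := `[a + k - h, a + k + h]%classic.
have mI k : measurable (I k) by exact: measurable_itv.
have II k : (lebesgue_measure (I k) <= (2 * h)%:E)%E.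
  rewrite /I lebesgue_measure_itv/= lte_fin; case: ifP => _; last by rewrite lee_fin mulr_ge0.
  by rewrite -EFinB lee_fin; lra.
apply: (@le_trans _ _ (lebesgue_measure (I (-1) `|` (I 0 `|` I 1)))).
  apply: le_measure; rewrite ?inE.
  - by apply: measurableI => //; exact: measurable_arc.
  - by apply: measurableU; [exact: mI|apply: measurableU; exact: mI].
  move=> t [/= th]; rewrite in_itv/= => /andP[t0 t1].
  have [k kE] := int_dist_ex (t - a); have := int_dist_le_half (t - a).
  rewrite kE => kh; rewrite kE in th.
  have : -2 < (k%:~R : R) < 2.
    by move: kh; rewrite ler_norml => /andP[? ?]; apply/andP; split; lra.
  move=> /andP[k1 k2].
  have {}k1 : (-2 < k)%R by rewrite -(ltr_int R) mulrNz.
  have {}k2 : (k < 2)%R by rewrite -(ltr_int R).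
  have : k = -1 \/ k = 0 \/ k = 1 by lia.
  move: th; rewrite ler_norml => /andP[? ?] [kk|[kk|kk]]; subst k.
  - by left; rewrite /I/= in_itv/=; apply/andP; split; lra.
  - by right; left; rewrite /I/= in_itv/=; apply/andP; split; lra.
  - by right; right; rewrite /I/= in_itv/=; apply/andP; split; lra.
have mU : measurable (I 0 `|` I 1) by apply: measurableU; exact: mI.
have := @measureU2 _ _ _ (@lebesgue_measure R) _ _ (mI (-1)) mU.
move=> /le_trans; apply.
apply: (@le_trans _ _ ((2 * h)%:E + ((2 * h)%:E + (2 * h)%:E))%E).
  apply: leeD; first exact: II.
  have := @measureU2 _ _ _ (@lebesgue_measure R) _ _ (mI 0) (mI 1).
  by move=> /le_trans; apply; apply: leeD; exact: II.
by rewrite -!EFinD lee_fin; lra.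
Qed.

Lemma arc_ge (a h : R) : 0 <= a < 1 -> 0 <= h <= 2^-1 ->
  (h%:E <= uniform_prob (@ltr01 R) [set t | (int_dist (t - a) <= h)%R])%E.
Proof.
move=> /andP[a0 a1] /andP[h0 h1]; rewrite uniform01E; last exact: measurable_arc.
(* One of the halves [[a - h, a]] and [[a, a + h]] of the arc lies in [[0, 1]]; [b] is its left
   end. *)
have [b [bh0 bh1 b0 b1]] : exists b, [/\ a - h <= b, b <= a, 0 <= b & b + h <= 1].
  by have [ah|ah] := leP a 2^-1; [exists a|exists (a - h)]; split; lra.
rewrite (_ : h%:E = lebesgue_measure `[b, b + h]%classic); last first.
  rewrite lebesgue_measure_itv/= lte_fin ltrDl; case: ltgtP h0 => // [_ _|<- _//].
  by rewrite -EFinB addrAC subrr add0r.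
apply: le_measure; rewrite ?inE//.
  by apply: measurableI => //; exact: measurable_arc.
move=> t /=; rewrite !in_itv/= => /andP[t0 t1]; split; last by apply/andP; split; lra.
by rewrite (le_trans (int_dist_norm _))// ler_norml; apply/andP; split; lra.
Qed.

Lemma measurable_box n (S : 'I_n -> set R) : (forall i, measurable (S i)) ->
  measurable [set t : n.-tuple R | forall i, S i (tnth t i)].
Proof.
move=> mS; rewrite (_ : [set _ | _] =
  \bigcap_(i in [set: 'I_n]) ((@tnth n R)^~ i @^-1` S i)); last first.
  by apply/seteqP; split => t /= h i *; exact: h.
apply: fin_bigcap_measurable => // i _.
by have := @measurable_tnth _ R n i measurableT _ (mS i); rewrite setTI.
Qed.

Lemma lebesgue_cube_box n (S : 'I_n.+1 -> set R) : (forall i, measurable (S i)) ->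
  lebesgue_cube n.+1 [set t : n.+1.-tuple R | forall i, S i (tnth t i)] =
  (uniform_prob (@ltr01 R) (S ord0) *
   lebesgue_cube n [set t : n.-tuple R | forall i, S (lift ord0 i) (tnth t i)])%E.
Proof.
move=> mS; rewrite /= /distribution /pushforward.
rewrite -product_measure1E; [|exact: mS|exact: (@measurable_box _ (fun i => S (lift ord0 i)))].
congr ((_ \x _)%E _); apply/seteqP; split=> [[x t] /= h|[x t] /= [h0 h] i].
  split; first by have := h ord0; rewrite tnth0.
  by move=> i; have := h (lift ord0 i); rewrite tnthS.
by case: (unliftP ord0 i) => [j|] ->; rewrite ?tnth0// tnthS; exact: h.
Qed.

Lemma lebesgue_cube_box_le n (S : 'I_n -> set R) (a : R) : 0 <= a ->
  (forall i, measurable (S i)) -> (forall i, (uniform_prob (@ltr01 R) (S i) <= a%:E)%E) ->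
  (lebesgue_cube n [set t : n.-tuple R | forall i, S i (tnth t i)] <= (a ^+ n)%:E)%E.
Proof.
move=> a0; elim: n S => [|n IH] S mS Sa.
  by rewrite /= expr0 diracE; case: (_ \in _); rewrite lee_fin.
by rewrite lebesgue_cube_box// exprS EFinM; apply: lee_pmul => //;
  exact: (IH (fun i => S (lift ord0 i))).
Qed.

Lemma lebesgue_cube_box_ge n (S : 'I_n -> set R) (a : R) : 0 <= a ->
  (forall i, measurable (S i)) -> (forall i, (a%:E <= uniform_prob (@ltr01 R) (S i))%E) ->
  ((a ^+ n)%:E <= lebesgue_cube n [set t : n.-tuple R | forall i, S i (tnth t i)])%E.
Proof.
move=> a0; elim: n S => [|n IH] S mS Sa.
  by rewrite /= expr0 diracE mem_set//= => -[].
rewrite lebesgue_cube_box// exprS EFinM; apply: lee_pmul => //;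
  last exact: (IH (fun i => S (lift ord0 i))).
by rewrite lee_fin exprn_ge0.
Qed.

Definition torus_of_tuple D (t : D.-tuple R) : borel (torus R D) :=
  torus_of (\row_i tnth t i).

Lemma measurable_torus_of_tuple D : measurable_fun setT (@torus_of_tuple D).
Proof.
apply: measurable_borel => [|x]; first exact: separable_torus.
rewrite -(torus_of_rep x) (_ : (fun _ => _) = fun t : D.-tuple R =>
  Num.sqrt (\sum_i (int_dist (tnth t i - torus_rep x 0 i)) ^+ 2)); last first.
  apply/funext => t; rewrite [mdist _ _]torus_distE /torus_norm /euclid_norm.
  by congr Num.sqrt; apply: eq_bigr => i _; rewrite !mxE.
apply: measurableT_comp.
  by apply: continuous_measurable_fun; exact: sqrt_continuous.
apply: measurable_sum => i; apply: measurable_funX.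
apply: measurableT_comp; first exact: measurable_int_dist.
by apply: measurable_funB => //; exact: measurable_tnth.
Qed.

HB.instance Definition _ D := isMeasurableFun.Build _ _ _ _ (@torus_of_tuple D)
  (@measurable_torus_of_tuple D).

Definition torus_prob D : probability (borel (torus R D)) R :=
  distribution (lebesgue_cube D) (@torus_of_tuple D).

Lemma torus_prob_ball_le D (x : torus R D) (h : R) : 0 <= h ->
  (torus_prob D [set y | (mdist x y <= h)%R] <= ((6 * h) ^+ D)%:E)%E.
Proof.
move=> h0; pose S i := [set s | int_dist (s - torus_rep x 0 i) <= h].
have mS i : measurable (S i) by exact: measurable_arc.
have xi i : 0 <= torus_rep x 0 i < 1 by have /forallP/(_ i) := torus_repP x.
have := @lebesgue_cube_box_le D S (6 * h) (mulr_ge0 (ler0n _ _) h0) mS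
  (fun i => arc_le (xi i) h0).
apply: le_trans.
have -> : torus_prob D [set y | (mdist x y <= h)%R] =
  lebesgue_cube D (@torus_of_tuple D @^-1` [set y | mdist x y <= h]) by [].
apply: le_measure; rewrite ?inE.
- have mb := @measurable_torus_of_tuple D measurableT.
  have := mb [set y | mdist x y <= h]; rewrite setTI; apply.
  exact: measurable_cball.
- exact: measurable_box.
move=> t /=; rewrite -{1}(torus_of_rep x) /torus_of_tuple [mdist _ _]torus_distE.
move=> th i; rewrite /S/=; apply: le_trans th; apply: le_trans (int_dist_le_torus_norm _ i).
by rewrite !mxE -int_distN opprB.
Qed.

(** The box of half-width [h / (2 * D)] has norm at most [h / 2], so it lies in the open ball; each
    side contributes at least its half-width by [arc_ge]. *)
Lemma torus_prob_ball_ge D (x : torus R D) (h : R) : (0 < D)%N -> 0 < h <= 1 ->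
  (((h / (2 * D%:R)) ^+ D)%:E <= torus_prob D (ball x h))%E.
Proof.
move=> D0 /andP[h0 h1]; pose b := h / (2 * D%:R).
have D1 : 1 <= D%:R :> R by rewrite ler1n.
have b0 : 0 < b by rewrite divr_gt0// mulr_gt0// (lt_le_trans _ D1).
have bE : b * D%:R = h / 2 by rewrite /b; field; lra.
have bh : 0 <= b <= 2^-1 by apply/andP; split; nra.
pose S i := [set s | int_dist (s - torus_rep x 0 i) <= b].
have mS i : measurable (S i) by exact: measurable_arc.
have xi i : 0 <= torus_rep x 0 i < 1 by have /forallP/(_ i) := torus_repP x.
apply: (le_trans (@lebesgue_cube_box_ge D S b (ltW b0) mS (fun i => arc_ge (xi i) bh))).
apply: le_measure; rewrite ?inE.
- exact: measurable_box.
- have := @measurable_torus_of_tuple D measurableT (ball x h); rewrite setTI; apply.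
  by apply: sub_sigma_algebra; exact: open_mball.
move=> t /= tS; rewrite /torus_of_tuple ballEmdist/= -(torus_of_rep x) [mdist _ _]torus_distE.
rewrite (le_lt_trans (torus_norm_le_sum _))//.
apply: (@le_lt_trans _ _ (\sum_(i < D) b)).
  by apply: ler_sum => i _; have := tS i; rewrite /S/= !mxE -int_distN opprB.
by rewrite sumr_const card_ord -mulr_natr bE; lra.
Qed.

End lebesgue_torus_measure.

(** * Hausdorff measure of Lipschitz graphs *)

Section hausdorff_exponents.
Context {R : realType} {X : pmetricType R}.
Implicit Types (A B : set X) (s t e : R).
Local Open Scope ereal_scope.

Lemma poweR_exponent (d : \bar R) s t e : (0 < s <= t)%R -> 0 <= d -> d <= e%:E ->
  d `^ t <= (e `^ (t - s))%:E * d `^ s.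
Proof.
move=> /andP[s0 st]; case: d => // d; rewrite !lee_fin => d0 de.
have t0 : (0 < t)%R by exact: lt_le_trans st.
have [->|dN0] := eqVneq d 0%R.
  by rewrite powR0 ?gt_eqF// mulr_ge0 ?powR_ge0.
have -> : (d `^ t = d `^ (t - s) * d `^ s)%R by rewrite -powRD ?subrK// dN0 implybT.
rewrite ler_wpM2r ?powR_ge0//.
by rewrite ge0_ler_powR ?nnegrE ?subr_ge0// (le_trans d0).
Qed.

Lemma premeasure_exponent s t e A : (0 < s <= t)%R -> (0 < e)%R ->
  hausdorff_premeasure t e A <= (e `^ (t - s))%:E * hausdorff_premeasure s e A.
Proof.
move=> st e0; have c0 : (0 < e `^ (t - s))%R by exact: powR_gt0.
rewrite -lee_pdivrMl//; apply: le_ereal_inf_tmp => _ [J [U [AU Ud ->]]].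
rewrite lee_pdivrMl//.
apply: (@le_trans _ _ (\esum_(i in J) (diam (U i) `^ t))).
  by apply: ereal_inf_lbound; exists J, U.
rewrite esum_mkcond [in leRHS]esum_mkcond -!nneseries_esumT; last 2 first.
- by move=> n; case: ifP => // _; exact: poweR_ge0.
- by move=> n; case: ifP => // _; exact: poweR_ge0.
rewrite -nneseriesZl; last by move=> n _; case: ifP => // _; exact: poweR_ge0.
apply: lee_nneseries => n _; first by move=> _; case: ifP => // _; exact: poweR_ge0.
case: ifPn => [|_]; last by rewrite mule0.
by rewrite inE => Jn; apply: poweR_exponent => //; [exact: diam_ge0|exact: Ud].
Qed.

Lemma exists_powR_le (a b : R) : (0 < a)%R -> (0 < b)%R ->
  exists2 e, (0 < e)%R & (e `^ a = b)%R.
Proof.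
move=> a0 b0; exists (b `^ a^-1)%R; first exact: powR_gt0.
by rewrite -powRrM mulVf ?gt_eqF// powRr1// ltW.
Qed.

Lemma hausdorff_finite_zero s t A : (0 < s < t)%R ->
  hausdorff_measure s A < +oo -> hausdorff_measure t A = 0.
Proof.
move=> /andP[s0 st] As; have H0 := hausdorff_ge0 s A.
apply/eqP; rewrite eq_le hausdorff_ge0 andbT; apply/lee_addgt0Pr => n n0; rewrite add0e.
have AsE : hausdorff_measure s A = (fine (hausdorff_measure s A))%:E.
  by rewrite fineK// ge0_fin_numE.
pose K := (fine (hausdorff_measure s A) + 1)%R.
have K0 : (0 < K)%R by rewrite ltr_wpDl// fine_ge0.
have [e e0 eE] : exists2 e, (0 < e)%R & (e `^ (t - s) = n / K)%R.
  by apply: exists_powR_le; rewrite ?subr_gt0// divr_gt0.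
apply: hausdorff_le => e' e'0; pose m := Num.min e e'.
have m0 : (0 < m)%R by rewrite lt_min e0.
apply: (@le_trans _ _ (hausdorff_premeasure t m A)).
  by apply: premeasure_anti; rewrite ge_min lexx orbT.
apply: (le_trans (@premeasure_exponent s t m A _ m0)); first by rewrite s0 ltW.
apply: (@le_trans _ _ ((n / K)%:E * K%:E)); last by rewrite -EFinM divfK// gt_eqF.
apply: lee_pmul; rewrite ?lee_fin ?powR_ge0 ?premeasure_ge0//.
  by rewrite -eE ge0_ler_powR ?nnegrE ?(ltW m0) ?(ltW e0) ?subr_ge0 ?(ltW st)// ge_min lexx.
rewrite (le_trans (premeasure_le_hausdorff _ _ m0))// AsE lee_fin /K.
by rewrite lerDl.
Qed.

Lemma hausdorff_infinite s t A : (0 < s < t)%R ->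
  0 < hausdorff_measure t A -> hausdorff_measure s A = +oo.
Proof.
move=> st At; apply/eqP; rewrite -leye_eq leNgt; apply/negP => As.
by move: At; rewrite (hausdorff_finite_zero st As) ltxx.
Qed.

Lemma premeasure_fin_cover (I : finType) (U : I -> set X) s e d A :
  (0 <= s)%R -> (0 <= d <= e)%R ->
  A `<=` \bigcup_i U i -> (forall i, diam (U i) <= d%:E) ->
  hausdorff_premeasure s e A <= (#|I|%:R * d `^ s)%:E.
Proof.
move=> s0 de AU Ud.
apply: (@premeasure_finite_cover _ _ s e d #|I| (fun i => U (enum_val i))) => //.
by move=> x /AU[i _ Ux]; exists (enum_rank i) => //; rewrite enum_rankK.
Qed.

End hausdorff_exponents.

Section graph_covers.
Context {R : realType} {D : nat}.
Implicit Types (A : set (torus R D * unit_interval R)%type).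

(** The cube lives in the covering space, which avoids the seam of the torus. It is half open so
    that the index of a subdivision cell, a truncation, stays below [N]. *)
Definition in_cube (u : 'rV[R]_D) (r : R) (x : torus R D) :=
  exists2 v : 'rV[R]_D, x = torus_of (u + v) & forall i, - r <= v 0 i < r.

Definition slope_le (M : R) A :=
  forall a b, A a -> A b -> `|a.2%:num - b.2%:num| <= M * mdist a.1 b.1.

Lemma in_cube_torus (x : torus R D) : in_cube 0 1 x.
Proof.
exists (torus_rep x); first by rewrite add0r torus_of_rep.
move=> i; have /forallP/(_ i)/andP[h0 ->] := torus_repP x.
by rewrite andbT (le_trans _ h0)// oppr_le0.
Qed.

Lemma in_cube_ball (u : 'rV[R]_D) r (x : torus R D) :
  mdist x (torus_of u) < r -> in_cube u r x.
Proof.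
rewrite -{1}(torus_of_rep x) [mdist _ _]torus_distE => h.
have [k kP] := boolp.choice (fun i => int_dist_ex ((torus_rep x - u) 0 i)).
exists (torus_rep x - u + \row_i (- k i)%:~R).
  by rewrite addrA [u + _]addrC subrK -{1}(torus_of_rep x) torus_of_int.
move=> i; have : `|(torus_rep x - u) 0 i - (k i)%:~R| < r.
  by rewrite -kP (le_lt_trans (int_dist_le_torus_norm _ i)).
rewrite ltr_norml => /andP[h1 h2]; rewrite !mxE mulrNz in h1 h2 *.
by rewrite h2 ltW.
Qed.

(* Cut the cube into [N ^ D] small cubes and the part of the graph over each of
   them into [2 M + 1] horizontal slices. *)
Lemma premeasure_graph_le A (u : 'rV[R]_D) (r s e : R) (M N : nat) :
  (0 < D)%N -> (0 < N)%N -> 0 < r -> 0 <= s -> 2 * D%:R * r / N%:R <= e ->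
  (forall a, A a -> in_cube u r a.1) -> slope_le M%:R A ->
  (hausdorff_premeasure s e A <=
    ((N ^ D * (2 * M).+1)%:R * (2 * D%:R * r / N%:R) `^ s)%:E)%E.
Proof.
move=> D0 N0 r0 s0 he Au AM; set h := 2 * D%:R * r / N%:R in he *.
have NR : 0 < N%:R :> R by rewrite ltr0n.
have DR : 0 < D%:R :> R by rewrite ltr0n.
have h0 : 0 < h by rewrite divr_gt0// !mulr_gt0.
pose w := 2 * r / N%:R; have w0 : 0 < w by rewrite divr_gt0// mulr_gt0.
have hw : h = w * D%:R by rewrite /h /w; ring.
pose box (k : {ffun 'I_D -> 'I_N}) : set (torus R D * unit_interval R)%type :=
  [set a | A a /\ exists2 v : 'rV[R]_D, a.1 = torus_of (u + v) &
    forall i, w * (k i)%:R <= v 0 i + r <= w * (k i).+1%:R].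
have boxh k a b : box k a -> box k b -> mdist a.1 b.1 <= h.
  move=> [_ [v av vk]] [_ [z bz zk]]; rewrite av bz [mdist _ _]torus_distE.
  rewrite opprD addrACA subrr add0r (le_trans (torus_norm_le_sum _))// hw.
  apply: (@le_trans _ _ (\sum_(i < D) w)); last by rewrite sumr_const card_ord mulr_natr.
  apply: ler_sum => i _; rewrite (le_trans (int_dist_norm _))// !mxE ler_norml.
  have /andP[h1 h2] := vk i; have /andP[h3 h4] := zk i.
  rewrite -natr1 mulrDr mulr1 in h2 h4.
  by apply/andP; split; lra.
have boxA a : A a -> exists k, box k a.
  move=> Aa; have [v av vr] := Au a Aa.
  have tv i : 0 <= (v 0 i + r) / w.
    by rewrite divr_ge0 ?(ltW w0)//; have /andP[? ?] := vr i; lra.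
  have tN i : (Num.truncn ((v 0 i + r) / w)%R < N)%N.
    have /andP[h1 _] := truncn_itv (tv i).
    rewrite -(ltr_nat R) (le_lt_trans h1)// ltr_pdivrMr//.
    have -> : N%:R * w = 2 * r by rewrite /w mulrC divfK// gt_eqF.
    by have /andP[? ?] := vr i; lra.
  exists [ffun i => Ordinal (tN i)]; split => //; exists v => // i; rewrite ffunE /=.
  have /andP[h1 h2] := truncn_itv (tv i).
  rewrite ler_pdivlMr// mulrC in h1; rewrite ltr_pdivrMr// mulrC in h2.
  by rewrite h1 ltW.
(* Heights over a small cube are measured from a reference point [b k]; the slope bound confines
   them to [[- M * h, M * h]], hence the [2 * M + 1] slices of height [h]. *)
have [b bP] : {b : {ffun 'I_D -> 'I_N} -> torus R D * unit_interval R &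
    forall k, box k !=set0 -> box k (b k)}.
  apply: (boolp.choice (P := fun k b => box k !=set0 -> box k b)) => k.
  by have [[a ak]|no] := pselect (box k !=set0); [exists a|exists point].
pose piece (kl : {ffun 'I_D -> 'I_N} * 'I_(2 * M).+1) :=
  [set a | box kl.1 a /\ h * kl.2%:R <= a.2%:num - (b kl.1).2%:num + M%:R * h
    <= h * kl.2.+1%:R].
have := @premeasure_fin_cover R _ _ piece s e h A s0.
rewrite card_prod card_ffun !card_ord; apply; first by rewrite ltW.
  move=> a Aa; have [k ka] := boxA a Aa.
  have kb : box k (b k) by apply: bP; exists a.
  have ab : `|a.2%:num - (b k).2%:num| <= M%:R * h.
    by rewrite (le_trans (AM a _ Aa kb.1))// ler_wpM2l// (boxh k).
  move: ab; rewrite ler_norml => /andP[ab1 ab2].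
  set y := a.2%:num - (b k).2%:num + M%:R * h.
  have y0 : 0 <= y / h by rewrite divr_ge0 ?(ltW h0)// /y; lra.
  have /andP[h1 h2] := truncn_itv y0.
  have yM : (Num.truncn (y / h)%R < (2 * M).+1)%N.
    rewrite ltnS -(ler_nat R) (le_trans h1)// ler_pdivrMr// natrM /y; lra.
  exists (k, Ordinal yM) => //; split => //=; rewrite -/y.
  rewrite ler_pdivlMr// mulrC in h1; rewrite ltr_pdivrMr// mulrC in h2.
  by rewrite h1 ltW.
move=> [k l]; apply: diam_le; first exact: ltW.
move=> a a' [ak /= /andP[a1 a2]] [ak' /= /andP[a3 a4]].
rewrite /mdist/= /prod_dist ge_max (boxh k)//= [mdist _ _]/mdist/= /unit_dist.
rewrite -natr1 mulrDr mulr1 in a2 a4.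
by rewrite ler_norml; apply/andP; split; lra.
Qed.

(** For exponent [D] the number [N ^ D] of small cubes cancels against their size, so the bound of
    [premeasure_graph_le] does not depend on [N], which may then tend to infinity. *)
Lemma hausdorff_graph_le A (u : 'rV[R]_D) (r : R) (M : nat) :
  (0 < D)%N -> 0 < r -> (forall a, A a -> in_cube u r a.1) -> slope_le M%:R A ->
  (hausdorff_measure D%:R A <= ((2 * M).+1%:R * (2 * D%:R * r) ^+ D)%:E)%E.
Proof.
move=> D0 r0 Au AM; apply: hausdorff_le => e e0.
have b0 : 0 < 2 * D%:R * r by rewrite !mulr_gt0// ltr0n.
have [N NP] : exists N : nat, (0 < N)%N && (2 * D%:R * r / N%:R <= e).
  exists (Num.truncn (2 * D%:R * r / e)).+1; rewrite /= ler_pdivrMr// [leRHS]mulrC -ler_pdivrMr//.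
  by have /andP[_ /ltW] := truncn_itv (ltW (divr_gt0 b0 e0)).
case/andP: NP => N0 NP.
rewrite (le_trans (premeasure_graph_le D0 N0 r0 (ler0n _ _) NP Au AM))// lee_fin.
have NR : N%:R != 0 :> R by rewrite pnatr_eq0 -lt0n.
rewrite powR_mulrn ?(ltW (divr_gt0 b0 _)) ?ltr0n// natrM natrX le_eqVlt.
by apply/orP; left; apply/eqP; rewrite expr_div_n; field; rewrite expf_neq0.
Qed.

End graph_covers.

(** * The measure on the graph *)

Section graph_measure.
Context {R : realType} {D : nat}.
Variables (kappa : {nonneg R}) (rho : 'rV[R]_D).

Local Notation phase := (torus R D * unit_interval R)%type.
Local Notation phi := (upper_graph kappa rho).
Local Notation P := (boundary_iter kappa rho).

Lemma upper_graph_lift x : phi x = upper_lift kappa rho (torus_rep x).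
Proof. by rewrite /upper_lift torus_of_rep. Qed.

Lemma upper_graph_ge0 x : 0 <= phi x.
Proof. by rewrite upper_graph_lift upper_lift_ge0. Qed.

Lemma upper_graph_le1 x : phi x <= 1.
Proof. by rewrite upper_graph_lift upper_lift_le1. Qed.

Lemma boundary_iter_torus_lipschitz n : exists2 K : R, 0 <= K &
  forall u v, `|P n u - P n v| <= K * torus_norm (u - v).
Proof.
elim: n => [|n [K K0 KP]].
  by exists 0 => // u v; rewrite /= subrr normr0 mul0r.
exists (4 * kappa%:num * K + 4); first by rewrite addr_ge0// !mulr_ge0.
move=> u v /=; set a := u - rho; set b := v - rho.
have ab : a - b = u - v by rewrite /a /b opprB addrA subrK.
rewrite (_ : _ - _ = (tanh (kappa%:num * P n a) - tanh (kappa%:num * P n b)) *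
  lift_forcing a + tanh (kappa%:num * P n b) * (lift_forcing a - lift_forcing b)); last by ring.
rewrite (le_trans (ler_normD _ _))// [leRHS]mulrDl lerD//.
  rewrite normrM (ger0_norm (lift_forcing_ge0 _)).
  rewrite (le_trans (ler_piMr _ (lift_forcing_le1 _)))//.
  rewrite (le_trans (tanh_lipschitz _ _)) ?mulr_ge0 ?boundary_iter_ge0//.
  rewrite -mulrBr normrM ger0_norm// -!mulrA !ler_wpM2l// -ab.
  exact: KP.
have t0 : 0 <= tanh (kappa%:num * P n b) by rewrite tanh_ge0// mulr_ge0// boundary_iter_ge0.
rewrite normrM (ger0_norm t0) (le_trans (ler_piMl _ (tanh_le1 _)))//.
by rewrite -ab lift_forcing_lipschitz.
Qed.

(** As an infimum of continuous boundary iterates the graph is upper semicontinuous; here the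
    Lipschitz constants of the iterates may grow with [n]. *)
Lemma open_upper_graph_lt a : open [set x | phi x < a].
Proof.
rewrite openE => x /=; rewrite upper_graph_lift => /upper_lift_lt[n na].
have [K K0 KP] := boundary_iter_torus_lipschitz n.
apply/nbhs_ballP; exists ((a - P n (torus_rep x)) / (K + 1)).
  by rewrite /= divr_gt0 ?subr_gt0// ltr_wpDl.
move=> y; rewrite ballEmdist/= -{1}(torus_of_rep x) -{1}(torus_of_rep y) [mdist _ _]torus_distE.
have K1 : 0 < K + 1 by rewrite ltr_wpDl.
rewrite ltr_pdivlMr// => h; rewrite /= upper_graph_lift.
apply: (le_lt_trans (upper_lift_le _ _ n _)).
have := KP (torus_rep x) (torus_rep y); rewrite ler_norml => /andP[h1 _].
by have := torus_norm_ge0 (torus_rep x - torus_rep y); nra.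
Qed.

Lemma measurable_upper_graph : measurable_fun setT (phi : borel (torus R D) -> R).
Proof.
apply: (measurability _ (RGenInftyO.measurableE R)) => _ [_ [a ->] <-].
rewrite setTI; apply: sub_sigma_algebra => /=.
rewrite (_ : phi @^-1` _ = [set x | phi x < a]); first exact: open_upper_graph_lt.
by apply/seteqP; split => x /=; rewrite in_itv.
Qed.

Definition graph_map (x : borel (torus R D)) : borel phase :=
  (x : torus R D, Itv01 (upper_graph_ge0 x) (upper_graph_le1 x)).

Lemma measurable_mdist (X : pmetricType R) (x : X) :
  measurable_fun setT (fun y : borel X => mdist (y : X) x).
Proof.
apply: (measurability _ (RGenInftyO.measurableE R)) => _ [_ [a ->] <-].
rewrite setTI (_ : _ @^-1` _ = ball x a); first exact: measurable_mball.
by apply/seteqP; split => y /=; rewrite in_itv/= ballEmdist/= metric_sym.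
Qed.

Lemma measurable_graph_map : measurable_fun setT graph_map.
Proof.
apply: measurable_borel => [|p].
  exact: separable_prod (separable_torus D) separable_unit_interval.
rewrite (_ : (fun _ => _) = fun x : borel (torus R D) =>
  Num.max (mdist (x : torus R D) p.1) `|phi x - p.2%:num|)//.
apply: measurable_maxr; first exact: measurable_mdist.
apply: measurableT_comp; first exact: normr_measurable.
by apply: measurable_funB => //; exact: measurable_upper_graph.
Qed.

HB.instance Definition _ := isMeasurableFun.Build _ _ _ _ graph_map measurable_graph_map.

Definition graph_prob : probability (borel phase) R :=
  distribution (torus_prob D) graph_map.

(** Projecting the part of [A] on the graph is the same as pulling [A] back by the graph map, for
    every set [A]. *)
Lemma upper_graph_measureE : upper_graph_measure kappa rho = graph_prob.
Proof.
apply/funext => A; rewrite /upper_graph_measure /lebesgue_torus.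
congr (lebesgue_cube D _); apply/seteqP; split => t /=.
  move=> [[x y] [Axy /= yE] /= xE]; rewrite /graph_map/=.
  rewrite xE in Axy yE.
  suff yy : y = Itv01 (upper_graph_ge0 (torus_of_tuple t)) (upper_graph_le1 (torus_of_tuple t)).
    by rewrite -yy; exact: Axy.
  exact: val_inj.
move=> At; eexists; first by split; [exact: At|].
by [].
Qed.

Lemma measurable_fst_borel :
  measurable_fun setT (fun p : borel phase => p.1 : borel (torus R D)).
Proof.
apply: measurability; first by [].
move=> _ [U oU <-]; rewrite setTI; apply: sub_sigma_algebra => /=.
by apply: open_comp => // p _; exact: cvg_fst.
Qed.

Lemma measurable_snd_num : measurable_fun setT (fun p : borel phase => p.2%:num).
Proof.
apply: (measurability _ (RGenInftyO.measurableE R)) => _ [_ [a ->] <-].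
rewrite setTI; apply: sub_sigma_algebra => /=.
rewrite openE => -[x y] /=; rewrite in_itv/= => ya; apply/nbhs_ballP.
exists (a - y%:num) => /=; first by rewrite subr_gt0.
move=> [x' y'] [_ /=]; rewrite ballEmdist/= [mdist _ _]/mdist/= /unit_dist.
by rewrite in_itv/= ltr_norml => /andP[h1 h2]; lra.
Qed.

Lemma measurable_upper_graph_set : measurable (upper_graph_set kappa rho : set (borel phase)).
Proof.
have m : measurable_fun setT (fun p : borel phase => p.2%:num == phi p.1).
  apply: measurable_fun_eqr; first exact: measurable_snd_num.
  exact: (measurableT_comp measurable_upper_graph measurable_fst_borel).
have := m measurableT [set true] I; rewrite setTI; congr measurable.
by apply/seteqP; split => p /=; rewrite /upper_graph_set/=; [move=> /eqP|move=> ->; rewrite eqxx].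
Qed.

Definition graph_over (E : set (torus R D)) : set phase :=
  [set p | upper_graph_set kappa rho p /\ E p.1].

Lemma measurable_graph_over (E : set (borel (torus R D))) : measurable E ->
  measurable (graph_over E : set (borel phase)).
Proof.
move=> mE; rewrite (_ : graph_over E = upper_graph_set kappa rho `&` (fst @^-1` E))//.
apply: measurableI; first exact: measurable_upper_graph_set.
by have := measurable_fst_borel measurableT mE; rewrite setTI.
Qed.

Lemma graph_map_in x : upper_graph_set kappa rho (graph_map x). Proof. by []. Qed.

Lemma graph_prob_ball_le p (e : R) : 0 <= e ->
  (graph_prob (ball (p : phase) e) <= ((6 * e) ^+ D)%:E)%E.
Proof.
move=> e0; apply: le_trans (torus_prob_ball_le p.1 e0).
have -> : graph_prob (ball (p : phase) e) =
  torus_prob D (graph_map @^-1` (ball (p : phase) e)) by [].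
apply: le_measure; rewrite ?inE.
- by have := measurable_graph_map measurableT (measurable_mball p e); rewrite setTI.
- exact: measurable_cball.
move=> x [/= xp _]; rewrite ballEmdist/= in xp; exact: ltW.
Qed.

(* A set of diameter [d] projects into a closed ball of radius [d]. *)
Lemma torus_prob_le_premeasure (E : set (borel (torus R D))) (A : set phase) (e : R) :
  (0 < D)%N -> measurable E -> E `<=` fst @` A ->
  (torus_prob D E <= ((6 ^+ D)%:E * hausdorff_premeasure D%:R e A))%E.
Proof.
move=> D0 mE EA; have c0 : 0 < (6 ^+ D : R) by rewrite exprn_gt0.
rewrite -lee_pdivrMl//; apply: le_ereal_inf_tmp => _ [J [U [AU Ud ->]]].
rewrite lee_pdivrMl//.
have DN : D%:R != 0 :> R by rewrite pnatr_eq0 -lt0n.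
pose x i : phase := xget point (U i).
pose F i : set (borel (torus R D)) := if (i \in J) && (U i != set0)
  then [set y | mdist (x i).1 y <= fine (diam (U i))] else set0.
have mF i : measurable (F i) by rewrite /F; case: ifP => // _; exact: measurable_cball.
have EF : E `<=` \bigcup_i F i.
  move=> y /EA[p Ap <-]; have [i Ji Up] := AU p Ap; exists i => //.
  have Ux : U i (x i) by exact: xgetPex (ex_intro _ p Up).
  rewrite /F mem_set//=; case: ifPn => [_ /=|/negPn/eqP U0]; last by rewrite U0 in Up.
  apply: (@le_trans _ _ (mdist (x i) p)).
    by rewrite [leRHS]/mdist/= /prod_dist le_max lexx.
  have := mdist_le_diam Ux Up; have := Ud i Ji; have := diam_ge0 (U i).
  by case: (diam (U i)) => //= d; rewrite lee_fin.
rewrite (le_trans (measure_sigma_subadditive (torus_prob D) mF mE EF))//.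
rewrite esum_mkcond -nneseries_esumT; last first.
  by move=> i; case: ifP => // _; exact: poweR_ge0.
rewrite -nneseriesZl; last by move=> i _; case: ifP => // _; exact: poweR_ge0.
apply: lee_nneseries => i _; first by move=> _; exact: measure_ge0.
rewrite /F; case: ifPn => [/andP[Ji _]|_].
  rewrite Ji; have := Ud i (set_mem Ji); have := diam_ge0 (U i).
  case: (diam (U i)) => //= d; rewrite !lee_fin => d0 _.
  by rewrite powR_mulrn// -EFinM -exprMn torus_prob_ball_le.
by rewrite measure0; case: ifP => _; rewrite ?mule0// mule_ge0 ?poweR_ge0// lee_fin ltW.
Qed.

Lemma torus_prob_le_hausdorff (E : set (borel (torus R D))) (A : set phase) :
  (0 < D)%N -> measurable E -> E `<=` fst @` A ->
  (torus_prob D E <= ((6 ^+ D)%:E * hausdorff_measure D%:R A))%E.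
Proof.
move=> D0 mE EA; apply: (le_trans (torus_prob_le_premeasure 1 D0 mE EA)).
by rewrite lee_wpmul2l ?lee_fin ?exprn_ge0// premeasure_le_hausdorff.
Qed.

Lemma hausdorff_upper_graph_gt0 : (0 < D)%N ->
  (0 < hausdorff_measure D%:R (upper_graph_set kappa rho))%E.
Proof.
move=> D0; rewrite lt_neqAle hausdorff_ge0 andbT eq_sym; apply/eqP => H0.
have := @torus_prob_le_hausdorff setT (upper_graph_set kappa rho) D0 measurableT.
rewrite H0 mule0 probability_setT => h.
have : (1 <= 0 :> \bar R)%E by apply: h => x _; exists (graph_map x).
by rewrite lee_fin ler10.
Qed.

(** Absolute continuity with respect to the Hausdorff measure, the input of the Radon-Nikodym
    theorem. It rests on the projection to the torus not increasing distances. *)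
Lemma graph_prob_null (B : set (borel phase)) : (0 < D)%N -> measurable B ->
  hausdorff_measure D%:R (B : set phase) = 0%E -> graph_prob B = 0%E.
Proof.
move=> D0 mB B0; apply/eqP; rewrite eq_le measure_ge0 andbT.
have -> : graph_prob B = torus_prob D (graph_map @^-1` B) by [].
rewrite (le_trans (@torus_prob_le_hausdorff _ (B : set phase) D0 _ _))//.
- by have := measurable_graph_map measurableT mB; rewrite setTI.
- by move=> x Bx; exists (graph_map x).
- by rewrite B0 mule0.
Qed.

End graph_measure.

(** * Hausdorff dimension of the graph *)

Lemma mdist_torusE {R : realType} {D : nat} (x y : torus R D) :
  mdist x y = torus_norm (torus_rep x - torus_rep y).
Proof. by rewrite -{1}(torus_of_rep x) -{1}(torus_of_rep y) [mdist _ _]torus_distE. Qed.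

Section geometric_series.
Context {R : realType}.

Lemma nneseries_geometric_le (f : nat -> \bar R) (c q : R) : 0 <= c -> 0 <= q < 1 ->
  (forall k, 0%E <= f k)%E -> (forall k, f k <= (c * q ^+ k)%:E)%E ->
  (\sum_(0 <= k <oo) f k <= (c / (1 - q))%:E)%E.
Proof.
move=> c0 /andP[q0 q1] f0 fc.
have gs n : (\sum_(0 <= k < n) q ^+ k) * (1 - q) = 1 - q ^+ n.
  elim: n => [|n IH]; first by rewrite big_geq// mul0r expr0 subrr.
  by rewrite big_nat_recr//= mulrDl IH exprS; ring.
apply: lime_le; first exact: is_cvg_nneseries.
near=> n; apply: (@le_trans _ _ (\sum_(0 <= k < n) (c * q ^+ k)%:E)%E).
  by apply: lee_sum => k _; exact: fc.
rewrite sumEFin lee_fin -mulr_sumr ler_wpM2l// -[leRHS]mul1r ler_pdivlMr ?subr_gt0//.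
by rewrite gs lerBlDr lerDl exprn_ge0.
Unshelve. all: by end_near. Qed.

Lemma exists_expr_le (q x : R) : 0 <= q < 1 -> 0 < x ->
  exists m, forall k, (m <= k)%N -> q ^+ k <= x.
Proof.
move=> /andP[q0 q1] x0; have := @cvg_expr R q; rewrite ger0_norm// => /(_ q1).
move=> /cvgrPdist_le/(_ x x0)[m _ mP]; exists m => k mk.
by have := mP k mk; rewrite /= sub0r normrN ger0_norm// exprn_ge0.
Qed.

End geometric_series.

Section slabs.
Context {R : realType} {D : nat}.

(** The slab is cut into slices of height [2 * r]. Their number is at most [1 / (2 * r) + 1], which
    is at most [1 / r] as [r <= 1 / 2]. *)
Lemma premeasure_slab_le (y : torus R D) (r s e : R) :
  0 <= s -> 0 < r <= 2^-1 -> 2 * r <= e ->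
  (hausdorff_premeasure s e [set a : torus R D * unit_interval R | (mdist a.1 y <= r)%R]
    <= (r^-1 * (2 * r) `^ s)%:E)%E.
Proof.
move=> s0 /andP[r0 r1] re; have h0 : 0 < 2 * r by rewrite mulr_gt0.
pose N := (Num.truncn (2 * r)^-1).+1.
have i0 : 0 <= (2 * r)^-1 by rewrite invr_ge0 ltW.
pose U (k : 'I_N) := [set a : torus R D * unit_interval R | mdist a.1 y <= r /\
  2 * r * k%:R <= a.2%:num <= 2 * r * k.+1%:R].
apply: le_trans (@premeasure_finite_cover _ _ s e (2 * r) N U _ s0 _ _ _) _.
- by rewrite (ltW h0).
- move=> a /= ay; have a0 : 0 <= a.2%:num / (2 * r).
    by rewrite divr_ge0 ?(ltW h0)// unit_interval_ge0.
  have /andP[t1 t2] := truncn_itv a0.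
  have tN : (Num.truncn (a.2%:num / (2 * r))%R < N)%N.
    rewrite ltnS truncn_le_nat (le_lt_trans _ (truncnS_gt _))//.
    by rewrite ler_piMl// unit_interval_le1.
  exists (Ordinal tN) => //; split => //=.
  rewrite ler_pdivlMr// mulrC in t1; rewrite ltr_pdivrMr// mulrC in t2.
  by rewrite t1 ltW.
- move=> k; apply: diam_le; first exact: ltW.
  move=> a b [ay /andP[a1 a2]] [yb /andP[b1 b2]].
  rewrite /mdist/= /prod_dist ge_max; apply/andP; split.
    by have := metric_triangle a.1 y b.1; rewrite (metric_sym y); lra.
  rewrite [mdist _ _]/mdist/= /unit_dist; rewrite -[k.+1%:R]natr1 mulrDr mulr1 in a2 b2.
  by rewrite ler_norml; apply/andP; split; lra.
rewrite lee_fin ler_wpM2r ?powR_ge0// /N -natr1.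
have /andP[t1 _] := truncn_itv i0.
have : 1 <= (2 * r)^-1 by rewrite -invr1 lef_pV2 ?posrE//; lra.
have : r^-1 = (2 * r)^-1 + (2 * r)^-1 by field; rewrite gt_eqF.
by move: (2 * r)^-1 t1 => z; lra.
Qed.

End slabs.

Section good_pieces.
Context {R : realType} {D : nat} {kappa : {nonneg R}} {rho : 'rV[R]_D} {p : R}.
Hypothesis H : regime kappa rho p.

Local Notation phase := (torus R D * unit_interval R)%type.
Local Notation Phi := (upper_graph_set kappa rho).
Local Notation B := (4 * kappa%:num).
Local Notation tau j := (torus_of (rho *+ j)).

Let p0 := regime_gt0 H.
Let D0 := regime_dim H.

(* Outside the balls of radius [2 D p ^ (2 j)] around [j rho], [j > m], the graph
   is Lipschitz; the larger radii [2 D p ^ j] leave room around each point. *)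
Definition good_set m : set (torus R D) :=
  [set x | forall j, (m < j)%N -> 2 * D%:R * p ^+ (2 * j) <= mdist x (tau j)].

Definition strong_set m : set (torus R D) :=
  [set x | forall j, (m < j)%N -> 2 * D%:R * p ^+ j <= mdist x (tau j)].

Lemma strong_good m : strong_set m `<=` good_set m.
Proof.
move=> x xm j mj; apply: le_trans (xm j mj); rewrite ler_wpM2l//.
by rewrite ler_wiXn2l ?(ltW p0) ?(regime_p_le1 H)//; lia.
Qed.

Lemma good_setP m x : good_set m x <-> good_lift (rho := rho) (p := p) m (torus_rep x).
Proof.
have e j : mdist x (tau j) = torus_norm (torus_rep x - rho *+ j).
  by rewrite -{1}(torus_of_rep x) [mdist _ _]torus_distE.
by split => h j mj; have := h j mj; rewrite e.
Qed.

Let measurable_far (f : nat -> R) m :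
  measurable ([set x | forall j, (m < j)%N -> f j <= mdist x (tau j)] : set (borel (torus R D))).
Proof.
rewrite (_ : [set _ | _] = \bigcap_(j in [set j | (m < j)%N]) ~` ball (tau j) (f j)); last first.
  apply/seteqP; split => x /= h j mj.
    by rewrite ballEmdist/= metric_sym; apply/negP; rewrite -leNgt h.
  by have := h j mj; rewrite ballEmdist/= metric_sym => /negP; rewrite -leNgt.
apply: bigcap_measurable; first by exists m.+1 => /=.
by move=> j _; apply: measurableC; exact: measurable_mball.
Qed.

Lemma measurable_good_set m : measurable (good_set m : set (borel (torus R D))).
Proof. exact: measurable_far. Qed.

Lemma measurable_strong_set m : measurable (strong_set m : set (borel (torus R D))).
Proof. exact: measurable_far. Qed.

Lemma regime_pD : D%:R * p <= 384^-1.
Proof. by have := regime_small H; lra. Qed.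

Lemma strong_radius_le j : (6 * (2 * D%:R * p ^+ j.+1)) ^+ D <= 2^-1 ^+ j.+1.
Proof.
have DR := regime_dimR H; have p1 : p <= 2^-1 by have := regime_p_le H; lra.
have h : 6 * (2 * D%:R * p ^+ j.+1) <= 2^-1 ^+ j.+1.
  have h1 : p ^+ j <= 2^-1 ^+ j by rewrite lerXn2r ?nnegrE ?(ltW p0).
  have : 0 <= p ^+ j by rewrite exprn_ge0// ltW.
  rewrite !exprS; have := regime_pD; move: h1; move: (2^-1 ^+ j) (p ^+ j) => a b ab Dp b0.
  by rewrite (_ : 6 * _ = 12 * (D%:R * p) * b); [nra|ring].
have h0 : 0 <= 6 * (2 * D%:R * p ^+ j.+1) by rewrite !mulr_ge0// exprn_ge0// ltW.
apply: (le_trans _ h); rewrite -[leRHS]expr1 ler_wiXn2l//.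
by apply: (le_trans h); rewrite exprn_ile1//; lra.
Qed.

Lemma strong_set_compl m : (torus_prob D (~` (strong_set m : set (borel (torus R D))))
  <= (2^-1 ^+ m)%:E)%E.
Proof.
pose F k : set (borel (torus R D)) :=
  [set x | mdist (tau (m + k).+1) x <= 2 * D%:R * p ^+ (m + k).+1].
have mF k : measurable (F k) by exact: measurable_cball.
have sub : ~` strong_set m `<=` \bigcup_k F k.
  move=> x /= /existsNP[j /not_implyP[mj]] /negP; rewrite -ltNge => xj.
  by exists (j - m.+1)%N => //; rewrite /F/= -addSn subnKC// metric_sym ltW.
have mS : measurable (~` (strong_set m : set (borel (torus R D)))).
  by apply: measurableC; exact: measurable_strong_set.
rewrite (le_trans (measure_sigma_subadditive (torus_prob D) mF mS sub))//.
have := @nneseries_geometric_le R (fun k => torus_prob D (F k)) (2^-1 ^+ m.+1) 2^-1.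
rewrite (_ : 2^-1 ^+ m.+1 / (1 - 2^-1) = 2^-1 ^+ m); last by rewrite exprS; field.
apply => //; first by apply/andP; split; lra.
move=> k; rewrite -exprD addSn; apply: le_trans (torus_prob_ball_le _ _) _.
  by rewrite !mulr_ge0// exprn_ge0// ltW.
by rewrite lee_fin strong_radius_le.
Qed.

Definition slope_bound m : nat := (Num.truncn (@lip_const R kappa m)).+1.

Lemma lip_const_ge1 m : 1 <= lip_const (kappa := kappa) m.
Proof.
have B2 := regime_factor_ge2 H; rewrite /lip_const.
have : 1 <= B ^+ (3 * m + 1) by rewrite exprn_ege1//; lra.
lra.
Qed.

Lemma lip_const_le m : lip_const (kappa := kappa) m <= (slope_bound m)%:R.
Proof. exact/ltW/truncnS_gt. Qed.

Lemma slope_bound_le m : (slope_bound m)%:R <= 2 * lip_const (kappa := kappa) m.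
Proof.
rewrite /slope_bound -natr1; have l1 := lip_const_ge1 m.
have l0 : 0 <= lip_const (kappa := kappa) m by lra.
by have /andP[h _] := truncn_itv l0; lra.
Qed.

Lemma upper_graph_lipschitz m x y : good_set m x -> good_set m y ->
  `|upper_graph kappa rho x - upper_graph kappa rho y| <=
    lip_const (kappa := kappa) m * mdist x y.
Proof.
move=> /good_setP xm /good_setP ym; have := upper_lift_lipschitz H xm ym.
rewrite -!upper_graph_lift => /le_trans; apply.
by rewrite mdist_torusE.
Qed.

Lemma slope_good_piece m (A : set phase) : A `<=` graph_over kappa rho (good_set m) ->
  slope_le (slope_bound m)%:R A.
Proof.
move=> Am a b /Am[Pa am] /Am[Pb bm]; rewrite /upper_graph_set/= in Pa Pb; rewrite Pa Pb.
rewrite (le_trans (upper_graph_lipschitz am bm))// ler_wpM2r ?mdist_ge0//.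
exact: lip_const_le.
Qed.

Lemma hausdorff_good_piece m :
  (hausdorff_measure D%:R (graph_over kappa rho (good_set m)) < +oo)%E.
Proof.
apply: le_lt_trans (@hausdorff_graph_le _ _ _ 0 1 (slope_bound m) D0 ltr01 _ _) (ltry _).
  by move=> a _; exact: in_cube_torus.
exact: slope_good_piece.
Qed.

Definition bad_set : set (torus R D) := ~` \bigcup_m good_set m.

(* Over a ball of radius [r] the graph is covered by about [1 / r] sets of diameter
   of order [r], and [r ^ (s - 1)] is summable over the exponentially small balls. *)
Lemma hausdorff_bad_piece s : 1 < s ->
  hausdorff_measure s (graph_over kappa rho bad_set) = 0%E.
Proof.
move=> s1; have s0 : 0 < s by lra.
have DR := regime_dimR H.
apply/eqP; rewrite eq_le hausdorff_ge0 andbT; apply: hausdorff_le => e e0.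
apply/lee_addgt0Pr => n n0; rewrite add0e.
pose r j := 2 * D%:R * p ^+ (2 * j).
have r0 j : 0 < r j by rewrite !mulr_gt0 ?exprn_gt0//; lra.
(* One of the two factors [p ^ j.+1] absorbs the constant [2 * D]. *)
have rS j : r j.+1 <= p ^+ j.+1 / 2.
  rewrite /r (_ : (2 * j.+1 = j.+1 + j.+1)%N); last by lia.
  rewrite exprD mulrA mulrC; apply: ler_wpM2l; first by rewrite exprn_ge0// ltW.
  have : p ^+ j.+1 <= p by rewrite -[leRHS]expr1 ler_wiXn2l ?(ltW p0) ?(regime_p_le1 H).
  by have := regime_pD; nra.
pose q := (p ^+ 2) `^ (s - 1).
have pp0 : 0 < p ^+ 2 by rewrite exprn_gt0.
have pp1 : p ^+ 2 < 1 by rewrite expr2; have := regime_p_le H; have := p0; nra.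
have q0 : 0 <= q by exact: powR_ge0.
have q1 : q < 1.
  rewrite /q -(powRr1 (ltW pp0)) -powRrM mul1r -[ltRHS](powRr0 (p ^+ 2)).
  by rewrite -ltr_ln ?posrE ?powR_gt0// !ln_powR; have := ln_lt0 (x := p ^+ 2); nra.
pose c := 2 `^ s * (2 * D%:R) `^ (s - 1).
have c0 : 0 <= c by rewrite mulr_ge0 ?powR_ge0.
have rq j : (r j)^-1 * (2 * r j) `^ s = c * q ^+ j.
  have rj0 := ltW (r0 j).
  have -> : (2 * r j) `^ s = 2 `^ s * (r j * (r j) `^ (s - 1)).
    rewrite powRM//; congr (_ * _); rewrite -{2}(powRr1 rj0) -powRD.
      by congr (_ `^ _); ring.
    by rewrite (gt_eqF (r0 j)) implybT.
  rewrite mulrCA mulKf ?gt_eqF// /c -mulrA; congr (_ * _).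
  rewrite /r powRM ?exprn_ge0 ?(ltW p0)//.
  rewrite exprM; congr (_ * _).
  by rewrite -(powR_mulrn j (ltW pp0)) -powRrM mulrC powRrM powR_mulrn// powR_ge0.
have q01 : 0 <= q < 1 by rewrite q0 q1.
have n1 : 0 < n * (1 - q) / (c + 1) by rewrite divr_gt0 ?mulr_gt0 ?subr_gt0// ltr_wpDl.
have p01 : 0 <= p < 1 by rewrite (ltW p0)/=; have := regime_p_le H; lra.
(* Beyond [m1] the tail of the series is at most [n]; beyond [m2] the covering sets are small enough
   for the scale [e]. *)
have [m1 m1P] := exists_expr_le q01 n1.
have [m2 m2P] := exists_expr_le p01 e0.
have [m mm1 mm2] : exists2 m, (m1 <= m)%N & (m2 <= m)%N.
  by exists (maxn m1 m2); rewrite ?leq_maxl ?leq_maxr.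
pose S k : set phase := [set a | mdist a.1 (tau (m + k).+1) <= r (m + k).+1].
have sub : graph_over kappa rho bad_set `<=` \bigcup_k S k.
  move=> a [_ ab]; apply: contrapT => aS; apply: ab; exists m => // j mj.
  rewrite leNgt; apply/negP => aj; apply: aS; exists (j - m.+1)%N => //.
  by rewrite /S/= -addSn subnKC// ltW.
rewrite (le_trans (le_premeasure s e sub))//.
have sN0 : s != 0 by rewrite gt_eqF.
rewrite (le_trans (premeasure_sigma_subadditive sN0 (ltW e0) S))//.
have := @nneseries_geometric_le R (fun k => hausdorff_premeasure s e (S k)) (c * q ^+ m.+1) q.
rewrite q0 q1 => h; apply: (le_trans (h _ isT _ _)).
- by rewrite mulr_ge0// exprn_ge0.
- by move=> k; exact: premeasure_ge0.
- move=> k; rewrite -mulrA -exprD addSn -rq; apply: premeasure_slab_le; first exact: ltW.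
    rewrite r0/= (le_trans (rS _))// ler_piMl// exprn_ile1// ?(ltW p0)//.
    exact: regime_p_le1 H.
  apply: (@le_trans _ _ (p ^+ (m + k).+1)); first by have := rS (m + k)%N; lra.
  by apply: m2P; rewrite leqW// (leq_trans mm2)// leq_addr.
- rewrite lee_fin ler_pdivrMr ?subr_gt0//.
  have /m1P : (m1 <= m.+1)%N by rewrite leqW.
  rewrite ler_pdivlMr ?ltr_wpDl// => hq.
  have : 0 <= q ^+ m.+1 by rewrite exprn_ge0.
  by rewrite mulrDr mulr1 mulrC in hq; lra.
Qed.

Lemma graph_split : Phi `<=`
  \bigcup_m graph_over kappa rho (good_set m) `|` graph_over kappa rho bad_set.
Proof.
move=> a Pa; have [[m _ am]|nb] := pselect ((\bigcup_m good_set m) a.1).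
  by left; exists m.
by right.
Qed.

Lemma hausdorff_above (s : R) : D%:R < s -> hausdorff_measure s Phi = 0%E.
Proof.
move=> Ds; have DR := regime_dimR H; have s0 : 0 < s by lra.
have sN0 : s != 0 by rewrite gt_eqF.
apply/eqP; rewrite eq_le hausdorff_ge0 andbT.
rewrite (le_trans (le_hausdorff s graph_split))//.
rewrite (le_trans (outer_measureU2 (hausdorff_outer sN0) _ _))//=.
rewrite hausdorff_bad_piece ?adde0; last by lra.
rewrite (le_trans (hausdorff_sigma_subadditive sN0 _))//.
rewrite eseries0// => m _ _; apply: (@hausdorff_finite_zero _ _ D%:R).
  by rewrite Ds andbT; lra.
exact: hausdorff_good_piece.
Qed.

Lemma hausdorff_dim_upper_graph : hausdorff_dim Phi = D%:R%:E.
Proof.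
have DR := regime_dimR H.
apply/eqP; rewrite eq_le; apply/andP; split.
  rewrite /hausdorff_dim ge_max lee_fin ler0n/=; apply: ge_ereal_sup.
  move=> _ [s [s0 sy] <-]; rewrite lee_fin leNgt; apply/negP => Ds.
  by move: sy; rewrite hausdorff_above.
rewrite /hausdorff_dim le_max; apply/orP; right.
apply/lee_addgt0Pr => e e0; pose s := Num.max (D%:R - e) (2^-1).
have sD : s < D%:R by rewrite gt_max; apply/andP; split; lra.
have s0 : 0 < s by rewrite lt_max; apply/orP; right; lra.
apply: (@le_trans _ _ (s%:E + e%:E)%E).
  by rewrite -EFinD lee_fin -lerBlDr le_max lexx.
rewrite leeD2r//; apply: ereal_sup_ubound; exists s => //; split; first exact: ltW.
apply: (@hausdorff_infinite _ _ s D%:R); first by rewrite s0.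
exact: hausdorff_upper_graph_gt0.
Qed.

(** A point whose index is exactly [m + 1] can only have failed the condition for [m] at
    [j = m + 1]. So the piece of larger slope sits over a small cube. *)
Lemma good_difference m (a : phase) :
  graph_over kappa rho (good_set m.+1 `\` good_set m) a ->
  in_cube (rho *+ m.+1) (2 * D%:R * p ^+ (2 * m.+1)) a.1.
Proof.
move=> [_ [am nam]]; apply: in_cube_ball; rewrite ltNge; apply/negP => far.
apply: nam => j; rewrite leq_eqVlt => /predU1P[<-//|mj]; exact: am.
Qed.

(** The piece of index [m + 1] costs about [B ^ (3 m)] for its slope and [p ^ (2 m D)] for its cube.
    As [kappa = p ^ (- 64)], the slope is of order [p ^ (- 192 m)] up to the factor 4 in [B];
    [D >= 100] leaves [p ^ (8 m)], which absorbs that factor and makes the sum converge. *)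
Lemma hausdorff_upper_graph_finite : (100 <= D)%N -> (hausdorff_measure D%:R Phi < +oo)%E.
Proof.
move=> D100; have DR := regime_dimR H; have DN0 : D%:R != 0 :> R by lra.
have B2 := regime_factor_ge2 H.
have D1 : 1 < D%:R :> R by rewrite ltr1n; lia.
pose A m := graph_over kappa rho (good_set m.+1 `\` good_set m).
have sub : Phi `<=` (graph_over kappa rho (good_set 0) `|` \bigcup_m A m) `|`
    graph_over kappa rho bad_set.
  move=> a Pa; have [[m0 _ am0]|nb] := pselect ((\bigcup_m good_set m) a.1); last by right.
  left; have ex : exists m, `[< good_set m a.1 >] by exists m0; exact/asboolP.
  case: (ex_minnP ex) => -[|m] /asboolP am mmin; first by left.
  right; exists m => //; split => //; split => // am'.
  by have := mmin m (asboolT am'); rewrite ltnn.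
pose c := 40 * B ^+ 4.
have c0 : 0 <= c by rewrite mulr_ge0// exprn_ge0//; lra.
have Am m : (hausdorff_measure D%:R (A m) <= (c * 2^-1 ^+ m)%:E)%E.
  have r0 : 0 < 2 * D%:R * p ^+ (2 * m.+1) by rewrite !mulr_gt0 ?exprn_gt0//; lra.
  have := @hausdorff_graph_le _ _ (A m) (rho *+ m.+1) _ (slope_bound m.+1) D0 r0.
  move=> h; apply: (le_trans (h _ _)).
  - exact: good_difference.
  - by apply: slope_good_piece => a [Pa [am _]].
  rewrite lee_fin; apply: (@le_trans _ _ (c * B ^+ (3 * m) * p ^+ (200 * m))).
    apply: ler_pM => //; first by rewrite exprn_ge0// mulr_ge0 ?(ltW r0)// mulr_ge0.
      have := slope_bound_le m.+1; have := lip_const_ge1 m.+1.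
      rewrite -[(2 * slope_bound m.+1).+1%:R]natr1 natrM => l1 l2.
      have {l1 l2} : 2 * (slope_bound m.+1)%:R + 1 <= 5 * lip_const (kappa := kappa) m.+1.
        by lra.
      move=> /le_trans; apply; rewrite /lip_const /c le_eqVlt; apply/orP; left; apply/eqP.
      by rewrite (_ : (3 * m.+1 + 1 = 4 + 3 * m)%N) ?exprD; [ring|lia].
    have h1 : 2 * D%:R * (2 * D%:R * p ^+ (2 * m.+1)) <= p ^+ (2 * m).
      rewrite (_ : (2 * m.+1 = 2 + 2 * m)%N); last by lia.
      rewrite exprD (_ : 2 * _ * _ = 4 * (D%:R * p) ^+ 2 * p ^+ (2 * m)); last by ring.
      rewrite ler_piMl ?exprn_ge0 ?(ltW p0)//; have := regime_pD.
      have : 0 <= D%:R * p by rewrite mulr_ge0// ltW.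
      by rewrite expr2; move: (D%:R * p) => x; nra.
    apply: (@le_trans _ _ ((p ^+ (2 * m)) ^+ D)).
      rewrite lerXn2r ?nnegrE ?exprn_ge0 ?(ltW p0)//.
      by rewrite mulr_ge0 ?(ltW r0)// mulr_ge0.
    by rewrite -exprM ler_wiXn2l ?(ltW p0) ?(regime_p_le1 H)//; nia.
  rewrite -mulrA ler_wpM2l// !exprM -exprMn lerXn2r ?nnegrE//.
    by rewrite mulr_ge0 ?exprn_ge0 ?(ltW p0)//; lra.
  have -> : B ^+ 3 * p ^+ 200 = 64 * (kappa%:num * p ^+ 64) ^+ 3 * p ^+ 8.
    by rewrite -[200%N]/(64 * 3 + 8)%N exprD exprM; move: (p ^+ 64) (p ^+ 8) => x y; ring.
  rewrite (regime_kappa H) expr1n mulr1.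
  have : p ^+ 8 <= p ^+ 2 by rewrite ler_wiXn2l ?(ltW p0) ?(regime_p_le1 H).
  by rewrite expr2; have := regime_p_le H; have := p0; nra.
have fin0 : (hausdorff_measure D%:R (graph_over kappa rho (good_set 0)) < +oo)%E.
  exact: hausdorff_good_piece.
apply: (le_lt_trans (le_hausdorff _ sub)).
apply: (le_lt_trans (outer_measureU2 (hausdorff_outer DN0) _ _)) => /=.
rewrite hausdorff_bad_piece// adde0.
apply: (le_lt_trans (outer_measureU2 (hausdorff_outer DN0) _ _)) => /=.
apply: lte_add_pinfty => //.
apply: (le_lt_trans (hausdorff_sigma_subadditive DN0 _)).
apply: (@le_lt_trans _ _ (c / (1 - 2^-1))%:E); last exact: ltry.
apply: nneseries_geometric_le => //; first by apply/andP; split; lra.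
by move=> k; exact: hausdorff_ge0.
Qed.

End good_pieces.

(** * Rectifiability *)

(** The Hausdorff measure is not sigma-finite on the whole phase space, so the theorem is applied to
    its restriction to [A], which carries all of [mu]. *)
Lemma radon_nikodym_on (R : realType) d (T : measurableType d)
    (mu : {finite_measure set T -> \bar R}) (nu : {measure set T -> \bar R})
    (A : set T) (F : nat -> set T) :
  A = \bigcup_m F m -> (forall m, measurable (F m)) -> (forall m, nu (F m) < +oo)%E ->
  mu (~` A) = 0%E -> (forall B, measurable B -> nu B = 0%E -> mu B = 0%E) ->
  exists f : T -> R, [/\ measurable_fun setT f, forall x, 0 <= f x &
    forall B, measurable B -> mu B = (\int[nu]_(x in B `&` A) (f x)%:E)%E].
Proof.
move=> AF mF nuF muA munu.
have mA : measurable A by rewrite AF; exact: bigcupT_measurable.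
pose m0 : {measure set T -> \bar R} := mrestr nu mA.
have sf : sigma_finite setT m0.
  (* The complement of [A] is null for the restriction and can be added to every piece to exhaust
     the space. *)
  exists (fun m => ~` A `|` F m).
    apply/seteqP; split => // a _; have [|na] := pselect (A a).
      by rewrite {1}AF => -[m _ am]; exists m => //; right.
    by exists 0%N => //; left.
  move=> m; split; first by apply: measurableU => //; exact: measurableC.
  apply: le_lt_trans (nuF m); apply: le_measure; rewrite ?inE//.
    by apply: measurableI => //; apply: measurableU => //; exact: measurableC.
  by move=> a [[na|am] //].
pose m1 : {sigma_finite_measure set T -> \bar R} :=
  HB.pack (Measure.sort m0) (Measure.class m0)
    (Measure_isSigmaFinite.Build _ _ _ (Measure.sort m0) sf).
have muD B : measurable B -> mu (B `\` A) = 0%E.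
  move=> mB; apply/eqP; rewrite eq_le measure_ge0 andbT -muA.
  apply: le_measure; rewrite ?inE; [exact: measurableD|exact: measurableC|].
  by move=> a [].
have muI B : measurable B -> mu B = mu (B `&` A).
  move=> mB; have mBA : measurable (B `&` A) by exact: measurableI.
  apply/eqP; rewrite eq_le; apply/andP; split; last first.
    by apply: le_measure; rewrite ?inE//; exact: subIsetl.
  rewrite -{1}(setUIDK B A) (le_trans (measureU2 _ _ _))//.
  - exact: measurableD.
  - by rewrite [X in (_ + X)%E](_ : _ = 0%E) ?adde0//; exact: muD.
have dom : mu `<< m1.
  apply/null_content_dominatesP => B mB B0.
  by rewrite muI// munu//; exact: measurableI.
have [f [f0 ffin intf fE]] := radon_nikodym_sigma_finite dom.
exists (fun x => fine (f x)); split.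
- by apply: measurableT_comp => //; have /integrableP[] := intf.
- by move=> x; apply: fine_ge0.
move=> B mB; have mBA : measurable (B `&` A) by exact: measurableI.
rewrite muI// fE//.
transitivity (\int[m1]_(x in B `&` A) (fine (f x))%:E)%E.
  by apply: eq_integral => x _; rewrite fineK.
apply: (@eq_measure_integral _ _ _ _ nu) => E mE EB.
by rewrite /m1 /= /mrestr setIidl// => a /EB[].
Qed.

Section rectifiable_graph.
Context {R : realType} {D : nat} {kappa : {nonneg R}} {rho : 'rV[R]_D} {p : R}.
Hypothesis H : regime kappa rho p.

Local Notation phase := (torus R D * unit_interval R)%type.
Local Notation Phi := (upper_graph_set kappa rho).
Local Notation good := (good_set (rho := rho) (p := p)).
Local Notation strong := (strong_set (rho := rho) (p := p)).
Local Notation gmap := (graph_map kappa rho).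

Let D0 := regime_dim H.

Definition good_graph : set (borel phase) := \bigcup_m graph_over kappa rho (good m).

Lemma measurable_good_graph : measurable good_graph.
Proof.
apply: bigcupT_measurable => m; apply: measurable_graph_over.
exact: measurable_good_set.
Qed.

Lemma graph_map_lipschitz m x y : good m x -> good m y ->
  mdist (gmap x : phase) (gmap y) <= lip_const (kappa := kappa) m * mdist x y.
Proof.
move=> xm ym; rewrite [leLHS]/mdist/= /prod_dist ge_max.
rewrite (upper_graph_lipschitz H xm ym) andbT /= ler_peMl ?mdist_ge0//.
exact: lip_const_ge1 H m.
Qed.

Lemma countably_rectifiable_good_graph : countably_rectifiable D good_graph.
Proof.
split; first exact: measurable_good_graph.
exists (fun m => [set u | good m (torus_of u)]), (fun m u => gmap (torus_of u)).
split=> [m|].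
  exists (lip_const (kappa := kappa) m) => u v um vm.
  rewrite (le_trans (graph_map_lipschitz um vm))// ler_wpM2l//.
    by have := lip_const_ge1 H m; lra.
  by rewrite [mdist _ _]torus_distE torus_norm_le_euclid.
rewrite (_ : _ `\` _ = set0); first by apply: hausdorff0; rewrite pnatr_eq0 -lt0n.
apply/seteqP; split => // -[x y] [[m _ [xy xm]] nim]; apply: nim.
exists m => //; exists (torus_rep x) => /=; first by rewrite torus_of_rep.
rewrite torus_of_rep /graph_map; congr pair; apply: val_inj.
by symmetry; exact: xy.
Qed.

Lemma good_graph_full : graph_prob kappa rho (~` good_graph) = 0%E.
Proof.
apply/eqP; rewrite eq_le measure_ge0 andbT; apply/lee_addgt0Pr => e e0; rewrite add0e.
have h : 0 <= (2^-1 : R) < 1 by apply/andP; split; lra.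
have [m /(_ m (leqnn _)) me] := exists_expr_le h e0.
have -> : graph_prob kappa rho (~` good_graph) = torus_prob D (gmap @^-1` (~` good_graph)) by [].
apply: (@le_trans _ _ (torus_prob D (~` (strong m : set (borel (torus R D)))))).
  apply: le_measure; rewrite ?inE.
  - have := measurable_graph_map kappa rho measurableT (measurableC measurable_good_graph).
    by rewrite setTI.
  - by apply: measurableC; exact: measurable_strong_set.
  move=> x /= xn xm; apply: xn; exists m => //; split => //=.
  exact: strong_good H _ _ xm.
rewrite (le_trans (strong_set_compl H m))// lee_fin.
Qed.

Lemma rectifiable_graph_prob : rectifiable_measure D (graph_prob kappa rho).
Proof.
split; first by rewrite probability_setT ltry.
have DN0 : D%:R != 0 :> R by rewrite pnatr_eq0 -lt0n.
have [||f [mf f0 fE]] := @radon_nikodym_on R _ _ (graph_prob kappa rho)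
    (hausdorff_borel DN0) good_graph (fun m => graph_over kappa rho (good m)) erefl _
    (hausdorff_good_piece H) good_graph_full.
- by move=> m; apply: measurable_graph_over; exact: measurable_good_set.
- by move=> B mB B0; exact: graph_prob_null.
exists good_graph, f; split => //.
- exact: countably_rectifiable_good_graph.
- exact: measurable_funTS.
Qed.

End rectifiable_graph.

(** * Pointwise and information dimension *)

Section ball_measure.
Context {R : realType} (X : pmetricType R) (mu : {measure set (borel X) -> \bar R}).

(** Continuity from below along the smaller balls. It makes the measure of a ball lower
    semicontinuous in the centre, hence the integrand of the information dimension measurable. *)
Lemma ball_inner_measure (x : X) (e : R) (t : \bar R) : (t < mu (ball x e))%E ->
  exists2 e', e' < e & (t < mu (ball x e'))%E.
Proof.
move=> te; pose F n : set (borel X) := ball x (e - n.+1%:R^-1).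
have FU : \bigcup_n F n = (ball x e : set (borel X)).
  apply/seteqP; split => [y [n _]|y].
    apply: le_ball; rewrite lerBlDr lerDl invr_ge0//.
  rewrite ballEmdist/= => xy; have [n nP] := @ltr_add_invr R (mdist x y) e xy.
  by exists n => //; rewrite /F ballEmdist/= ltrBrDr.
have mF n : measurable (F n) by exact: measurable_mball.
have mU : measurable (\bigcup_n F n) by exact: bigcupT_measurable.
have ndF : nondecreasing_seq F.
  move=> m n mn; apply/subsetPset; apply: le_ball.
  by rewrite lerD2l lerN2 lef_pV2 ?posrE// ler_nat.
have := @nondecreasing_cvg_mu _ _ _ mu F mF mU ndF.
rewrite FU => /(_ [set y | (t < y)%E]) [].
  by apply: open_nbhs_nbhs; split => //; exact: open_ereal_gt_ereal.
move=> n _ /(_ n (leqnn n)) nP; exists (e - n.+1%:R^-1) => //.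
by rewrite ltrBlDr ltrDl invr_gt0.
Qed.

Lemma open_ball_measure_gt (e : R) (t : \bar R) : open [set x : X | (t < mu (ball x e))%E].
Proof.
rewrite [X in X _]openE => x /= tx; have [e' ee te'] := ball_inner_measure tx.
apply/nbhs_ballP; exists (e - e'); rewrite /= ?subr_gt0// => y.
rewrite ballEmdist/= => xy; apply: (lt_le_trans te').
apply: le_measure; rewrite ?inE; [exact: measurable_mball|exact: measurable_mball|].
move=> z; rewrite !ballEmdist/= => xz; have := metric_triangle y x z.
have := metric_sym x y; lra.
Qed.

Lemma measurable_lne_ball (e : R) :
  measurable_fun setT (fun x : borel X => lne (mu (ball (x : X) e))).
Proof.
apply: (measurability _ (ErealGenOInfty.measurableE R)) => _ /= [_ [a ->]] <-.
rewrite setTI preimage_itvoy; apply: sub_sigma_algebra => /=.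
rewrite (_ : [set _ | _] = [set x : X | (((expR a)%:E : \bar R) < mu (ball x e))%E]).
  exact: open_ball_measure_gt.
have lneE (v : \bar R) : (0 <= v)%E -> (a%:E < lne v)%E = ((expR a)%:E < v)%E.
  by move=> v0; rewrite -[(expR a)%:E]/(expeR a%:E) -lte_expeR lneK// in_itv/= v0 leey.
by apply/seteqP; split => x; have := lneE (mu (ball (x : X) e)) (measure_ge0 _ _); move=> /= ->.
Qed.

End ball_measure.

(** An additive error [s] in the logarithm becomes [s / - ln e] in the quotient, which tends to
    0. *)
Lemma log_quotient_cvg {R : realType} (f : R -> \bar R) (a s : R) : 0 <= s ->
  (forall e, 0 < e < 1 -> ((a * ln e - s)%:E <= f e <= (a * ln e + s)%:E)%E) ->
  (f e / (ln e)%:E)%E @[e --> 0%R^'+] --> a%:E.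
Proof.
move=> s0 fP.
have ffin e : 0 < e < 1 -> exists2 v, f e = v%:E & a * ln e - s <= v <= a * ln e + s.
  by move=> /fP; case: (f e) => [v||]//=; rewrite ?leeNy_eq ?leye_eq ?andbF// !lee_fin; exists v.
have l0 (e : R) : 0 < e < 1 -> ln e < 0 by exact: ln_lt0.
have fE e : 0 < e < 1 -> exists2 w, (f e / (ln e)%:E)%E = w%:E & `|a - w| <= s / - ln e.
  move=> e01; have le0 := l0 e e01; have [v vE /andP[v1 v2]] := ffin e e01.
  exists (v / ln e); first by rewrite vE inver lt_eqF.
  rewrite (_ : a - v / ln e = (v - a * ln e) / - ln e); last by field; rewrite lt_eqF.
  rewrite normrM (ger0_norm (_ : 0 <= (- ln e)^-1)); last by rewrite invr_ge0 oppr_ge0 ltW.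
  rewrite ler_wpM2r//; first by rewrite invr_ge0 oppr_ge0 ltW.
  by rewrite ler_norml; apply/andP; split; lra.
apply/fine_cvgP; split.
  near=> e; have [|w -> //] := fE e.
  by apply/andP; split; near: e; [exact: nbhs_right_gt|exact: nbhs_right_lt].
apply/cvgrPdist_le => /= t t0; near=> e.
have e01 : 0 < e < 1.
  by apply/andP; split; near: e; [exact: nbhs_right_gt|exact: nbhs_right_lt].
have [w wE aw] := fE e e01; rewrite wE/= (le_trans aw)//.
have le0 := l0 e e01; rewrite ler_pdivrMr ?oppr_gt0//.
have : ln e <= - (s / t).
  have e0 : 0 < e by case/andP: e01.
  rewrite -[leRHS]expRK ler_ln ?posrE ?expR_gt0//.
  by near: e; apply: nbhs_right_le; exact: expR_gt0.
by rewrite lerNr ler_pdivrMr//; lra.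
Unshelve. all: by end_near. Qed.

Section dimensions_of_graph_measure.
Context {R : realType} {D : nat} {kappa : {nonneg R}} {rho : 'rV[R]_D} {p : R}.
Hypothesis H : regime kappa rho p.

Local Notation phase := (torus R D * unit_interval R)%type.
Local Notation tau j := (torus_of (rho *+ j)).
Local Notation good := (good_set (rho := rho) (p := p)).
Local Notation strong := (strong_set (rho := rho) (p := p)).
Local Notation gmap := (graph_map kappa rho).
Local Notation L := (lip_const (kappa := kappa)).

Let D0 := regime_dim H.
Let p0 := regime_gt0 H.

(* A ball around [j rho] that meets a ball of radius [h] around a point of
   [strong_set m] has [2 D p ^ j < 2 h], hence radius at most [2 h p ^ j]. *)
Lemma strong_ball_bad m x h : strong m x -> 0 < h <= 1 ->
  (torus_prob D ((ball x h : set (borel (torus R D))) `\` (good m : set (borel (torus R D))))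
     <= (2^-1 * (h / (2 * D%:R)) ^+ D)%:E)%E.
Proof.
move=> xm /andP[h0 h1].
have DR := regime_dimR H; have pD := regime_pD H.
have p1 : p <= 2^-1 by have := regime_p_le H; lra.
have hp j : 0 <= 2 * h * p ^+ j by rewrite !mulr_ge0 ?exprn_ge0 ?ltW.
pose F k : set (borel (torus R D)) :=
  [set y | mdist (tau (m + k).+1) y <= 2 * h * p ^+ (m + k).+1].
have mF k : measurable (F k) by exact: measurable_cball.
have sub : (ball x h : set (borel (torus R D))) `\` (good m : set (borel (torus R D)))
    `<=` \bigcup_k F k.
  move=> y /= [xy] /existsNP[j /not_implyP[mj]] /negP; rewrite -ltNge => yj.
  rewrite ballEmdist/= in xy.
  exists (j - m.+1)%N => //; rewrite /F/= -addSn subnKC// metric_sym.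
  have tri : mdist x (tau j) <= mdist x y + mdist y (tau j) by exact: metric_triangle.
  have := xm j mj; move: yj; rewrite mul2n -addnn exprD.
  have q0 : 0 < p ^+ j by rewrite exprn_gt0.
  have q1 : p ^+ j <= 2^-1.
    rewrite (le_trans _ p1)// -[leRHS]expr1 ler_wiXn2l ?(ltW p0)//; first by lra.
    exact: leq_ltn_trans mj.
  set q := p ^+ j in q0 q1 *; set r := 2 * D%:R.
  have r0 : 0 < r by rewrite /r; lra.
  rewrite mulrA => yj xj.
  have rq : r * q < 2 * h.
    have : r * q * q <= r * q / 2 by rewrite ler_wpM2l// mulr_ge0//ltW.
    lra.
  have := ltW rq; rewrite -(ler_pM2r q0); lra.
have mB : measurable ((ball x h : set (borel (torus R D))) `\` (good m : set (borel (torus R D)))).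
  by apply: measurableD; [exact: measurable_mball|exact: measurable_good_set].
rewrite (le_trans (measure_sigma_subadditive (torus_prob D) mF mB sub))//.
have c0 : 0 <= (12 * h * p) ^+ D by rewrite exprn_ge0// !mulr_ge0// ltW.
have q01 : 0 <= (2^-1 : R) < 1 by apply/andP; split; lra.
have := @nneseries_geometric_le R (fun k => torus_prob D (F k)) _ _ c0 q01.
move=> /(_ (fun k => measure_ge0 _ _)) h2; apply: (le_trans (h2 _)).
  move=> k; apply: (le_trans (torus_prob_ball_le _ (hp _))); rewrite lee_fin.
  rewrite (_ : 6 * _ = 12 * h * p * p ^+ (m + k)); last by rewrite exprS; ring.
  rewrite exprMn ler_wpM2l// -exprM.
  rewrite (@le_trans _ _ (p ^+ k))//; last by rewrite lerXn2r ?nnegrE ?(ltW p0).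
  rewrite ler_wiXn2l ?(ltW p0) ?(regime_p_le1 H)//.
  by rewrite (leq_trans (leq_addl m k))// leq_pmulr.
rewrite lee_fin.
(* The factor [h / (2 * D)] is the one in [torus_prob_ball_ge]; the other is at most 1/16, so the
   removed part is at most half of that lower bound. *)
have -> : 12 * h * p = h / (2 * D%:R) * (24 * (D%:R * p)) by field; lra.
rewrite exprMn.
have : (24 * (D%:R * p)) ^+ D <= 24 * (D%:R * p).
  have Dp0 : 0 <= D%:R * p by rewrite mulr_ge0// ltW.
  by rewrite -[leRHS]expr1 ler_wiXn2l//; lra.
have : 0 <= (h / (2 * D%:R)) ^+ D by rewrite exprn_ge0// divr_ge0// ltW// mulr_gt0//; lra.
rewrite (_ : _ / (1 - 2^-1) = ((h / (2 * D%:R)) ^+ D) * (2 * (24 * (D%:R * p)) ^+ D)); last by field.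
move=> a0 b1; rewrite mulrC ler_wpM2r//; lra.
Qed.

(** Half of the lower bound for a base ball of radius [h] survives the removal of the exceptional
    balls, and there the graph map has Lipschitz constant [L m]. The choice [h = e / (2 * L m)]
    keeps the image strictly inside the open ball of radius [e]. *)
Lemma graph_prob_ball_ge m x e : strong m x -> 0 < e <= 1 ->
  ((2^-1 * (e / (4 * D%:R * L m)) ^+ D)%:E <= graph_prob kappa rho (ball (gmap x : phase) e))%E.
Proof.
move=> xm /andP[e0 e1]; have L1 := lip_const_ge1 H m; have DR := regime_dimR H.
set h := e / (2 * L m).
have hL : h * L m = e / 2 by rewrite /h; field; lra.
have h0 : 0 < h by rewrite divr_gt0//; lra.
have h1 : h <= 1.
  have : h <= h * L m by rewrite ler_peMr// ltW.
  lra.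
have -> : e / (4 * D%:R * L m) = h / (2 * D%:R) by rewrite /h; field; lra.
have hh : 0 < h <= 1 by rewrite h0.
pose Bx : set (borel (torus R D)) := ball x h; pose G : set (borel (torus R D)) := good m.
have mBx : measurable Bx by exact: measurable_mball.
have mG : measurable G by exact: measurable_good_set.
have bad := strong_ball_bad xm hh.
have all := torus_prob_ball_ge x D0 hh.
have mBG : measurable (Bx `&` G) by exact: measurableI.
have mBD : measurable (Bx `\` G) by exact: measurableD.
have split : (torus_prob D Bx <= torus_prob D (Bx `&` G) + torus_prob D (Bx `\` G))%E.
  by rewrite -{1}(setUIDK Bx G); exact: measureU2.
have : (torus_prob D (Bx `&` G) <= graph_prob kappa rho (ball (gmap x : phase) e))%E.
  have -> : graph_prob kappa rho (ball (gmap x : phase) e) =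
    torus_prob D (gmap @^-1` (ball (gmap x : phase) e)) by [].
  apply: le_measure; rewrite ?inE//.
    by have := measurable_graph_map kappa rho measurableT (measurable_mball (gmap x : phase) e); rewrite setTI.
  move=> y [xy ym]; rewrite /= ballEmdist/=.
  have := graph_map_lipschitz H (strong_good H xm) ym; rewrite /Bx ballEmdist/= in xy.
  have : L m * mdist x y <= L m * h by rewrite ler_wpM2l ?ltW//; lra.
  by rewrite (mulrC _ h) hL; lra.
apply: le_trans; move: all split bad; rewrite -/Bx -/G.
set A := (h / _) ^+ D; rewrite -(fineK (fin_num_measure _ _ mBx)).
rewrite -(fineK (fin_num_measure _ _ mBG)) -(fineK (fin_num_measure _ _ mBD)).
by rewrite -EFinD !lee_fin; lra.
Qed.

(** [ln (L m)] is affine in [m], so the defect is linear in the index. Constants uniform in [m], [x]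
    and [e] are what allows it to be integrated. *)
Lemma lne_graph_prob_ball_ge : exists a b : R, [/\ 0 <= a, 0 < b & forall m x e,
  strong m x -> 0 < e <= 1 ->
  ((D%:R * ln e - a - m%:R * b)%:E <= lne (graph_prob kappa rho (ball (gmap x : phase) e)))%E].
Proof.
have B2 := regime_factor_ge2 H; have DR := regime_dimR H.
set B := 4 * kappa%:num in B2.
have B0 : 0 < B by lra.
pose a := ln 2 + D%:R * ln (4 * D%:R * (8 * B)).
pose b := D%:R * 3 * ln B.
have lB : 0 < ln B by rewrite ln_gt0//; lra.
exists a, b; split.
- rewrite addr_ge0 ?mulr_ge0 ?ln_ge0//; [lra|nra].
- by rewrite !mulr_gt0//; lra.
move=> m x e xm /andP[e0 e1].
have e01 : 0 < e <= 1 by rewrite e0.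
have := graph_prob_ball_ge xm e01.
set v := graph_prob _ _ _ => vge.
have Lm : L m = 8 * B * B ^+ (3 * m) by rewrite /lip_const -/B addn1 exprS; ring.
have L0 : 0 < L m by have := lip_const_ge1 H m; lra.
have q0 : 0 < e / (4 * D%:R * L m) by rewrite divr_gt0// mulr_gt0// mulr_gt0//; lra.
have w0 : 0 < 2^-1 * (e / (4 * D%:R * L m)) ^+ D by rewrite mulr_gt0 ?exprn_gt0.
suff -> : D%:R * ln e - a - m%:R * b = ln (2^-1 * (e / (4 * D%:R * L m)) ^+ D).
  rewrite -lne_EFin// lee_lne ?in_itv/= ?leey ?andbT ?lee_fin ?(ltW w0)//.
  exact: measure_ge0.
rewrite lnM ?posrE ?exprn_gt0// lnV ?posrE// lnXn// ln_div ?posrE//; last first.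
  by rewrite mulr_gt0// mulr_gt0//; lra.
rewrite (_ : 4 * _ * L m = 4 * D%:R * (8 * B) * B ^+ (3 * m)); last by rewrite Lm; ring.
rewrite lnM ?posrE ?exprn_gt0//; last by rewrite mulr_gt0//; lra.
rewrite lnXn// /a /b -[ln B *+ _]mulr_natr -[(_ - _) *+ D]mulr_natr [(3 * m)%:R]natrM.
by move: (ln 2) (ln B) (ln e) (ln (4 * D%:R * (8 * B))) D%:R m%:R => *; ring.
Qed.

Lemma lne_graph_prob_ball_le (z : phase) (e : R) : 0 < e ->
  (lne (graph_prob kappa rho (ball z e)) <= (D%:R * ln e + D%:R * ln 6)%:E)%E.
Proof.
move=> e0; have w0 : 0 < (6 * e) ^+ D by rewrite exprn_gt0// mulr_gt0.
have -> : D%:R * ln e + D%:R * ln 6 = ln ((6 * e) ^+ D).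
  by rewrite lnXn ?mulr_gt0// lnM ?posrE// -mulr_natr; ring.
rewrite -lne_EFin// lee_lne ?in_itv/= ?leey ?andbT ?lee_fin ?(ltW w0) ?measure_ge0//.
by apply: graph_prob_ball_le; rewrite ltW.
Qed.

Lemma exact_dimensional_graph_prob : exact_dimensional (graph_prob kappa rho) D%:R.
Proof.
have [a [b [a0 b0 ab]]] := lne_graph_prob_ball_ge.
pose S : set (borel phase) := \bigcup_m graph_over kappa rho (strong m).
have mS : measurable S.
  apply: bigcupT_measurable => m; apply: measurable_graph_over.
  exact: measurable_strong_set.
exists (~` S); split; first exact: measurableC.
  apply/eqP; rewrite eq_le measure_ge0 andbT; apply/lee_addgt0Pr => e e0; rewrite add0e.
  have h : 0 <= (2^-1 : R) < 1 by apply/andP; split; lra.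
  have [m /(_ m (leqnn _)) me] := exists_expr_le h e0.
  apply: (@le_trans _ _ (torus_prob D (~` (strong m : set (borel (torus R D)))))).
    have -> : graph_prob kappa rho (~` S) = torus_prob D (gmap @^-1` (~` S)) by [].
    apply: le_measure; rewrite ?inE.
    - have := measurable_graph_map kappa rho measurableT (measurableC mS).
      by rewrite setTI.
    - by apply: measurableC; exact: measurable_strong_set.
    by move=> x /= xn xm; apply: xn; exists m.
  by rewrite (le_trans (strong_set_compl H m))// lee_fin.
apply: subsetC => -[x y] [m _ [xy xm]].
have -> : (x, y) = gmap x.
  by rewrite /graph_map; congr pair; apply: val_inj; exact: xy.
pose s := a + m%:R * b + D%:R * ln 6.
have l6 : 0 <= D%:R * ln 6 :> R by rewrite mulr_ge0// ln_ge0//; lra.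
have mb : 0 <= m%:R * b by rewrite mulr_ge0// ltW.
rewrite /= /has_pointwise_dim; apply: (@log_quotient_cvg _ _ _ s).
  by rewrite /s !addr_ge0.
move=> e /andP[e0 e1]; apply/andP; split.
  apply: le_trans (ab m x e xm _); last by rewrite e0 ltW.
  by rewrite lee_fin /s; lra.
apply: (le_trans (lne_graph_prob_ball_le (gmap x) e0)).
by rewrite lee_fin /s; lra.
Qed.

(** The least [m] with [strong m x] is at most the number of strong sets that miss [x]. The integral
    of this number is at most the sum of the [2 ^ (- m)], namely 2, hence the term [2 * b]. *)
Lemma has_information_dim_graph_prob : has_information_dim (graph_prob kappa rho) D%:R.
Proof.
have [a [b [a0 b0 ab]]] := lne_graph_prob_ball_ge.
have l6 : 0 <= D%:R * ln 6 :> R by rewrite mulr_ge0// ln_ge0//; lra.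
apply: (@log_quotient_cvg _ _ _ (a + 2 * b + D%:R * ln 6)).
  by rewrite !addr_ge0// mulr_ge0// ltW.
move=> e /andP[e0 e1]; pose g z := (- lne (graph_prob kappa rho (ball (z : phase) e)))%E.
have g0 z : (0 <= g z)%E by rewrite oppe_ge0 lne_le0 probability_le1//; exact: measurable_mball.
have mg : measurable_fun setT (g : borel phase -> \bar R).
  by apply: measurableT_comp => //; exact: measurable_lne_ball.
have le0 : ln e < 0 by rewrite ln_lt0// e0.
suff /andP[h1 h2] : ((- (D%:R * ln e) - D%:R * ln 6)%:E <=
    \int[graph_prob kappa rho]_z g z <= (- (D%:R * ln e) + a + 2 * b)%:E)%E.
  have -> : (\int[graph_prob kappa rho]_z lne (graph_prob kappa rho (ball (z : phase) e)) =
    - \int[graph_prob kappa rho]_z g z)%E.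
    by rewrite -integral_ge0N//; apply: eq_integral => z _; rewrite oppeK.
  move: h1 h2; case: (\int[_]_z _)%E => [v||]//.
  by rewrite -EFinN !lee_fin => h1 h2; apply/andP; split; lra.
apply/andP; split.
  set c := - _ - _; have [c0|/ltW c0] := leP 0 c; last first.
    by apply: (@le_trans _ _ 0%E); [rewrite lee_fin|apply: integral_ge0].
  have -> : c%:E = (\int[graph_prob kappa rho]_(z in setT) cst c%:E z)%E.
    by rewrite integral_cst// [X in (_ * X)%E](_ : _ = 1%E) ?mule1//; exact: probability_setT.
  apply: ge0_le_integral => // z _; rewrite leeNr -EFinN.
  apply: (le_trans (lne_graph_prob_ball_le z e0)).
  by rewrite lee_fin /c; lra.
pose I m : borel (torus R D) -> \bar R := fun x => (\1_(~` (strong m : set (borel (torus R D)))) x)%:E.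
have mS m : measurable (~` (strong m : set (borel (torus R D)))).
  by apply: measurableC; exact: measurable_strong_set.
have I0 m x : (0 <= I m x)%E by rewrite lee_fin.
have mI m : measurable_fun setT (I m).
  by apply/measurable_EFinP; exact: measurable_indic.
have c0 : 0 <= - (D%:R * ln e) + a.
  by rewrite addr_ge0// -mulrN mulr_ge0//; lra.
have mIs : measurable_fun setT (fun x => \sum_(0 <= m <oo) I m x)%E.
  exact: ge0_emeasurable_sum.
have Is0 x : (0 <= \sum_(0 <= m <oo) I m x)%E by exact: nneseries_ge0.
rewrite ge0_integral_distribution//.
apply: (@le_trans _ _ (\int[torus_prob D]_x ((- (D%:R * ln e) + a)%:E +
    b%:E * \sum_(0 <= m <oo) I m x))%E).
  apply: ge0_le_integral => //.
  - by move=> x _; exact: g0.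
  - exact: (measurableT_comp mg (measurable_graph_map kappa rho)).
  - by apply: emeasurable_funD => //; exact: measurable_funeM.
  move=> x _.
  have sumI n : (forall k, (k < n)%N -> ~ strong k x) ->
      (n%:R%:E <= \sum_(0 <= m <oo) I m x)%E.
    move=> nx; apply: le_trans (nneseries_lim_ge n (fun k _ _ => I0 k x)).
    rewrite (eq_big_nat _ _ (F2 := fun=> 1%E)) => [|k /andP[_ kn]]; last first.
      by rewrite /I indicE mem_set//; exact: nx.
    by rewrite sumEFin sumr_const_nat subn0.
  have [[m xm]|nx] := pselect (exists m, strong m x); last first.
    rewrite (_ : \sum_(0 <= m <oo) I m x = +oo)%E ?gt0_muley ?addey ?leey//.
    apply/eqyP => t t0; apply: (@le_trans _ _ (Num.truncn t).+1%:R%:E).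
      by rewrite lee_fin ltW// truncnS_gt.
    by apply: sumI => k _ xk; apply: nx; exists k.
  have [n /asboolP xn nmin] := ex_minnP (ex_intro (fun m => `[< strong m x >]) m (asboolT xm)).
  rewrite leeNl; apply: le_trans (ab n x e xn _); last by rewrite e0 ltW.
  have /sumI sn : forall k, (k < n)%N -> ~ strong k x.
    by move=> k kn /asboolP /nmin; rewrite leqNgt kn.
  rewrite leeNl -EFinN.
  apply: (@le_trans _ _ ((- (D%:R * ln e) + a)%:E + b%:E * n%:R%:E)%E).
    by rewrite lee_fin; lra.
  by rewrite leeD2l// lee_wpmul2l// lee_fin ltW.
rewrite ge0_integralD//; last 2 first.
- by move=> x _; rewrite mule_ge0// lee_fin ltW.
- exact: measurable_funeM.
rewrite ge0_integralZl_EFin ?(ltW b0)// integral_nneseries//.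
have -> : (\int[torus_prob D]_x (- (D%:R * ln e) + a)%:E = (- (D%:R * ln e) + a)%:E)%E.
  rewrite (integral_cst (torus_prob D) measurableT (- (D%:R * ln e) + a)%:E).
  by rewrite [X in (_ * X)%E](_ : _ = 1%E) ?mule1//; exact: probability_setT.
rewrite [leRHS]EFinD leeD2l// (mulrC 2) EFinM lee_wpmul2l ?lee_fin ?(ltW b0)//.
have h : 0 <= (2^-1 : R) < 1 by apply/andP; split; lra.
have := @nneseries_geometric_le R (fun m => \int[torus_prob D]_x I m x)%E 1 2^-1 ler01 h.
rewrite (_ : 1 / (1 - 2^-1) = 2 :> R); last by field.
apply; first by move=> m; exact: integral_ge0.
by move=> m; rewrite integral_indic// setIT mul1r; exact: strong_set_compl H m.
Qed.

End dimensions_of_graph_measure.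

(** * Infinite length over the circle *)

(** A covering set of diameter [d] has its heights in an interval of length [2 * d], whence the
    factor 2. The sets [K i] take up heights that need not occur on [A]. *)
Lemma lebesgue_le_hausdorff1 {R : realType} {D : nat} (W : set R)
    (A : set (torus R D * unit_interval R)) (K : nat -> set R) :
  measurable W -> (forall i, measurable (K i)) ->
  W `<=` [set q.2%:num | q in A] `|` \bigcup_i K i ->
  (lebesgue_measure W <=
    2%:E * hausdorff_measure 1 A + \sum_(0 <= i <oo) lebesgue_measure (K i))%E.
Proof.
move=> mW mK WAK; set c := (\sum_(0 <= i <oo) _)%E.
have c0 : (0 <= c)%E by exact: nneseries_ge0.
have [->|cfin] := eqVneq c +oo%E.
  have : (0 <= 2%:E * hausdorff_measure 1 A)%E by rewrite mule_ge0// hausdorff_ge0.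
  by case: (2%:E * _)%E => // *; rewrite ?addey// leey.
have {}cfin : c \is a fin_num by rewrite ge0_fin_numE// ltey.
rewrite -leeBlDr// -lee_pdivrMl//.
apply: le_trans (premeasure_le_hausdorff _ _ ltr01).
apply: le_ereal_inf_tmp => _ [J [U [AU Ud ->]]]; rewrite lee_pdivrMl// leeBlDr//.
pose x i : torus R D * unit_interval R := xget point (U i).
pose F i : set R := if (i \in J) && (U i != set0)
  then [set` `[(x i).2%:num - fine (diam (U i)), (x i).2%:num + fine (diam (U i))]] else set0.
have mF i : measurable (F i) by rewrite /F; case: ifP => // _; exact: measurable_itv.
have WF : W `<=` \bigcup_i F i `|` \bigcup_i K i.
  move=> y /WAK[[q Aq <-]|]; last by right.
  left; have [i Ji Uq] := AU q Aq; exists i => //.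
  have Ux : U i (x i) by exact: xgetPex (ex_intro _ q Uq).
  rewrite /F mem_set//=; case: ifPn => [_ /=|/negPn/eqP U0]; last by rewrite U0 in Uq.
  have : mdist (x i).2 q.2 <= mdist (x i) q by rewrite [leRHS]/mdist/= /prod_dist le_max lexx orbT.
  rewrite [leLHS]/mdist/= /unit_dist; have := mdist_le_diam Ux Uq.
  have := Ud i Ji; have := diam_ge0 (U i).
  case: (diam (U i)) => //= d; rewrite !lee_fin => _ _ h1 h2.
  have := le_trans h2 h1; rewrite ler_norml => /andP[h3 h4].
  by rewrite in_itv/=; apply/andP; split; lra.
have mUF : measurable (\bigcup_i F i) by exact: bigcupT_measurable.
have mUK : measurable (\bigcup_i K i) by exact: bigcupT_measurable.
apply: (@le_trans _ _ (lebesgue_measure (\bigcup_i F i `|` \bigcup_i K i))).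
  by apply: le_measure; rewrite ?inE//; exact: measurableU.
apply: (le_trans (measureU2 lebesgue_measure mUF mUK)); apply: leeD; last first.
  exact: (measure_sigma_subadditive lebesgue_measure mK mUK (@subset_refl _ _)).
apply: (le_trans (measure_sigma_subadditive lebesgue_measure mF mUF (@subset_refl _ _))).
rewrite esum_mkcond -nneseries_esumT; last first.
  by move=> i; case: ifP => // _; exact: poweR_ge0.
rewrite -nneseriesZl; last by move=> i _; case: ifP => // _; exact: poweR_ge0.
apply: lee_nneseries => i _; first by move=> _; exact: measure_ge0.
rewrite /F; case: ifPn => [/andP[Ji _]|_].
  rewrite Ji; have := Ud i (set_mem Ji); have := diam_ge0 (U i).
  case: (diam (U i)) => //= d; rewrite !lee_fin => d0 _.
  rewrite lebesgue_measure_itv/= powRr1//; case: ifP => _.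
    by rewrite -EFinB lee_fin; lra.
  by rewrite lee_fin; lra.
by rewrite measure0; case: ifP => _; rewrite ?mule0// mule_ge0 ?poweR_ge0.
Qed.

(** Extending over the gaps of the arc makes the intermediate value theorem available; the lower
    bound [b] keeps the infimum finite. *)
Lemma lipschitz_extension {R : realType} (E : set R) (f : R -> R) (L b : R) :
  E !=set0 -> 0 <= L -> (forall s, b <= f s) ->
  (forall s t, E s -> E t -> `|f s - f t| <= L * `|s - t|) ->
  exists g : R -> R, (forall s, E s -> g s = f s) /\
    (forall s t, `|g s - g t| <= L * `|s - t|).
Proof.
move=> E0 L0 fb fL; pose S s := [set f t + L * `|s - t| | t in E].
(* McShane's extension *)
pose g s := inf (S s).
have Sb s : lbound (S s) b.
  by move=> _ [t _ <-]; rewrite (le_trans (fb t))// lerDl mulr_ge0.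
have S0 s : S s !=set0 by have [t Et] := E0; exists (f t + L * `|s - t|); exists t.
have hS s : has_lbound (S s) by exists b.
have gle s t : E t -> g s <= f t + L * `|s - t| by move=> Et; apply: ge_inf => //; exists t.
have gL s t : g s <= g t + L * `|s - t|.
  rewrite -lerBlDr; apply: lb_le_inf => // _ [v Ev <-]; rewrite lerBlDr.
  rewrite (le_trans (gle s v Ev))// -addrA lerD2l -mulrDr ler_wpM2l//.
  by rewrite [leRHS]addrC ler_distD.
exists g; split=> [s Es|s t]; last first.
  by rewrite ler_norml lerBlDl gL andbT lerNl opprB lerBlDl distrC gL.
apply/eqP; rewrite eq_le; apply/andP; split.
  by have := gle s s Es; rewrite subrr normr0 mulr0 addr0.
apply: lb_le_inf => // _ [t Et <-].
by have := fL s t Es Et; rewrite ler_norml => /andP[_]; lra.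
Qed.

Lemma lipschitz_continuous {R : realType} (g : R -> R) (L : R) : 0 <= L ->
  (forall s t, `|g s - g t| <= L * `|s - t|) -> continuous g.
Proof.
move=> L0 gL s; apply/cvgrPdist_le => /= e e0; near=> t.
rewrite (le_trans (gL s t))//; apply: (@le_trans _ _ ((L + 1) * `|s - t|)).
  by rewrite ler_wpM2r// lerDl.
rewrite mulrC -ler_pdivlMr; last by rewrite ltr_wpDl.
near: t; apply: cvgr_dist_le; first exact: cvg_id.
by rewrite divr_gt0// ltr_wpDl.
Unshelve. all: by end_near. Qed.

Section circle.
Context {R : realType} {kappa : {nonneg R}} {rho : 'rV[R]_1} {p : R}.
Hypothesis H : regime kappa rho p.
Implicit Types (s t : R) (i j k l n : nat).

Local Notation phase := (torus R 1 * unit_interval R)%type.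
Local Notation tau j := (torus_of (rho *+ j)).
Local Notation good := (good_set (rho := rho) (p := p)).
Local Notation phi := (upper_lift kappa rho).
Local Notation P := (boundary_iter kappa rho).
Local Notation delta := (p ^+ 32).
Local Notation L := (lip_const (kappa := kappa)).

Let p0 := regime_gt0 H.

Definition line s : 'rV[R]_1 := const_mx s.

Lemma torus_norm_line s : torus_norm (line s) <= `|s|.
Proof. by rewrite (le_trans (torus_norm_le_sum _))// big_ord1 mxE int_dist_norm. Qed.

Lemma le_torus_norm_line s : `|s| <= 2^-1 -> `|s| <= torus_norm (line s).
Proof.
move=> s2; rewrite -(int_dist_small s2).
by have := int_dist_le_torus_norm (line s) 0; rewrite mxE.
Qed.

Lemma line0 : line 0 = 0.
Proof. by apply/rowP => i; rewrite !mxE. Qed.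

Lemma lineB s t : line s - line t = line (s - t).
Proof. by apply/rowP => i; rewrite !mxE. Qed.

Let pn k : 0 < p ^+ k. Proof. by rewrite exprn_gt0. Qed.
Let pn1 k : p ^+ k <= 1. Proof. by rewrite exprn_ile1 ?(ltW p0)// (regime_p_le1 H). Qed.
Let ple k l : (k <= l)%N -> p ^+ l <= p ^+ k.
Proof. by move=> kl; rewrite ler_wiXn2l ?(ltW p0) ?(regime_p_le1 H). Qed.
Let psmall k : 384 * p ^+ k.+1 <= p ^+ k.
Proof. by have := regime_p_le H; have := pn k; rewrite exprS => a b; nra. Qed.

Let phalf k l : p ^+ (2 * (k + l)) <= p ^+ (2 * k) * 2^-1 ^+ l.
Proof.
rewrite mulnDr exprD ler_wpM2l ?(ltW (pn _))//.
apply: (@le_trans _ _ (p ^+ l)); first by apply: ple; rewrite leq_pmull.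
by rewrite lerXn2r ?nnegrE ?(ltW p0)//; have := regime_p_le H; lra.
Qed.

(** The recurrence condition keeps [rho *+ i] at distance [4 * p ^ k] from 0, of which [s] uses up
    at most half. *)
Lemma near_pinch s i k : (0 < k)%N -> (0 < i <= 32 ^ k)%N -> `|s| <= 2 * p ^+ k ->
  2 * p ^+ k <= torus_norm (line s - rho *+ i) /\ 2 * p ^+ k <= torus_norm (line s + rho *+ i).
Proof.
move=> k0 ik sk; have := regime_recurrence H k0 ik; rewrite mulr1 => h.
have s1 := torus_norm_line s; split.
  have := torus_normD (line s) (rho *+ i - line s); rewrite addrC subrK -[X in _ <= _ + X]torus_normN opprB.
  lra.
have := torus_normD (line s + rho *+ i) (- line s); rewrite addrC addKr torus_normN; lra.
Qed.

Lemma good_set_compl m :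
  (torus_prob 1 (~` (good m : set (borel (torus R 1)))) <= (24 * p ^+ (2 * m.+1))%:E)%E.
Proof.
pose F k : set (borel (torus R 1)) :=
  [set x | mdist (tau (m + k).+1) x <= 2 * p ^+ (2 * (m + k).+1)].
have mF k : measurable (F k) by exact: measurable_cball.
have sub : ~` good m `<=` \bigcup_k F k.
  move=> x /= /existsNP[j /not_implyP[mj]] /negP; rewrite -ltNge mulr1 => xj.
  by exists (j - m.+1)%N => //; rewrite /F/= -addSn subnKC// metric_sym ltW.
have mS : measurable (~` (good m : set (borel (torus R 1)))).
  by apply: measurableC; exact: measurable_good_set.
rewrite (le_trans (measure_sigma_subadditive (torus_prob 1) mF mS sub))//.
have c0 : 0 <= 12 * p ^+ (2 * m.+1) by rewrite mulr_ge0// ltW.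
have h : 0 <= (2^-1 : R) < 1 by apply/andP; split; lra.
have := @nneseries_geometric_le R (fun k => torus_prob 1 (F k)) _ _ c0 h.
rewrite (_ : 12 * _ / (1 - 2^-1) = 24 * p ^+ (2 * m.+1)); last by field.
apply => // k; apply: le_trans (torus_prob_ball_le _ _) _; first by rewrite mulr_ge0// ltW.
rewrite lee_fin expr1 mulrA (_ : 6 * 2 = 12 :> R); last by ring.
by rewrite -mulrA ler_wpM2l// -addSn phalf.
Qed.

(** With [t = p ^ (2 n) / 4] the offset is sought within [t / 2] of [3 t / 2]. That arc has measure
    at least [t / 4], whereas the balls of index above [2 n] have total measure at most
    [24 * p ^ (4 n + 2)], which is less. *)
Lemma exists_good_offset n : exists s, [/\ 4^-1 * p ^+ (2 * n) <= s, s <= 2^-1 * p ^+ (2 * n) &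
  forall i, (2 * n < i)%N -> 2 * p ^+ (2 * i) <= torus_norm (line s - rho *+ i)].
Proof.
set t := 4^-1 * p ^+ (2 * n).
have t0 : 0 < t by rewrite mulr_gt0.
have t1 : t <= 4^-1 by have := pn1 (2 * n); rewrite /t; lra.
pose c := torus_of (line (3 / 2 * t)).
have h2 : 0 < t / 2 <= 1 by apply/andP; split; lra.
have [x [xc xg]] : exists x, ball c (t / 2) x /\ good (2 * n) x.
  apply: contrapT => /forallNP nx.
  have := torus_prob_ball_ge c (ltn0Sn 0) h2; rewrite leNgt => /negP; apply.
  apply: (@le_lt_trans _ _ (torus_prob 1 (~` (good (2 * n) : set (borel (torus R 1)))))).
    apply: le_measure; rewrite ?inE; first exact: measurable_mball.
      by apply: measurableC; exact: measurable_good_set.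
    by move=> x xc xg; exact: (nx x).
  rewrite (le_lt_trans (good_set_compl _))// lte_fin expr1 mulr1.
  rewrite (_ : (2 * (2 * n).+1 = 2 * n + 2 + 2 * n)%N); last by lia.
  rewrite exprD; have := pn1 (2 * n); have := pn (2 * n); have := pn (2 * n + 2).
  have s1 : 384 * p ^+ (2 * n + 2) <= p ^+ (2 * n).+1 by rewrite addn2; exact: psmall.
  have := psmall (2 * n); move: s1; rewrite /t.
  move: (p ^+ _.+1) (p ^+ (_ + _)) (p ^+ _) => a b d s1 s2 b0 d0 d1.
  have : d < 384^-1 by lra.
  nra.
have xE : x = torus_of (torus_rep x) by rewrite torus_of_rep.
move: xc; rewrite ballEmdist/= xE [mdist _ _]torus_distE => xc.
have := int_dist_le_torus_norm (line (3 / 2 * t) - torus_rep x) 0.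
have [k ->] := int_dist_ex ((line (3 / 2 * t) - torus_rep x) 0 0).
rewrite !mxE => /le_lt_trans/(_ xc); set r := torus_rep x 0 0; rewrite ltr_norml => /andP[k1 k2].
exists (r + k%:~R); split.
- by rewrite /t in k1 k2 *; lra.
- by rewrite /t in k1 k2 *; lra.
move=> i /xg; rewrite mulr1 [mdist _ _](_ : _ = torus_norm (line (r + k%:~R) - rho *+ i))//.
rewrite xE [LHS]torus_distE.
rewrite (_ : line _ - _ = torus_rep x - rho *+ i + \row_(_ < 1) k%:~R) ?torus_norm_int//.
by apply/rowP => a; rewrite !mxE (ord1 a) -/r; ring.
Qed.

(** Up to the first idle time [l] the queue serves at least [l - 1] units, while at most
    [(l + maxn n.+1 l) / 16] arrive; for [n > 2] this forces [2 * l <= n]. *)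
Lemma first_rise u n : (2 < n)%N ->
  (forall j, (0 < j)%N -> 2 * p ^+ (2 * maxn n.+1 j) <= torus_norm (u - rho *+ j)) ->
  exists l, [/\ (0 < l)%N, (2 * l <= n)%N & delta <= phi (u - rho *+ l)].
Proof.
move=> n2 uj.
have /exists_delays[Om OmP] : forall j, (0 < j)%N ->
    2 * delta ^+ (maxn n.+1 j %/ 16).+1 <= lift_forcing (u - rho *+ j).
  move=> j j0; apply: (good_lift_forcing H (k := maxn n.+1 j)).
    by rewrite mulr1 uj.
  by rewrite mulnC ltnW// ltn_ceil.
have rise N : (0 < N)%N -> exists l, [/\ (0 < l)%N, (2 * l <= n)%N, (l <= N)%N &
    delta <= P (N - l) (u - rho *+ l)].
  move=> N0; pose Z := backlog Om N.
  have exl : exists l, (0 < l <= N)%N && (Z l == 0%N) by exists N; rewrite N0 leqnn /Z backlogn.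
  case: (ex_minnP exl) => l /andP[/andP[l0 lN] /eqP Zl] lmin.
  exists l; split => //; last first.
    have := ge_boundary_backlog H (u := u) (Om := Om) (m := 0) (n := N) _ (j := l).
    rewrite -/Z Zl expr1 lN; apply => // j _.
    by have [] := OmP j.+1 isT.
  have ZE j : (j < N)%N -> Z j = (Om j.+1 + (Z j.+1).-1)%N by exact: (backlogS H).
  have := @backlog_balance Om Z N 0 l ZE; rewrite lN => /(_ isT); rewrite Zl addn0.
  have : (l.-1 <= \sum_(0 <= j < l) (0 < Z j.+1))%N.
    case: l l0 lN Zl lmin => // l _ lN Zl lmin; rewrite big_nat_recr//=.
    apply: leq_trans (leq_addr _ _).
    rewrite -[leqLHS]subn0 -[leqLHS]muln1 -[leqLHS]sum_nat_const_nat.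
    rewrite big_nat [leqRHS]big_nat; apply: leq_sum => j /andP[_ jl].
    have [Z0|_ //] := posnP (Z j.+1).
    have := lmin j.+1; rewrite Z0 eqxx /= (leq_trans _ lN)// => [/(_ isT)|]; last exact: ltnW.
    by rewrite ltnNge jl.
  have : (16 * \sum_(0 <= j < l) Om j.+1 <= l + 16 * (maxn n.+1 l %/ 16))%N.
    apply: (delay_sum H (u := u)) => j /andP[_ jl].
      have [_ h _] := OmP j.+1 isT; rewrite (leq_trans h)// leq_div2r//.
      by rewrite geq_max leq_maxl/= (leq_trans jl)// leq_maxr.
    by have [] := OmP j.+1 isT.
  have := leq_trunc_div (maxn n.+1 l) 16.
  move: (\sum_(0 <= j < l) Om _)%N (\sum_(0 <= j < l) (0 < _))%N (maxn n.+1 l %/ 16)%N => a b c.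
  by rewrite /maxn; case: ifP => _; lia.
apply: contrapT => nol.
(* The time found by [rise] depends on the horizon [N]. If [phi] were below [delta] at each of the
   finitely many candidates, so would be some finite iterate, and a horizon beyond all of these
   contradicts [rise]. *)
have /boolp.choice[K KP] l : exists k, (0 < l)%N -> (2 * l <= n)%N -> P k (u - rho *+ l) < delta.
  have [l0|] := boolP (0 < l)%N; last by exists 0%N.
  have [ln|] := boolP (2 * l <= n)%N; last by exists 0%N.
  have [|k kP] := @upper_lift_lt _ _ kappa rho delta (u - rho *+ l); last by exists k.
  by rewrite ltNge; apply/negP => h; apply: nol; exists l.
pose N := (n.+1 + \sum_(0 <= l < n.+1) K l)%N.
have [l [l0 ln lN]] := rise N isT.
apply/negP; rewrite -ltNge; apply: le_lt_trans (KP l l0 ln); apply: le_boundary_iter.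
have : (K l <= \sum_(0 <= l < n.+1) K l)%N.
  by rewrite big_mkord (bigD1 (inord l))//= inordK ?leq_addr//; lia.
rewrite /N; move: (\sum_(_ <= _ < _) _)%N => S; lia.
Qed.

(* At the offset [s] from the pinching point the backlog is about [n / 16], and it is
   cleared before time [n / 2], while the orbit of 0 is pinched forever. *)
Lemma exists_rising_arc n : (2 < n)%N -> exists m s, [/\ (0 < m)%N, (n <= 2 * m)%N,
  0 <= s <= 2^-1 * p ^+ (2 * m), good_lift (rho := rho) (p := p) m (rho *+ m + line s) &
  delta <= phi (rho *+ m + line s)].
Proof.
move=> n2; have n0 : (0 < n)%N by lia.
have [s [s1 s2 sg]] := exists_good_offset n.
have s0 : 0 <= s by apply: le_trans s1; rewrite mulr_ge0// ltW.
have n32 k : (k <= 2 * n)%N -> (k <= 32 ^ n)%N.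
  move=> kn; rewrite (leq_trans kn)// (leq_trans (n := 2 * 2 ^ n))//.
    by rewrite leq_mul2l/= ltnW// ltn_expl.
  by rewrite -expnS -[32%N]/(2 ^ 5)%N -expnM leq_exp2l//; lia.
have sk k : (k <= 2 * n)%N -> `|s| <= 2 * p ^+ k.
  by move=> kn; rewrite ger0_norm// (le_trans s2)// ; have := ple kn; have := pn k; lra.
have offset i : (0 < i)%N -> 2 * p ^+ i <= torus_norm (line s - rho *+ i) \/
    (n < i)%N /\ 2 * p ^+ (2 * i) <= torus_norm (line s - rho *+ i).
  move=> i0; have [i_n|ni] := leqP i n.
    left; have [||//] := @near_pinch s i i i0; last by apply: sk; lia.
    by rewrite i0 ltnW// ltn_expl.
  right; split=> //; have [i2n|] := leqP i (2 * n); last exact: sg.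
  have [||h _] := @near_pinch s i n n0; [by rewrite i0 n32|by apply: sk; lia|].
  apply: le_trans h; rewrite ler_pM2l//; apply: ple; lia.
have back m j : (m <= j)%N -> rho *+ m + line s - rho *+ j = line s - rho *+ (j - m).
  by move=> mj; rewrite mulrnBr// opprB [RHS]addrC addrAC.
have [|l [l0 ln ul]] := @first_rise (rho *+ n + line s) n n2.
  move=> j j0; have [jn|nj|->] := ltngtP j n.
  - have -> : rho *+ n + line s - rho *+ j = line s + rho *+ (n - j).
      by rewrite mulrnBr ?(ltnW jn)// addrA [line s + _]addrC.
    have [||_ h] := @near_pinch s (n - j) n n0; [|by apply: sk; lia|].
      by rewrite subn_gt0 jn n32//; lia.
    apply: le_trans h; rewrite ler_pM2l//; apply: ple; rewrite /maxn; case: ifP; lia.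
  - rewrite back ?(ltnW nj)//; have i0 : (0 < j - n)%N by lia.
    have [h|[_ h]] := offset _ i0; apply: le_trans h; rewrite ler_pM2l//; apply: ple.
      by rewrite /maxn; case: ifP; lia.
    by rewrite /maxn; case: ifP; lia.
  (* For [j = n] the distance is [s] itself, at least [p ^ (2 n) / 4]. *)
  rewrite addrAC subrr add0r; have := @le_torus_norm_line s; rewrite ger0_norm// => h.
  apply: le_trans (h _); last by rewrite (le_trans s2)//; have := pn1 (2 * n); lra.
  apply: le_trans s1; have -> : (2 * maxn n.+1 n)%N = (2 * n + 1).+1 by rewrite /maxn; case: ifP; lia.
  have := psmall (2 * n + 1); have := pn (2 * n + 1).+1.
  have : p ^+ (2 * n + 1) <= p ^+ (2 * n) by apply: ple; lia.
  lra.
have l_n : (l <= n)%N by clear -ln; lia.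
exists (n - l)%N, s; have lE : rho *+ n + line s - rho *+ l = rho *+ (n - l) + line s.
  by rewrite mulrnBr// addrAC.
split; [by clear -n0 ln; lia|by clear -ln; lia| | |by rewrite -lE].
  by rewrite s0 (le_trans s2)// ler_pM2l//; apply: ple; rewrite leq_mul2l/= leq_subr.
move=> j mj; rewrite mulr1 back ?(ltnW mj)//.
have i0 : (0 < j - (n - l))%N by rewrite subn_gt0.
by have [h|[_ h]] := offset _ i0; apply: le_trans h; rewrite ler_pM2l//; apply: ple; clear -mj; lia.
Qed.

Definition crest m : set phase :=
  graph_over kappa rho ([set x | mdist (tau m) x <= 2^-1 * p ^+ (2 * m)] `&` good m).

Lemma measurable_crest m : measurable (crest m : set (borel phase)).
Proof.
apply: measurable_graph_over; apply: measurableI; last exact: measurable_good_set.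
exact: measurable_cball.
Qed.

(** For [m < n] a point over the arc of index [n] is within [p ^ (2 n) / 2] of [n rho], while
    [good m] demands a distance of [2 * p ^ (2 n)]. *)
Lemma trivIset_crest : trivIset setT crest.
Proof.
have h m n q : (m < n)%N -> crest m q -> crest n q -> False.
  move=> mn [_ [_ /(_ n mn)]] + [_ [+ _]]; rewrite /= mulr1 metric_sym => h1 h2.
  have := le_trans h1 h2; have := pn (2 * n); lra.
apply/trivIsetP => m n _ _ mn; apply/seteqP; split => // q [qm qn].
have [nm|nm|nm] := ltngtP m n; [exact: h nm qm qn|exact: h nm qn qm|].
by rewrite nm eqxx in mn.
Qed.

(** Since [B * p ^ 65 = 4 * p <= 1], the power [B ^ (3 m + 1)] is cancelled by
    [p ^ (65 * (3 m + 1))], and two spare factors of [p] beat the numerical constants. The number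
    150 ensures [300 m >= 65 * (3 m + 1) + 34] for [m >= 1]. *)
Lemma lip_const_small m M : (0 < m)%N -> (150 * m <= M)%N ->
  16 * L m * p ^+ (2 * M) <= 2^-1 * delta.
Proof.
have pp := p0; have p384 := regime_p_le H; move=> m0 mM; set B := 4 * kappa%:num.
have B0 : 0 <= B by rewrite mulr_ge0.
have BE : B * p ^+ 65 = 4 * p.
  by rewrite /B exprSr mulrA -[4 * _ * _]mulrA (regime_kappa H) mulr1.
have Bk k : B ^+ k * p ^+ (65 * k) <= 1.
  by rewrite exprM -exprMn BE exprn_ile1//; lra.
have : p ^+ (2 * M) <= p ^+ (65 * (3 * m + 1)) * p ^+ 34.
  by rewrite -exprD; apply: ple; lia.
rewrite /lip_const -/B => h1; have := Bk (3 * m + 1)%N.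
have : 0 <= B ^+ (3 * m + 1) by rewrite exprn_ge0.
have := psmall 32; have := psmall 33; have := pn 34; have := pn (65 * (3 * m + 1)).
move: (B ^+ _) h1; set a := p ^+ (2 * M); set b := p ^+ (65 * _).
set d := p ^+ 34; set e := p ^+ 33; set f := p ^+ 32.
move=> w h1 b0 d0 h2 h3 w0 wb.
have : w * a <= d.
  apply: (le_trans (ler_wpM2l w0 h1)); rewrite mulrA ler_piMl// ltW//.
by rewrite (_ : 16 * (8 * w) * a = 128 * (w * a)); [lra|ring].
Qed.

(* Over the arc the graph climbs from 0 to [delta]; the balls taken out of the arc have
   indices at least [150 m], and a Lipschitz extension climbs little over them, so the
   graph itself has a large vertical projection. *)
Lemma hausdorff_crest m s : (0 < m)%N -> 0 <= s <= 2^-1 * p ^+ (2 * m) ->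
  good_lift (rho := rho) (p := p) m (rho *+ m + line s) -> delta <= phi (rho *+ m + line s) ->
  ((4^-1 * delta)%:E <= hausdorff_measure 1 (crest m))%E.
Proof.
move=> m0 /andP[s0 s1] sgood srise.
pose v t := rho *+ m + line t.
have vB t t' : v t - v t' = line (t - t') by rewrite /v opprD addrACA subrr add0r lineB.
have vj t j : (m <= j)%N -> v t - rho *+ j = line t - rho *+ (j - m).
  by move=> mj; rewrite /v mulrnBr// opprB [RHS]addrC addrAC.
pose E := [set t | 0 <= t <= s /\ good_lift (rho := rho) (p := p) m (v t)].
have E0 : E 0.
  split; first by rewrite lexx.
  move=> j mj; rewrite mulr1 vj ?(ltnW mj)//.
  have i0 : (0 < j - m)%N by lia.
  have [||h _] := @near_pinch 0 (j - m) (j - m) i0.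
  - by rewrite i0 ltnW// ltn_expl.
  - by rewrite normr0 mulr_ge0// ltW.
  by apply: le_trans h; rewrite ler_pM2l//; apply: ple; lia.
have Es : E s by split=> //; rewrite s0 lexx.
have L0 : 0 <= L m by have := lip_const_ge1 H m; lra.
have [|t t' [_ tg] [_ tg']|g [gE gL]] :=
    @lipschitz_extension _ E (fun t => phi (v t)) (L m) 0 (ex_intro _ 0 E0) L0.
- by move=> t; exact: upper_lift_ge0.
- rewrite (le_trans (upper_lift_lipschitz H tg tg'))// ler_wpM2l// vB.
  exact: torus_norm_line.
(* The lower bound is for [lip_const_small]. The upper one gives [M <= 512 m <= 32 ^ (2 m)], within
   reach of the recurrence condition at level [2 m]. *)
have [M [mM Mm]] : exists M, (150 * m <= M)%N /\ (M <= 512 * m)%N.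
  by exists (150 * m)%N; rewrite leqnn leq_mul2r orbT.
pose S j := [set t | 0 <= t <= s /\ torus_norm (v t - rho *+ j) < 2 * p ^+ (2 * j)].
pose K k : set R := [set` `[g (xget 0 (S (M + k)%N)) - 4 * L m * p ^+ (2 * (M + k)),
  g (xget 0 (S (M + k)%N)) + 4 * L m * p ^+ (2 * (M + k))]].
have mK k : measurable (K k) by exact: measurable_itv.
(* A removed ball meeting the arc is a close return to [m rho], and returns this close take more
   than [32 ^ (2 m)] steps. *)
have far j : (m < j)%N -> S j !=set0 -> (M <= j)%N.
  move=> mj [t [/andP[t0 ts]]]; rewrite vj ?(ltnW mj)// => tj.
  rewrite leqNgt; apply/negP => jM; move: tj; apply/negP; rewrite -leNgt.
  have i0 : (0 < j - m <= 32 ^ (2 * m))%N.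
    rewrite subn_gt0 mj/= (leq_trans (leq_subr _ _))// (leq_trans (ltnW jM))//.
    rewrite (leq_trans Mm)// expnM -[(32 ^ 2)%N]/(512 * 2)%N expnMn leq_mul//.
      by rewrite -{1}(expn1 512) leq_pexp2l.
    by rewrite ltnW// ltn_expl.
  have m2 : (0 < 2 * m)%N by lia.
  have [|h _] := @near_pinch t _ _ m2 i0.
    by rewrite ger0_norm// (le_trans ts)// (le_trans s1)//; have := pn (2 * m); lra.
  by apply: le_trans h; rewrite ler_pM2l//; apply: ple; lia.
have cover : [set` `[0, delta]] `<=` [set q.2%:num | q in crest m] `|` \bigcup_k K k.
  move=> y /=; rewrite in_itv/= => /andP[y0 yd].
  have gs : delta <= g s by rewrite gE.
  have g0 : g 0 = 0.
    by rewrite gE// /v line0 addr0 upper_lift_pinch.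
  have [||t] := @IVT R g 0 s y s0.
  - by apply: continuous_subspaceT; exact: (lipschitz_continuous L0 gL).
  - by rewrite g0 ge_min y0/= le_max (le_trans yd gs) orbT.
  rewrite in_itv/= => t0s gt.
  have [Et|nEt] := pselect (E t).
    left; exists (graph_map kappa rho (torus_of (v t))); last by rewrite /= -gt gE.
    split; first exact: graph_map_in.
    split=> /=.
      rewrite [mdist _ _]torus_distE /v opprD addrA subrr add0r torus_normN.
      by case/andP: t0s => t0 ts; rewrite (le_trans (torus_norm_line t))// ger0_norm//; lra.
    by move=> j mj; rewrite [mdist _ _]torus_distE; case: Et => _; exact.
  right; have [j mj tj] : exists2 j, (m < j)%N & S j t.
    apply: contrapT => nj; apply: nEt; split=> // j mj.
    rewrite mulr1 leNgt; apply/negP => tj; apply: nj; exists j => //.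
  have Mj := far j mj (ex_intro _ t tj).
  exists (j - M)%N => //; rewrite /K /= subnKC// in_itv/=.
  have [/andP[x0 xs] xj] : S j (xget 0 (S j)) := xgetPex 0 (ex_intro _ t tj).
  set x := xget 0 (S j) in x0 xs xj *.
  have tx : `|t - x| <= 4 * p ^+ (2 * j).
    case: tj => /andP[t0 ts] tj; apply: le_trans (le_torus_norm_line _) _.
      have q1 := pn1 (2 * m); rewrite ler_norml.
      by apply/andP; split; clear -t0 ts x0 xs s1 q1; lra.
    rewrite -vB (_ : v t - v x = (v t - rho *+ j) + - (v x - rho *+ j)); last first.
      by rewrite opprB addrA subrK.
    by rewrite (le_trans (torus_normD _ _))// torus_normN; lra.
  have := gL t x; rewrite gt => /le_trans/(_ (ler_wpM2l L0 tx)).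
  by rewrite ler_norml => /andP[h1 h2]; apply/andP; split; lra.
have := lebesgue_le_hausdorff1 (measurable_itv `[0, delta]) mK cover.
rewrite lebesgue_measure_itv/= lte_fin (pn 32) -EFinB subr0 => h.
have sumK : (\sum_(0 <= k <oo) lebesgue_measure (K k) <= (2^-1 * delta)%:E)%E.
  have c0 : 0 <= 8 * L m * p ^+ (2 * M) by rewrite !mulr_ge0// ltW.
  have q01 : 0 <= (2^-1 : R) < 1 by apply/andP; split; lra.
  have := @nneseries_geometric_le R (fun k => lebesgue_measure (K k)) _ _ c0 q01.
  rewrite (_ : 8 * L m * _ / (1 - 2^-1) = 16 * L m * p ^+ (2 * M)); last by field.
  move=> h2; apply: le_trans (h2 _ _) _; last by rewrite lee_fin (lip_const_small m0 mM).
  - by move=> k; exact: measure_ge0.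
  move=> k; rewrite /K lebesgue_measure_itv/=.
  have hk : 8 * L m * p ^+ (2 * (M + k)) <= 8 * L m * p ^+ (2 * M) * 2^-1 ^+ k.
    by rewrite -[leRHS]mulrA ler_wpM2l ?phalf// mulr_ge0.
  case: ifP => _; last by rewrite lee_fin !mulr_ge0// ?exprn_ge0// ltW.
  by rewrite -EFinB lee_fin; apply: le_trans hk; lra.
have H0 := hausdorff_ge0 1 (crest m).
move: h sumK; move: (\sum_(0 <= _ <oo) _)%E (hausdorff_measure _ _) H0.
move=> [a||] [b||]//= b0; rewrite ?leey// ?lee_fin => h1 h2; lra.
Qed.

Lemma hausdorff_circle_infinite : hausdorff_measure 1 (upper_graph_set kappa rho) = +oo%E.
Proof.
have oneN0 : 1 != 0 :> R by exact: oner_neq0.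
pose h1 : {measure set (borel phase) -> \bar R} := hausdorff_borel oneN0.
apply/eqP; rewrite -leye_eq.
apply: (@le_trans _ _ (h1 (\bigcup_m (crest m : set (borel phase))))); last first.
  by apply: le_hausdorff => q [m _ []].
have mU : measurable (\bigcup_m (crest m : set (borel phase))).
  by apply: bigcupT_measurable => m; exact: measurable_crest.
rewrite (measure_semi_bigcup h1 _ trivIset_crest mU); last first.
  by move=> m; exact: measurable_crest.
have d0 : 0 < 4^-1 * delta by rewrite mulr_gt0.
have big N : exists2 m, (N <= m)%N & ((4^-1 * delta)%:E <= h1 (crest m))%E.
  have [|m [s [m0 Nm s01 sg sr]]] := @exists_rising_arc (2 * N + 3); first by lia.
  by exists m; [lia|exact: hausdorff_crest s01 sg sr].
have c0 m : (0 <= h1 (crest m))%E by exact: measure_ge0.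
have many k : exists N, ((k%:R * (4^-1 * delta))%:E <= \sum_(0 <= m < N) h1 (crest m))%E.
  elim: k => [|k [N NP]]; first by exists 0%N; rewrite big_geq// mul0r.
  have [m Nm mP] := big N; exists m.+1; rewrite big_nat_recr//=.
  rewrite mulrSr mulrDl mul1r EFinD leeD// (le_trans NP)//.
  by apply: lee_sum_nneg_natr.
rewrite leye_eq; apply/eqP/eqyP => t t0.
have [N NP] := many (Num.truncn (t / (4^-1 * delta))).+1.
apply: le_trans (nneseries_lim_ge N (fun m _ _ => c0 m)); apply: le_trans NP.
by rewrite lee_fin -ler_pdivrMr// ltW// truncnS_gt.
Qed.

End circle.

(** * The Diophantine condition *)

Lemma exists_root64 {R : realType} (x : R) : 0 < x -> exists2 p, 0 < p & x * p ^+ 64 = 1.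
Proof.
move=> x0; exists (x `^ (- 64^-1)); first exact: powR_gt0.
rewrite -powR_mulrn ?powR_ge0// -powRrM mulNr mulVf// powRN powRr1 ?ltW//.
by rewrite mulfV// gt_eqF.
Qed.

(** For [n <= 32 ^ i] the Diophantine bound is at least [c * Q ^ (- i)] with [Q = 32 ^ e]. One
    factor [p] absorbs [4 * D * Q / c], and the remaining [(p * Q) ^ (i - 1)] is at most 1. *)
Lemma regime_of_diophantine {R : realType} (c d p : R) (D e : nat) (kappa : {nonneg R})
    (rho : 'rV[R]_D) : (0 < D)%N -> 0 < c -> d <= e%:R -> diophantine c d rho ->
  0 < p -> p * (96 * D%:R) <= 4^-1 -> p * 32 ^+ e <= 1 -> p * (4 * D%:R * 32 ^+ e) <= c ->
  kappa%:num * p ^+ 64 = 1 -> regime kappa rho p.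
Proof.
move=> D0 c0 de dio p0 p1 p2 p3 kp; split=> // i n i0 /andP[n0 ni].
set Q : R := 32 ^+ e in p2 p3.
have Q0 : 0 < Q by rewrite exprn_gt0.
have nR : 1 <= n%:R :> R by rewrite ler1n.
have nE : 0 < n%:R ^+ e :> R by rewrite exprn_gt0// (lt_le_trans ltr01).
have h : c * (n%:R ^+ e)^-1 <= torus_norm (rho *+ n).
  have := dio n n0; rewrite [mdist _ _]torus_distE subr0; apply: le_trans.
  rewrite ler_wpM2l ?(ltW c0)// powRN -powR_mulrn ?(le_trans ler01)//.
  by rewrite lef_pV2 ?posrE ?powR_gt0 ?(lt_le_trans ltr01)// ler_powR.
apply: le_trans h; rewrite ler_pdivlMr//.
apply: (@le_trans _ _ (4 * D%:R * p ^+ i * Q ^+ i)).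
  rewrite ler_wpM2l ?mulr_ge0 ?exprn_ge0 ?(ltW p0)//.
  rewrite /Q -exprM mulnC exprM lerXn2r ?nnegrE ?exprn_ge0//.
  by rewrite -natrX ler_nat.
rewrite -mulrA -exprMn -(prednK i0) exprS mulrA.
rewrite -[leRHS]mulr1 ler_pM ?mulr_ge0 ?exprn_ge0 ?mulr_ge0 ?(ltW p0) ?(ltW Q0)//.
  by rewrite (_ : _ * (p * Q) = p * (4 * D%:R * Q))//; ring.
by rewrite exprn_ile1 ?mulr_ge0 ?(ltW p0) ?(ltW Q0).
Qed.

Theorem corollary5p6 (R : realType) (c d : R) (hc : 0 < c) (hd : 1 < d) :
  exists (D0 : nat) (kappa0 : nat -> R),
    forall (D : nat) (hD : (0 < D)%N) (rho : 'rV[R]_D) (hrho : diophantine c d rho)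
      (kappa : {nonneg R}) (hkappa : kappa0 D <= kappa%:num),
    let Phi := upper_graph_set kappa rho in
    let mu := @upper_graph_measure R D kappa rho in
    [/\ hausdorff_dim Phi = D%:R%:E,
        (D = 1%N -> hausdorff_measure D%:R Phi = +oo%E) /\
          ((D0 <= D)%N -> (hausdorff_measure D%:R Phi < +oo)%E),
        exact_dimensional mu D%:R,
        has_information_dim mu D%:R &
        rectifiable_measure D mu].
Proof.
pose e := (Num.truncn d).+1; pose Q : R := 32 ^+ e.
have Q0 : 0 < Q by rewrite exprn_gt0.
(* The bound [kappa >= q D ^ 64] means [p * q D <= 1]; each summand after the first supplies one
   smallness condition on [p]. *)
pose q (D : nat) : R := 1 + 384 * D%:R + Q + 4 * D%:R * Q / c.
exists 100%N, (fun D => q D ^+ 64) => D hD rho hrho kappa hkappa Phi mu.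
have DR : 1 <= D%:R :> R by rewrite ler1n.
have DQ : 0 < 4 * D%:R * Q / c by rewrite divr_gt0// mulr_gt0//; lra.
have q1 : 1 <= q D by rewrite /q; lra.
have k0 : 0 < kappa%:num.
  by apply: lt_le_trans hkappa; rewrite exprn_gt0//; lra.
have [p p0 kp] := exists_root64 k0.
have pq : p * q D <= 1.
  have pq0 : 0 <= p * q D by rewrite mulr_ge0 ?(ltW p0)//; lra.
  rewrite -(@ler_pXn2r _ 64)// ?nnegrE// expr1n exprMn mulrC -kp.
  by rewrite ler_wpM2r// exprn_ge0// ltW.
have H : regime kappa rho p.
  apply: (@regime_of_diophantine _ c d p D e) => //.
  - by rewrite ltW// truncnS_gt.
  - have : p * (384 * D%:R) <= p * q D by rewrite ler_wpM2l ?(ltW p0)// /q; lra.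
    lra.
  - by apply: le_trans pq; rewrite ler_wpM2l ?(ltW p0)// -/Q /q; lra.
  - rewrite -[leRHS]mul1r -ler_pdivrMr// -[p * _ / c]mulrA; apply: le_trans pq.
    by rewrite ler_wpM2l ?(ltW p0)// -/Q /q; lra.
rewrite /mu /Phi upper_graph_measureE; split.
- exact: hausdorff_dim_upper_graph H.
- split; last exact: hausdorff_upper_graph_finite H.
  move=> D1; subst D; exact: hausdorff_circle_infinite H.
- exact: exact_dimensional_graph_prob H.
- exact: has_information_dim_graph_prob H.
- exact: rectifiable_graph_prob H.
Qed.
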